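(* Work at the centered unit bubble for $(\sigma,\eta)\in\{(0,2),(1,0)\}$, with Jacobi form $\mathcal B$, projected space $\Sigma_{(0,1)}$ and projected operator $\mathcal L$ as in the context. Let $S_i$ be sources compatible with the Jacobi kernel, let $Z_i:=\mathcal L^{-1}S_i$, and let $X_i\in\Sigma_{(0,1)}$ be arbitrary (all pairings below being assumed finite). Then $$\langle S_i,Z_j\rangle=\langle S_i,X_j\rangle+\langle S_j,X_i\rangle-\mathcal B(X_i,X_j)+\mathcal B(Z_i-X_i,Z_j-X_j).$$ In particular $\langle S_i,Z_i\rangle=2\langle S_i,X_i\rangle-\mathcal B(X_i,X_i)+\mathcal B(Z_i-X_i,Z_i-X_i)$. If each $X_i$ also satisfies $JX_i=S_i$ in the interior, then $$J(Z_i-X_i)=0,\qquad\mathcal B_\partial(Z_i-X_i)=-\mathcal B_\partial X_i,$$ and $$\langle S_i,Z_j\rangle=\frac12\int_{\mathbb R^N_+}(S_iX_j+S_jX_i)-\frac12\int_{\partial\mathbb R^N_+}(X_i\mathcal B_\partial X_j+X_j\mathcal B_\partial X_i)+\langle\mathcal B_\partial X_i,\mathcal R_\perp(\mathcal B_\partial X_j)\rangle_\partial,$$ where the last term is exactly $\mathcal B(Z_i-X_i,Z_j-X_j)$. The first identity holds for any symmetric invertible weak operator on a projected space; the second uses the Green identity of the context. Neither requires positivity of $\mathcal B$.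
   Context: $\mathbb R^N_+=\{x=(\bar x,t):\bar x\in\mathbb R^{N-1},t\ge0\}$, $s=|\bar x|^2$. Energy space $\Sigma$: all $w\in H^1_{\rm loc}(\overline{\mathbb R^N_+})$ with $\nabla w\in L^2$, $w\in L^{2N/(N-2)}$, $w|_{t=0}\in L^{2(N-1)/(N-2)}$, normed by $\|\nabla w\|_2$. Case $(0,2)$: $D=s+(t+1)^2$, $J\psi=-\Delta\psi$, $\mathcal B_\partial\psi=-\partial_t\psi-\frac N{1+s}\psi$ on $t=0$, $\mathcal B(v,\psi)=\int\nabla v\cdot\nabla\psi-N\int_{t=0}\frac{v\psi}{1+s}$. Case $(1,0)$: $D=1+s+t^2$, $J\psi=-\Delta\psi-N(N+2)D^{-2}\psi$, $\mathcal B_\partial\psi=-\partial_t\psi$ on $t=0$, $\mathcal B(v,\psi)=\int\nabla v\cdot\nabla\psi-N(N+2)\int D^{-2}v\psi$. Let $U_{(\xi,\varepsilon)}=\bigl(\frac{\varepsilon}{(\varepsilon+t)^2+|\bar x-\xi|^2}\bigr)^{(N-2)/2}$ for $(0,2)$ and $U_{(\xi,\varepsilon)}=\bigl(\frac{2\varepsilon}{\varepsilon^2+|\bar x-\xi|^2+t^2}\bigr)^{(N-2)/2}$ for $(1,0)$. The Jacobi kernel is the span of $\Phi_\alpha=\partial_{z_\alpha}U_z|_{z=(0,1)}$, $1\le\alpha\le N$. $\Sigma_{(0,1)}$ is the set of $w\in\Sigma$ with $\int_{t=0}U_{(0,1)}^{2/(N-2)}\Phi_\alpha w\,d\bar x=0$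 for all $\alpha$ in case $(0,2)$, respectively $\int_{\mathbb R^N_+}U_{(0,1)}^{4/(N-2)}\Phi_\alpha w\,dx=0$ for all $\alpha$ in case $(1,0)$. $\mathcal L:\Sigma_{(0,1)}\to\Sigma_{(0,1)}^*$, $(\mathcal Lv)(\psi)=\mathcal B(v,\psi)$, is invertible. A source $S$ (a function acting by $\langle S,\psi\rangle=\int_{\mathbb R^N_+}S\psi\,dx$, bounded on $\Sigma$) is compatible with the kernel if $\langle S,\Phi_\alpha\rangle=0$ for all $\alpha$. Green's formula: $\mathcal B(v,\psi)=\int_{\mathbb R^N_+}(Jv)\psi+\int_{\partial\mathbb R^N_+}(\mathcal B_\partial v)\psi$. For boundary forcing $f$ compatible with the kernel, $\mathcal R_\perp f:=v|_{\partial\mathbb R^N_+}$, where $v\in\Sigma_{(0,1)}$ solves $Jv=0$ in the interior and $\mathcal B_\partial v=f$ on the boundary; $\langle f_1,f_2\rangle_\partial=\int_{\partial\mathbb R^N_+}f_1f_2\,d\bar x$. *)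

(* Defs.v *)
From HB Require Import structures.
From mathcomp Require Import all_boot all_order all_algebra.
From mathcomp Require Import all_classical all_reals all_analysis.

Set Implicit Arguments.
Unset Strict Implicit.
Unset Printing Implicit Defensive.

Import Order.TTheory GRing.Theory Num.Theory.
Import numFieldNormedType.Exports.

Local Open Scope classical_set_scope.
Local Open Scope ring_scope.

Definition rV_display : measure_display.
Proof. exact: default_measure_display. Qed.

(* 'rV[R]_n carries the product sigma-algebra of its coordinates, i.e. the
   Borel one. *)
Section measurable_rV.
Context (R : realType) (n : nat).

Let coord (i : 'I_n) (x : 'rV[R]_n) : R := x ord0 i.

Let rV_set0 : g_sigma_preimage coord set0.
Proof. exact: sigma_algebra0. Qed.

Let rV_setC A : g_sigma_preimage coord A -> g_sigma_preimage coord (~` A).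
Proof. exact: sigma_algebraC. Qed.

Let rV_bigcup (F : (set 'rV[R]_n)^nat) :
  (forall i, g_sigma_preimage coord (F i)) ->
  g_sigma_preimage coord (\bigcup_i (F i)).
Proof. exact: sigma_algebra_bigcup. Qed.

HB.instance Definition _ := @isMeasurable.Build rV_display
  'rV[R]_n (g_sigma_preimage coord) rV_set0 rV_setC rV_bigcup.

Lemma measurable_rV_coord (i : 'I_n) :
  measurable_fun [set: 'rV[R]_n] (fun x => x ord0 i : R).
Proof.
move=> _ Y mY; rewrite setTI; apply: sub_sigma_algebra => /=.
rewrite -bigcup_seq/=; exists i => /=; first by rewrite mem_index_enum.
by exists Y => //; rewrite setTI.
Qed.

Lemma measurable_fun_rVP d (T : measurableType d) (f : T -> 'rV[R]_n) :
  (forall i, measurable_fun [set: T] (fun x => f x ord0 i : R)) ->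
  measurable_fun [set: T] f.
Proof.
move=> mf _ Y; rewrite setTI.
suff : g_sigma_preimage coord `<=` [set B | measurable (f @^-1` B)] by apply.
apply: smallest_sub => [|B].
  split => [|B mB|F mF] /=.
  - by rewrite preimage_set0.
  - by rewrite setTD preimage_setC; exact: measurableC.
  - by rewrite preimage_bigcup; exact: bigcupT_measurable.
rewrite -bigcup_seq => -[i _ [C mC <-]] /=; rewrite setTI -comp_preimage.
by rewrite -[_ @^-1` _]setTI; exact: mf.
Qed.

End measurable_rV.

Section lebesgue_rV_succ.
Context (R : realType) (n : nat).

Definition rV_cons (x : measurableTypeR R * 'rV[R]_n) : 'rV[R]_n.+1 :=
  \row_i (if unlift ord0 i is Some j then x.2 ord0 j else x.1 : R).

Lemma measurable_rV_cons : measurable_fun setT rV_cons.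
Proof.
apply: measurable_fun_rVP => i; case: (unliftP ord0 i) => [j|] ->.
- under eq_fun => x do rewrite mxE liftK.
  exact: (measurableT_comp (measurable_rV_coord j)).
- under eq_fun => x do rewrite mxE unlift_none.
  exact: measurable_fst.
Qed.

Definition rV_uncons (y : 'rV[R]_n.+1) : measurableTypeR R * 'rV[R]_n :=
  (y ord0 ord0, \row_j y ord0 (lift ord0 j)).

Lemma rV_consK : cancel rV_cons rV_uncons.
Proof.
move=> [a x]; rewrite /rV_uncons/= mxE unlift_none; congr pair.
by apply/rowP => j; rewrite !mxE liftK.
Qed.

Lemma rV_unconsK : cancel rV_uncons rV_cons.
Proof.
move=> y; apply/rowP => i; rewrite mxE.
by case: unliftP => [j|] ->; rewrite ?mxE.
Qed.

Lemma measurable_rV_uncons : measurable_fun setT rV_uncons.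
Proof.
apply/measurable_fun_pairP; split => /=.
- exact: (measurable_rV_coord ord0).
- apply: measurable_fun_rVP => i; under eq_fun => x do rewrite mxE.
  exact: (measurable_rV_coord (lift ord0 i)).
Qed.

Variable mu : {sigma_finite_measure set 'rV[R]_n -> \bar R}.

Definition lebesgue_rV_succ : set 'rV[R]_n.+1 -> \bar R :=
  pushforward (lebesgue_measure \x mu)%E rV_cons.

Let succ0 : lebesgue_rV_succ set0 = 0%E.
Proof. by rewrite /lebesgue_rV_succ /pushforward preimage_set0 measure0. Qed.

Let succ_ge0 A : (0 <= lebesgue_rV_succ A)%E.
Proof. exact: (measure_ge0 (lebesgue_measure \x mu)%E). Qed.

Let succ_sigma_additive : semi_sigma_additive lebesgue_rV_succ.
Proof.
move=> F mF tF mUF.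
have mpre A : measurable A -> measurable (rV_cons @^-1` A).
  by move=> mA; rewrite -[_ @^-1` _]setTI; exact: measurable_rV_cons.
rewrite /lebesgue_rV_succ /pushforward preimage_bigcup.
apply: (measure_semi_sigma_additive (s := (lebesgue_measure \x mu)%E)).
- by move=> k; exact: mpre.
- apply/trivIsetP => /= i j _ _ ij; rewrite -preimage_setI.
  by move/trivIsetP : tF => /(_ _ _ _ _ ij) ->//; rewrite preimage_set0.
- by rewrite -preimage_bigcup; exact: mpre.
Qed.

HB.instance Definition _ := isMeasure.Build _ _ _ lebesgue_rV_succ
  succ0 succ_ge0 succ_sigma_additive.

Let succ_sigma_finite : sigma_finite setT lebesgue_rV_succ.
Proof.
have /sigma_finiteP[F [TF ndF Foo]] := sigma_finiteT (@lebesgue_measure R).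
have /sigma_finiteP[G [TG ndG Goo]] := sigma_finiteT mu.
exists (fun k => rV_uncons @^-1` (F k `*` G k)).
  rewrite -preimage_bigcup -[LHS](preimage_setT rV_uncons); congr (_ @^-1` _).
  rewrite -setXTT TF TG predeqE => -[x y]; split.
    move=> [/= [i _ Fix] [k _ Gky]]; exists (maxn i k) => //; split.
    - by move: x Fix; exact/subsetPset/ndF/leq_maxl.
    - by move: y Gky; exact/subsetPset/ndG/leq_maxr.
  by move=> [i _ []/= ? ?]; split; exists i.
move=> k; have [mF Fk] := Foo k; have [mG Gk] := Goo k; split.
  by rewrite -[_ @^-1` _]setTI; apply: measurable_rV_uncons => //;
    exact: measurableX.
rewrite /lebesgue_rV_succ /pushforward -comp_preimage.
rewrite (_ : rV_uncons \o rV_cons = id); last exact/funext/rV_consK.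
by rewrite preimage_id product_measure1E// lte_mul_pinfty// ge0_fin_numE.
Qed.

HB.instance Definition _ := Measure_isSigmaFinite.Build _ _ _ lebesgue_rV_succ
  succ_sigma_finite.

End lebesgue_rV_succ.

(* Lebesgue measure on R^n: the product of Lebesgue measure on R with the one on
   R^(n-1), transported along (a, x) |-> (a, x_0, ..., x_(n-2)). *)
Fixpoint lebesgue_rV (R : realType) (n : nat) :
    {sigma_finite_measure set 'rV[R]_n -> \bar R} :=
  match n with
  | 0 => dirac (0 : 'rV[R]_0)
  | m.+1 => lebesgue_rV_succ (lebesgue_rV R m)
  end.

(* The space dimension is N = n.+1 throughout: a point of R^N is a pair
   x = (x.1, x.2) with x.1 in R^(N-1) tangential and x.2 the normal variable t,
   and the boundary {t = 0} is identified with 'rV[R]_n. *)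
Definition pt (R : realType) (n : nat) : Type :=
  ('rV[R]_n * measurableTypeR R)%type.

Section half_space.
Context (R : realType) (n : nat).
Local Notation pt := (pt R n).
Local Notation bpt := 'rV[R]_n.
Local Notation N := (n.+1%:R : R).

Definition lebesgue_pt : {measure set pt -> \bar R} :=
  (lebesgue_rV R n \x lebesgue_measure)%E.

(* The open half-space; it differs from the closed one by a null set. *)
Definition half_space : set pt := [set x | 0 < (x.2 : R)].

Definition bdry (y : bpt) : pt := (y, 0 : R).

Definition dotp (x y : pt) : R :=
  \sum_(i < n) x.1 ord0 i * y.1 ord0 i + (x.2 : R) * (y.2 : R).

Definition sqnorm (y : bpt) : R := \sum_(i < n) y ord0 i ^+ 2.

(* The canonical basis of R^N, the normal direction being the last one. *)
Definition dir (a : 'I_n.+1) : pt :=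
  if unlift ord_max a is Some i then (delta_mx ord0 i, 0 : R) else (0, 1 : R).

Definition int_H (f : pt -> R) : R := \int[lebesgue_pt]_(x in half_space) f x.
Definition int_bd (f : bpt -> R) : R := \int[lebesgue_rV R n]_y f y.

Definition integrable_H (f : pt -> R) : Prop :=
  lebesgue_pt.-integrable half_space (EFin \o f).
Definition integrable_bd (f : bpt -> R) : Prop :=
  (lebesgue_rV R n).-integrable setT (EFin \o f).

(* C^1 functions on R^N with compact support in Om.  With Om = setT these
   restrict to the C^1_c functions on the closed half-space, with
   Om = half_space they are the C^1_c functions of the open one. *)
Definition C1c (Om : set pt) (phi : pt -> R) : Prop :=
  [/\ forall x, differentiable phi x,
      forall e, continuous ('D_e phi)
    & exists K, [/\ compact K, K `<=` Om & forall x, ~ K x -> phi x = 0]].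

Definition gradient (phi : pt -> R) (x : pt) : pt :=
  (\row_i 'D_((delta_mx ord0 i, 0 : R) : pt) phi x,
   'D_((0, 1 : R) : pt) phi x).

(* A weakly differentiable function is carried together with its weak gradient
   and its trace on {t = 0}, which it determines up to null sets.  The
   operations of this lmodType are pointwise on the three components. *)
Definition wfun : Type := ((pt -> R) * (pt -> pt) * (bpt -> R))%type.

Definition fn (w : wfun) : pt -> R := w.1.1.
Definition grad (w : wfun) : pt -> pt := w.1.2.
Definition tr (w : wfun) : bpt -> R := w.2.

(* The divergence theorem for phi * w * e with outer normal -e_t; this
   characterizes both the weak gradient and the trace. *)
Definition has_grad_tr (w : wfun) : Prop :=
  forall (phi : pt -> R) (e : pt), C1c setT phi ->
    int_H (fun x => fn w x * 'D_e phi x) =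
    - int_H (fun x => dotp (grad w x) e * phi x)
    - (e.2 : R) * int_bd (fun y => tr w y * phi (bdry y)).

Definition L2loc (f : pt -> R) : Prop := forall r : R,
  f \_ (half_space `&` [set x | `|x| <= r]) \in Lfun lebesgue_pt 2%:E.

Definition in_Sigma (w : wfun) : Prop :=
  [/\ [/\ has_grad_tr w, L2loc (fn w)
        & forall a, L2loc (fun x => dotp (grad w x) (dir a))],
      forall a, (fun x => dotp (grad w x) (dir a)) \_ half_space
        \in Lfun lebesgue_pt 2%:E,
      fn w \_ half_space \in Lfun lebesgue_pt (2 * N / (N - 2))%:E
    & tr w \in Lfun (lebesgue_rV R n) (2 * (N - 1) / (N - 2))%:E].

Definition energy_norm (w : wfun) : R :=
  Num.sqrt (int_H (fun x => dotp (grad w x) (grad w x))).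

(* The two values (sigma, eta) = (0, 2) and (sigma, eta) = (1, 0). *)
Variant regime := regime02 | regime10.

Definition bubble (c : regime) (z x : pt) : R :=
  let xi := z.1 in let eps : R := z.2 in let t : R := x.2 in
  match c with
  | regime02 => (eps / ((eps + t) ^+ 2 + sqnorm (x.1 - xi))) `^ ((N - 2) / 2)
  | regime10 =>
      (2 * eps / (eps ^+ 2 + sqnorm (x.1 - xi) + t ^+ 2)) `^ ((N - 2) / 2)
  end.

Definition z01 : pt := (0, 1 : R).

Definition Phi (c : regime) (a : 'I_n.+1) (x : pt) : R :=
  'D_(dir a) (fun z => bubble c z x) z01.

Definition in_Sigma01 (c : regime) (w : wfun) : Prop :=
  in_Sigma w /\
  forall a : 'I_n.+1,
    match c with
    | regime02 =>
        int_bd (fun y => bubble c z01 (bdry y) `^ (2 / (N - 2)) *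
                         Phi c a (bdry y) * tr w y) = 0
    | regime10 =>
        int_H (fun x => bubble c z01 x `^ (4 / (N - 2)) * Phi c a x * fn w x)
        = 0
    end.

Definition D10 (x : pt) : R := 1 + sqnorm x.1 + (x.2 : R) ^+ 2.

Definition B (c : regime) (v psi : wfun) : R :=
  int_H (fun x => dotp (grad v x) (grad psi x)) -
  match c with
  | regime02 => N * int_bd (fun y => tr v y * tr psi y / (1 + sqnorm y))
  | regime10 =>
      N * (N + 2) * int_H (fun x => D10 x ^- 2 * fn v x * fn psi x)
  end.

Definition pairing (S : pt -> R) (psi : wfun) : R :=
  int_H (fun x => S x * fn psi x).

Definition source (S : pt -> R) : Prop :=
  exists C : R, forall psi, in_Sigma psi ->
    integrable_H (fun x => S x * fn psi x) /\
    `|pairing S psi| <= C * energy_norm psi.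

Definition compatible (c : regime) (S : pt -> R) : Prop :=
  forall a : 'I_n.+1, int_H (fun x => S x * Phi c a x) = 0.

(* Z = L^-1 S, where (L v)(psi) = B(v, psi) on Sigma_(0,1). *)
Definition is_Linv (c : regime) (S : pt -> R) (Z : wfun) : Prop :=
  in_Sigma01 c Z /\
  forall psi, in_Sigma01 c psi -> B c Z psi = pairing S psi.

(* Delta v = k in the sense of distributions in the open half-space. *)
Definition weak_laplacian (v : wfun) (k : pt -> R) : Prop :=
  forall phi, C1c half_space phi ->
    integrable_H (fun x => k x * phi x) /\
    int_H (fun x => dotp (grad v x) (gradient phi x)) =
    - int_H (fun x => k x * phi x).

(* The normal derivative d_t v = p on {t = 0} of v with Delta v = k, in the
   usual weak sense of Green's first identity tested over the energy space,
   as far as the pairings are finite.  Local integrability up to the boundary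
   makes all C^1_c functions of the closed half-space admissible. *)
Definition weak_normal_derivative
    (v : wfun) (k : pt -> R) (p : bpt -> R) : Prop :=
  [/\ forall r : R, lebesgue_pt.-integrable
        (half_space `&` [set x | `|x| <= r]) (EFin \o k),
      forall r : R, (lebesgue_rV R n).-integrable
        [set y | `|y| <= r] (EFin \o p)
    & forall psi, in_Sigma psi ->
        integrable_H (fun x => k x * fn psi x) ->
        integrable_bd (fun y => p y * tr psi y) ->
        int_H (fun x => dotp (grad v x) (grad psi x)) =
        - int_H (fun x => k x * fn psi x) - int_bd (fun y => p y * tr psi y)].

(* J v and B_bd v, where k is the Laplacian of v and p its normal
   derivative d_t v on {t = 0}. *)
Definition J_of (c : regime) (v : wfun) (k : pt -> R) (x : pt) : R :=
  match c with
  | regime02 => - k x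
  | regime10 => - k x - N * (N + 2) * D10 x ^- 2 * fn v x
  end.

Definition Bbd_of (c : regime) (v : wfun) (p : bpt -> R) (y : bpt) : R :=
  match c with
  | regime02 => - p y - N / (1 + sqnorm y) * tr v y
  | regime10 => - p y
  end.

Definition J_eq (c : regime) (v : wfun) (g : pt -> R) : Prop :=
  exists2 k, weak_laplacian v k &
    forall x, half_space x -> J_of c v k x = g x.

(* B_bd v = f on the boundary, for v with J v = g in the interior (the weak
   normal derivative depends on the Laplacian of v being a function). *)
Definition Bbd_eq (c : regime) (v : wfun) (g : pt -> R) (f : bpt -> R) : Prop :=
  exists k p, [/\ weak_laplacian v k, weak_normal_derivative v k p,
    forall x, half_space x -> J_of c v k x = g x
    & forall y, Bbd_of c v p y = f y].

Definition bd_pairing (f1 f2 : bpt -> R) : R := int_bd (fun y => f1 y * f2 y).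

Definition bd_forcing (f : bpt -> R) : Prop :=
  exists C : R, forall psi, in_Sigma psi ->
    integrable_bd (fun y => f y * tr psi y) /\
    `|bd_pairing f (tr psi)| <= C * energy_norm psi.

Definition bd_compatible (c : regime) (f : bpt -> R) : Prop :=
  forall a : 'I_n.+1, bd_pairing f (fun y => Phi c a (bdry y)) = 0.

(* r = R_perp f; the forcings are the bounded functionals of Sigma acting by
   integration over the boundary and orthogonal to the kernel. *)
Definition is_Rperp (c : regime) (f r : bpt -> R) : Prop :=
  [/\ bd_forcing f, bd_compatible c f
    & exists v, [/\ in_Sigma01 c v, J_eq c v (fun=> 0), Bbd_eq c v (fun=> 0) f
                  & r = tr v]].

End half_space.

(* Main.v *)
(** The kernel functions [Phi_a] lie in Sigma and are annihilated by [B]: test the weak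
    gradient of [v] against a compactly supported cut-off of the classical gradient of
    [Phi_a] and let the cut-off tend to 1.  Their Gram matrix for the weighted L^2
    product defining Sigma_(0,1) is positive definite, so Sigma is the sum of Sigma_(0,1)
    and the kernel; since a compatible source also vanishes on the kernel,
    [B(Z, psi) = <S, psi>] holds for every [psi] in Sigma.  With this the energy identity
    is bilinear algebra, and so is the boundary formula after Green's identity, which
    gives [B(X_i - Z_i, psi) = <B_bd X_i, psi>] on Sigma.  In particular [X_i - Z_i]
    itself represents [R_perp (B_bd X_i)], and no uniqueness of [R_perp] is needed: for
    any representative [v] one has
    [<B_bd X_i, v> = B(X_i - Z_i, v) = <B_bd X_j, X_i - Z_i> = B(X_i - Z_i, X_j - Z_j)]. *)
Require Import Defs.
From HB Require Import structures.
From mathcomp Require Import all_boot all_order all_algebra.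
From mathcomp Require Import all_classical all_reals all_analysis.
From mathcomp Require Import measurable_realfun ring lra.

Import Order.TTheory GRing.Theory Num.Theory.
Import numFieldNormedType.Exports.

Local Open Scope classical_set_scope.
Local Open Scope ring_scope.

Set Implicit Arguments.
Unset Strict Implicit.

(** The weak gradient may be tested only against compactly supported C^1 functions on all of R^N,
    while grad Phi_a has unbounded support and, in case (0,2), is singular at the point (0, -1)
    below the boundary. This shapes both constructions around the kernel: powers of D are powers of
    a positive C^1 extension, and the cut-off is a function of D itself. The only error in the
    divergence is then the derivative of the cut-off times grad D . grad Phi_a. That derivative is
    at most 2/D whatever the cut-off level, so the error is O(D^(-N/2)), which pairs integrably with
    L^(2N/(N-2)) for N >= 3, and dominated convergence removes it. Integrals are total functions
    with a default value when they diverge, so each use of linearity has to be preceded by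
    integrability. For products with members of Sigma this comes from Young's inequality and
    comparison with two weights, D10^(-3N/5) and (1+s)^(-3(N-1)/5). The parameter [kap], 1 in case
    (0,2) and 0 in case (1,0), lets one computation serve both cases. *)

Local Notation lebesgue_pt := Defs.lebesgue_pt.
Local Notation bdry := (@Defs.bdry _ _).


(** * Open sets and continuous functions are measurable on R^N *)

Section measurability.
Context (R : realType) (n : nat).
Implicit Types (x : pt R n) (c : 'rV[R]_n) (t r : R).

Definition box c t r : set (pt R n) :=
  [set x : pt R n | (forall i, `|x.1 ord0 i - c ord0 i| < r) /\ `|(x.2 : R) - t| < r].

Lemma measurable_box c t r : measurable (box c t r).
Proof.
have -> : box c t r = (\bigcap_(i in [set: 'I_n])
    (fun x : pt R n => x.1 ord0 i) @^-1` [set s | `|s - c ord0 i| < r]) `&`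
    (fun x : pt R n => x.2 : R) @^-1` [set s | `|s - t| < r].
  apply/seteqP; split => x [a b]; split => // i; [by move=> _; exact: a|].
  exact: a.
have mb (s : R) : measurable ([set u : measurableTypeR R | `|u - s| < r]).
  have -> : [set u : measurableTypeR R | `|u - s| < r] =
      [set` `](s - r), (s + r)[] :> set R.
    by apply/seteqP; split => u /=; rewrite in_itv/= distrC ltr_distlC.
  exact: measurable_itv.
apply: measurableI; last first.
  by rewrite -[X in measurable X]setTI; apply: measurable_snd.
apply: fin_bigcap_measurable => // i _.
rewrite -[X in measurable X]setTI.
apply: (measurableT_comp (measurable_rV_coord i) measurable_fst) => //.
exact: mb.
Qed.

Lemma ball_pt x e (y : pt R n) : 0 < e ->
  (forall i, `|x.1 ord0 i - y.1 ord0 i| < e) -> `|(x.2 : R) - y.2| < e ->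
  ball x e y.
Proof.
move=> e0 h1 h2; split => //; split => // i j; rewrite ord1; exact: h1.
Qed.

(** The sigma-algebra is generated by the coordinates, so it contains the boxes; the countably many
    boxes with rational centre and radius that lie in [U] already cover [U]. *)
Lemma open_measurable_pt (U : set (pt R n)) : open U -> measurable U.
Proof.
move=> oU.
pose q2 (q : 'rV[rat]_n * rat * rat) : set (pt R n) :=
  box (map_mx ratr q.1.1) (ratr q.1.2) (ratr q.2).
have -> : U = \bigcup_q (if `[< q2 q `<=` U >] then q2 q else set0).
  apply/seteqP; split => [x Ux|x [q _]]; last by case: asboolP => // h; exact: h.
  have /nbhs_ballP[e /= e0 eU] := open_nbhs_nbhs (conj oU Ux).
  (* A rational radius r < e/2 and a rational centre within r of [x]: the box contains [x], and all
     its points are within 2r < e of [x]. *)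
  have e2 : 0 < e / 2 by rewrite divr_gt0.
  have [r /[!in_itv]/= /andP[r0 re]] := rat_in_itvoo e2.
  have hq (s : R) : exists q : rat, `|s - ratr q| < ratr r.
    have [q /[!in_itv]/= h] := @rat_in_itvoo _ (s - ratr r) (s + ratr r)
      ltac:(lra).
    by exists q; rewrite ltr_distlC.
  pose q := fun s => projT1 (cid (hq s)).
  have hqs s : `|s - ratr (q s)| < ratr r := projT2 (cid (hq s)).
  exists (\row_i q (x.1 ord0 i), q x.2, r) => //.
  case: asboolP => [_|[]]; first by split => //= i; rewrite !mxE.
  move=> y [/= y1 y2]; apply: eU; apply: ball_pt => // [i|].
    move: (y1 i) (hqs (x.1 ord0 i)); rewrite !mxE => h1 h2.
    rewrite -(subrK (ratr (q (x.1 ord0 i))) (x.1 ord0 i)) -addrA.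
    rewrite (le_lt_trans (ler_normD _ _))// [e]splitr ltrD//.
      exact: lt_trans h2 re.
    by rewrite distrC (lt_trans h1).
  rewrite -(subrK (ratr (q x.2)) (x.2 : R)) -addrA.
  rewrite (le_lt_trans (ler_normD _ _))// [e]splitr ltrD//.
    exact: lt_trans (hqs _) re.
  by rewrite distrC (lt_trans y2).
apply: countable_bigcupT_measurable => [|q]; first exact: countableP.
by case: asboolP => // _; exact: measurable_box.
Qed.

Lemma continuous_measurable_pt (f : pt R n -> R) :
  continuous f -> measurable_fun setT f.
Proof.
move=> /continuousP cf; apply: (measurability _ (measurable_realfun.RGenOpens.measurableE R)).
move=> _ [_ [a [b ->]] <-]; rewrite setTI; apply: open_measurable_pt.
exact/cf/interval_open.
Qed.

Lemma continuous_measurable_rV (f : 'rV[R]_n -> R) :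
  continuous f -> measurable_fun setT f.
Proof.
move=> cf.
(* Extending [f] constantly in t reduces the claim to [pt]; the slice t = 0 then recovers [f]. *)
have : measurable_fun setT (fun x : pt R n => f x.1).
  apply: continuous_measurable_pt => x.
  by apply: continuous_comp; [exact: cvg_fst|exact: cf].
move=> h; apply: (measurableT_comp h (g := fun y : 'rV[R]_n => ((y, 0 : R) : pt R n))).
by apply/measurable_fun_pairP; split; [exact: measurable_id|exact: measurable_cst].
Qed.

End measurability.

(** * An integrable weight on the line *)

Section decay1.
Context (R : realType).

(* Any exponent in ]1/2, 1[ would do: 2 * 3/5 > 1 makes [decay1] integrable, and the
   products of [decay1] over the coordinates dominate the weights D10 ^ (- N). *)
Definition decay1 (x : R) : R := (1 + x ^+ 2) `^ (- (3 / 5)).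

Lemma decay1_ge0 x : 0 <= decay1 x. Proof. exact: powR_ge0. Qed.

Lemma continuous_decay1 : continuous decay1.
Proof.
move=> x; apply: (@continuous_comp R R R (fun x => 1 + x ^+ 2)
    (fun u => u `^ (- (3 / 5))) x).
  by apply: cvgD; [exact: cvg_cst|exact: exprn_continuous].
apply/differentiable_continuous/derivable1_diffP/derivable_powR.
by rewrite in_itv/= andbT ltr_pwDl// sqr_ge0.
Qed.

(** This is (1 + x)^2 <= 2 (1 + x^2) raised to the power 3/5. The majorant has an elementary
    primitive. *)
Lemma decay1_le (x : R) : 0 <= x ->
  decay1 x <= 2 `^ (3 / 5) * (1 + x) `^ (- (6 / 5)).
Proof.
move=> x0; have x1 : 0 < 1 + x by lra.
have -> : - (6 / 5) = 2 * - (3 / 5) :> R by lra.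
rewrite (powRrM (1 + x) 2) powR_mulrn ?(ltW x1)//.
have A0 : 0 < 1 + x ^+ 2 by rewrite ltr_pwDl// sqr_ge0.
rewrite /decay1 !powRN ler_pdivlMr ?powR_gt0 ?exprn_gt0//.
rewrite mulrC ler_pdivrMr ?powR_gt0// -powRM//; last exact: ltW.
apply: ge0_ler_powR; first lra.
- by rewrite nnegrE; nra.
- by rewrite nnegrE; nra.
- by have := sqr_ge0 (1 - x); rewrite !expr2; lra.
Qed.

Lemma integral_decay1_lty :
  (\int[@lebesgue_measure R]_x (decay1 x)%:E < +oo)%E.
Proof.
rewrite ge0_symfun_integralT//; last 3 first.
- exact: decay1_ge0.
- exact: continuous_decay1.
- by move=> x; rewrite /decay1 /= sqrrN.
rewrite lte_mul_pinfty// -set_itvcy.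
pose f x : R := 2 `^ (3 / 5) * (1 + x) `^ (- (6 / 5)).
(* A primitive of [f]: the exponent -6/5 becomes -1/5, whence the factor -5. *)
pose F x : R := - 5 * 2 `^ (3 / 5) * (1 + x) `^ (- (1 / 5)).
have dpow (b x : R) : 0 <= x ->
    is_derive x 1 (fun x : R => (1 + x) `^ b) (b * (1 + x) `^ (b - 1)).
  move=> x0; have x1 : 0 < 1 + x by lra.
  have h2 : is_derive x 1 (fun x : R => 1 + x) 1.
    rewrite (_ : (fun x => 1 + x) = shift 1); first exact: is_derive_shift.
    by apply/funext => y; rewrite /= addrC.
  have h := @is_derive1_comp _ (fun u => u `^ b) _ _ _ _
    (is_derive1_powR b x1) h2.
  by rewrite mulr1 in h.
have dF (x : R) : 0 <= x -> is_derive x 1 F (f x).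
  move=> x0; have := is_deriveZ (- 5 * 2 `^ (3 / 5)) (dpow (- (1 / 5)) x x0).
  move=> h; apply: DeriveDef; first by have [] := h.
  have [_ -> /=] := h; rewrite /f /GRing.scale/=.
  have -> : - (1 / 5) - 1 = - (6 / 5) :> R by lra.
  lra.
have cf (x : R) : 0 <= x -> {for x, continuous f}.
  move=> x0; apply/differentiable_continuous/derivable1_diffP.
  by have [] := is_deriveZ (2 `^ (3 / 5)) (dpow (- (6 / 5)) x x0).
have F0 : F x @[x --> +oo] --> (0 : R).
  rewrite -(mulr0 (- 5 * 2 `^ (3 / 5))); apply: cvgMr.
  apply/cvgr0Pnorm_lt => e e0; near=> x.
  have x0 : 0 < 1 + x by near: x; exists 0; split => // y; lra.
  rewrite ger0_norm ?powR_ge0// powRN invf_plt ?posrE ?powR_gt0//.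
  (* The exponent 1/5 makes x > e^(-5) the threshold beyond which (1 + x)^(-1/5) < e. *)
  have -> : e^-1 = ((e^-1) ^+ 5) `^ (1 / 5).
    by rewrite -powR_mulrn ?invr_ge0 ?ltW// -powRrM div1r mulfV ?powRr1 ?invr_ge0 ?ltW.
  rewrite gt0_ltr_powR ?nnegrE ?exprn_ge0 ?invr_ge0 ?(ltW e0) ?(ltW x0)//.
  near: x; exists (e^-1 ^+ 5); split => [|y ye]; first exact: num_real.
  lra.
have := @ge0_continuous_FTC2y R f F 0 0.
move=> FTC.
have : (\int[@lebesgue_measure R]_(x in `[0%R, +oo[) (f x)%:E < +oo)%E.
  have -> : (\int[@lebesgue_measure R]_(x in `[0%R, +oo[) (f x)%:E =
      0%:E - (F 0)%:E)%E; last by rewrite -EFinB ltry.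
  apply: FTC.
  - by move=> x _; rewrite mulr_ge0 ?powR_ge0.
  - apply: continuous_in_subspaceT => x; rewrite inE/= in_itv/= andbT => x0.
    exact: cf.
  - exact: F0.
  - by move=> x x0; have [] := dF x (ltW x0).
  - apply: cvg_at_right_filter; apply/differentiable_continuous/derivable1_diffP.
    by have [] := dF 0 (lexx _).
  - move=> x; rewrite in_itv/= andbT => x0.
    by rewrite derive1E; have [_ ->] := dF x (ltW x0).
apply: le_lt_trans; apply: ge0_le_integral => //.
- by move=> x _; rewrite lee_fin decay1_ge0.
- apply/measurable_EFinP; apply: measurable_funTS; apply: continuous_measurable_fun.
  exact: continuous_decay1.
- apply/measurable_EFinP; apply: subspace_continuous_measurable_fun => //.
  apply: continuous_in_subspaceT => x; rewrite inE/= in_itv/= andbT => x0.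
  exact: cf.
- by move=> x; rewrite /= in_itv/= andbT => x0; rewrite lee_fin decay1_le.
Unshelve. all: by end_near. Qed.
End decay1.

(** * Tonelli and Fubini when one coordinate is split off *)

Section integral_rV_succ.
Context (R : realType) (n : nat).
Local Open Scope ereal_scope.

Lemma ge0_integral_rV_succ (f : 'rV[R]_n.+1 -> \bar R) :
  measurable_fun setT f -> (forall y, 0 <= f y) ->
  \int[lebesgue_rV R n.+1]_y f y =
  \int[lebesgue_measure]_a \int[lebesgue_rV R n]_y f (rV_cons (a, y)).
Proof.
move=> mf f0.
have mfc : measurable_fun setT (f \o @rV_cons R n).
  exact: measurableT_comp mf (@measurable_rV_cons R n).
rewrite -(fubini_tonelli1 (f \o @rV_cons R n))//=.
exact: (@ge0_integral_pushforward _ _ _ _ _ _ (@measurable_rV_cons R n)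
  (lebesgue_measure \x lebesgue_rV R n) setT f).
Qed.

Lemma integral_rV_succ (f : 'rV[R]_n.+1 -> \bar R) :
  (lebesgue_rV R n.+1).-integrable setT f ->
  let g := f \o @rV_cons R n in
  (lebesgue_measure \x lebesgue_rV R n).-integrable setT g /\
  \int[lebesgue_rV R n.+1]_y f y =
  \int[(lebesgue_measure \x lebesgue_rV R n)]_z g z.
Proof.
move=> /integrableP[mf fy] g.
have mg : measurable_fun setT g.
  exact: measurableT_comp mf (@measurable_rV_cons R n).
have ig : (lebesgue_measure \x lebesgue_rV R n).-integrable setT g.
  apply/integrableP; split => //; move: fy; rewrite ge0_integral_rV_succ//.
    by rewrite -(fubini_tonelli1 (abse \o g))//=; exact: measurableT_comp.
  exact: measurableT_comp.
split => //.
exact: (@integral_pushforward _ _ _ _ _ _ (@measurable_rV_cons R n)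
  (lebesgue_measure \x lebesgue_rV R n) setT f mf).
Qed.

End integral_rV_succ.

(** * Integrability of the power weights on R^(N-1) and R^N *)

Section weights.
Context (R : realType).

Lemma measurable_decay1 : measurable_fun [set: R] (@decay1 R).
Proof. by apply: continuous_measurable_fun; exact: continuous_decay1. Qed.

(** A tensor product, so that its integral factors by Tonelli; the radial weights do not factor but
    are dominated by it. *)
Definition decay n (y : 'rV[R]_n) : R := \prod_(i < n) decay1 (y ord0 i).

Lemma decay_ge0 n (y : 'rV[R]_n) : 0 <= decay y.
Proof. by apply: prodr_ge0 => i _; exact: decay1_ge0. Qed.

Lemma measurable_decay n : measurable_fun [set: 'rV[R]_n] (@decay n).
Proof.
apply: measurable_prod => i _.
exact: (measurableT_comp measurable_decay1 (@measurable_rV_coord R n i)).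
Qed.

Lemma integral_decay_lty n :
  (\int[lebesgue_rV R n]_y (decay y)%:E < +oo)%E.
Proof.
elim: n => [|n ih].
  under eq_integral do rewrite /decay big_ord0.
  by rewrite integral_cst//= diracT mule1 ltry.
rewrite ge0_integral_rV_succ; last 2 first.
- by apply/measurable_EFinP; exact: measurable_decay.
- by move=> y; rewrite lee_fin decay_ge0.
have I0 : (0 <= \int[lebesgue_rV R n]_y (decay y)%:E)%E.
  by apply: integral_ge0 => y _; rewrite lee_fin decay_ge0.
have E (a : R) : (\int[lebesgue_rV R n]_y (decay (rV_cons (a, y)))%:E =
    (decay1 a)%:E * \int[lebesgue_rV R n]_y (decay y)%:E)%E.
  rewrite -ge0_integralZl//; last 3 first.
  - by apply/measurable_EFinP; exact: measurable_decay.
  - by move=> y _; rewrite lee_fin decay_ge0.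
  - by rewrite lee_fin decay1_ge0.
  apply: eq_integral => y _; rewrite -EFinM; congr EFin.
  rewrite /decay big_ord_recl mxE unlift_none; congr (_ * _).
  by apply: eq_bigr => i _; rewrite mxE liftK.
under eq_integral do rewrite E muleC.
rewrite ge0_integralZl//; last 2 first.
- by apply/measurable_EFinP; exact: measurable_decay1.
- by move=> a _; rewrite lee_fin decay1_ge0.
apply: lte_mul_pinfty => //.
- by rewrite ge0_fin_numE.
- exact: integral_decay1_lty.
Qed.

Lemma sqnorm_ge0 n (y : 'rV[R]_n) : 0 <= sqnorm y.
Proof. by apply: sumr_ge0 => i _; exact: sqr_ge0. Qed.

Lemma sqr_coord_le_sqnorm n (y : 'rV[R]_n) i : y ord0 i ^+ 2 <= sqnorm y.
Proof.
by rewrite /sqnorm (bigD1 i)//= lerDl; apply: sumr_ge0 => j _; exact: sqr_ge0.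
Qed.

Lemma D10_ge1 n (x : pt R n) : 1 <= D10 x.
Proof.
by rewrite /D10 -addrA lerDl addr_ge0 ?sqnorm_ge0 ?sqr_ge0.
Qed.

Lemma D10_gt0 n (x : pt R n) : 0 < D10 x.
Proof. exact: lt_le_trans (D10_ge1 x). Qed.

Lemma powR_le_decay1 (u t : R) : t ^+ 2 <= u -> (1 + u) `^ (- (3 / 5)) <= decay1 t.
Proof.
move=> tu; have t2 := sqr_ge0 t; rewrite /decay1 !powRN lef_pV2 ?posrE ?powR_gt0//.
- by apply: ge0_ler_powR; rewrite ?nnegrE; lra.
- by lra.
- by lra.
Qed.

(** Each of the n factors (1 + u)^(-3/5) is at most [decay1] of one coordinate, since y_i^2 <= u.
    Leaving [u] free covers both u = s and u = s + t^2. *)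
Lemma powR_le_decay n (y : 'rV[R]_n) u : sqnorm y <= u ->
  (1 + u) `^ (- (3 / 5) * n%:R) <= decay y.
Proof.
move=> yu; rewrite powRrM powR_mulrn ?powR_ge0//.
rewrite -[X in _ ^+ X](card_ord n) -prodr_const.
apply: ler_prod => i _; rewrite powR_ge0/=; apply: powR_le_decay1.
exact: le_trans (sqr_coord_le_sqnorm _ _) yu.
Qed.

Lemma continuous_sqr (T : topologicalType) (f : T -> R) :
  continuous f -> continuous (fun x => f x ^+ 2).
Proof.
move=> cf x; rewrite (_ : (fun x => f x ^+ 2) = f \* f); last exact/funext.
by apply: cvgM; exact: cf.
Qed.

Lemma continuous_tangential n : continuous (fun x : pt R n => x.1).
Proof. by move=> x; exact: cvg_fst. Qed.

Lemma continuous_normal n : continuous (fun x : pt R n => x.2 : R).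
Proof. by move=> x; exact: cvg_snd. Qed.

Lemma continuous_sqnorm n : continuous (@sqnorm R n).
Proof.
apply: (@continuous_big _ _ +%R) => [|i _]; first exact: add_continuous.
by apply: continuous_sqr => y; exact: coord_continuous.
Qed.

Lemma continuous_D10 n : continuous (@D10 R n).
Proof.
move=> x; apply: cvgD; last by apply: continuous_sqr; exact: continuous_normal.
apply: cvgD; first exact: cvg_cst.
by apply: continuous_comp;
  [exact: continuous_tangential|exact: continuous_sqnorm].
Qed.

Lemma measurable_D10 n : measurable_fun setT (@D10 R n).
Proof. by apply: continuous_measurable_pt; exact: continuous_D10. Qed.

Lemma measurable_sqnorm n : measurable_fun setT (@sqnorm R n).
Proof. by apply: continuous_measurable_rV; exact: continuous_sqnorm. Qed.

Lemma integrable_rV_weight (n : nat) : (lebesgue_rV R n).-integrable setT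
  (fun y => ((1 + sqnorm y) `^ (- (3 / 5) * n%:R))%:E).
Proof.
have mw : measurable_fun [set: 'rV[R]_n]
    (fun y => (1 + sqnorm y) `^ (- (3 / 5) * n%:R)).
  apply: (measurableT_comp (measurable_powR _)).
  by apply: measurable_funD => //; exact: measurable_sqnorm.
apply/integrableP; split; first exact/measurable_EFinP.
apply: le_lt_trans (integral_decay_lty n); apply: ge0_le_integral => //.
- by apply: measurableT_comp => //; exact/measurable_EFinP.
- by apply/measurable_EFinP; exact: measurable_decay.
- move=> y _ /=; rewrite ger0_norm ?powR_ge0// lee_fin.
  exact: powR_le_decay.
Qed.

Lemma integrable_pt_weight (n : nat) : (@lebesgue_pt R n).-integrable setT
  (fun x => (D10 x `^ (- (3 / 5) * n.+1%:R))%:E).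
Proof.
have mw : measurable_fun [set: pt R n]
    (fun x => D10 x `^ (- (3 / 5) * n.+1%:R)).
  by apply: (measurableT_comp (measurable_powR _)); exact: measurable_D10.
apply/integrableP; split; first exact/measurable_EFinP.
pose h (x : pt R n) := (decay x.1 * decay1 x.2)%:E.
have mh : measurable_fun setT h.
  apply/measurable_EFinP; apply: measurable_funM.
    by apply: (measurableT_comp (@measurable_decay n)); exact: measurable_fst.
  by apply: (measurableT_comp measurable_decay1); exact: measurable_snd.
have h0 x : (0 <= h x)%E by rewrite lee_fin mulr_ge0 ?decay_ge0 ?decay1_ge0.
apply: (@le_lt_trans _ _ (\int[@lebesgue_pt R n]_x h x)%E).
  apply: ge0_le_integral => //.
  - by apply: measurableT_comp => //; exact/measurable_EFinP.
  - move=> x _; rewrite /= ger0_norm ?powR_ge0// lee_fin.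
    (* One factor D10^(-3/5) is spent on t, the other n on the tangential coordinates. *)
    rewrite -(natr1 n) mulrDr powRD; last by apply/implyP => _; rewrite gt_eqF ?D10_gt0.
    rewrite mulr1 /D10 -addrA; apply: ler_pM; rewrite ?powR_ge0//.
      by apply: powR_le_decay; rewrite lerDl sqr_ge0.
    by apply: powR_le_decay1; rewrite lerDr sqnorm_ge0.
rewrite fubini_tonelli1//= /fubini_F.
have I0 : (0 <= \int[@lebesgue_measure R]_y (decay1 y)%:E)%E.
  by apply: integral_ge0 => y _; rewrite lee_fin decay1_ge0.
under eq_integral => y _.
  rewrite /h /=.
  under eq_integral do rewrite EFinM.
  rewrite ge0_integralZl//; last 3 first.
  - by apply/measurable_EFinP; exact: measurable_decay1.
  - by move=> t _; rewrite lee_fin decay1_ge0.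
  - by rewrite lee_fin decay_ge0.
  rewrite muleC.
  over.
rewrite ge0_integralZl//; last 2 first.
- by apply/measurable_EFinP; exact: measurable_decay.
- by move=> a _; rewrite lee_fin decay_ge0.
apply: lte_mul_pinfty => //.
- by rewrite ge0_fin_numE//; exact: integral_decay1_lty.
- exact: integral_decay_lty.
Qed.

End weights.

(** * The fundamental theorem of calculus on the line and the half-line, for bounded support *)

Section fundamental_theorem.
Context (R : realType).
Variables (h h' : R -> R) (r : R).
Hypotheses (hd : forall t : R, is_derive t 1 h (h' t)) (ch : continuous h')
  (h0 : forall t : R, r < `|t| -> h t = 0).

Let derivative_support (t : R) : r < `|t| -> h' t = 0.
Proof.
move=> rt; have [_ <-] := hd t.
have -> : 'D_1 h t = 'D_1 (cst 0 : R -> R) t; last by rewrite derive_cst.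
apply: near_eq_derive; near=> u; apply: h0.
by near: u; apply: (cvgr_gt `|t|) => //; exact: norm_continuous.
Unshelve. all: by end_near. Qed.

Let integral_Icc (a b : R) : a < b ->
  (\int[@lebesgue_measure R]_(t in `[a, b]) (h' t)%:E = (h b - h a)%:E)%E.
Proof.
have ch0 : continuous h.
  by move=> t; apply/differentiable_continuous/derivable1_diffP; have [] := hd t.
move=> ab; rewrite EFinB; apply: continuous_FTC2 => //.
- exact: continuous_subspaceT.
- split => [t _||]; first by have [] := hd t.
    exact/cvg_at_right_filter/ch0.
  exact/cvg_at_left_filter/ch0.
- by move=> t _; rewrite derive1E; have [] := hd t.
Qed.

Lemma integral_derivative_line : (\int[@lebesgue_measure R]_t (h' t)%:E = 0)%E.
Proof.
(* Larger than [r] and positive whatever the sign of [r]: [h] vanishes at b and -b, and the interval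
   is nondegenerate. *)
pose b := `|r| + 1; have rb : r < b by rewrite ltr_pwDr// ler_norm.
have b0 : 0 < b by rewrite ltr_pwDr.
transitivity (\int[@lebesgue_measure R]_(t in `[(- b)%R, b]) (h' t)%:E)%E.
  rewrite [RHS]integral_mkcond; apply: eq_integral => t _.
  rewrite patchE; case: ifPn => // /negP; rewrite inE/= in_itv/= -ler_norml => tb.
  rewrite derivative_support// (lt_trans rb)// ltNge.
  by apply/negP.
rewrite integral_Icc; last by lra.
by rewrite !h0 ?subrr// ?normrN gtr0_norm.
Qed.

Lemma integral_derivative_half_line :
  (\int[@lebesgue_measure R]_(t in [set t | (0 < t)%R]) (h' t)%:E = (- h 0)%:E)%E.
Proof.
pose b := `|r| + 1; have rb : r < b by rewrite ltr_pwDr// ler_norm.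
have b0 : 0 < b by rewrite ltr_pwDr.
transitivity (\int[@lebesgue_measure R]_(t in `]0%R, b]) (h' t)%:E)%E.
  rewrite integral_mkcond [RHS]integral_mkcond; apply: eq_integral => t _.
  rewrite !patchE; have [t0|t0] := ltP 0 t; last first.
    by rewrite !memNset//= ?in_itv/= ltNge t0.
  rewrite mem_set//; have [tb|bt] := leP t b.
    by rewrite mem_set//= in_itv/= t0 tb.
  rewrite memNset ?derivative_support ?gtr0_norm ?(lt_trans rb)//=.
  by rewrite in_itv/= t0/= leNgt bt.
rewrite integral_itv_obnd_cbnd; last first.
  by apply/measurable_EFinP/measurable_funTS; exact: continuous_measurable_fun.
by rewrite integral_Icc// [h b]h0 ?sub0r// gtr0_norm.
Qed.

End fundamental_theorem.

(** No chain rule is involved: the two difference quotients are the same function, so derivability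
    in the single direction [w] suffices. It moves partial derivatives to slices. *)
Lemma derive_comp_affine (R : realType) (V W : normedModType R) (f : W -> R)
    (L : V -> W) (x v : V) (w : W) :
  (forall h : R, L (h *: v + x) = h *: w + L x) -> derivable f (L x) w ->
  is_derive x v (f \o L) ('D_w f (L x)).
Proof.
move=> hL df.
have e : (fun h : R => h^-1 *: (((f \o L) \o shift x) (h *: v) - (f \o L) x)) =
         (fun h : R => h^-1 *: ((f \o shift (L x)) (h *: w) - f (L x))).
  by apply/funext => h /=; rewrite hL.
by apply: DeriveDef; rewrite /derivable /derive e.
Qed.

(** * Bounded functions of bounded support are dominated by the weights *)

Section bounded_support.
Context (R : realType) (n : nat).

Lemma coord_le_norm (y : 'rV[R]_n) i : `|y ord0 i| <= `|y|.
Proof. by rewrite [leRHS]mx_normrE; apply: (le_bigmax _ _ (ord0, i)). Qed.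

Lemma sqnorm_le_norm (y : 'rV[R]_n) (r : R) : `|y| <= r -> sqnorm y <= n%:R * r ^+ 2.
Proof.
move=> yr; rewrite -[X in X%:R]card_ord -sumr_const mulr_suml.
apply: ler_sum => i _; rewrite mul1r -real_normK ?num_real//.
apply: lerXn2r; rewrite ?nnegrE//; first exact: le_trans yr.
exact: le_trans (coord_le_norm _ _) yr.
Qed.

Lemma norm_le_weight_rV (f : 'rV[R]_n -> R) (r M : R) :
  (forall y, `|f y| <= M) -> (forall y, r < `|y| -> f y = 0) ->
  exists C : R, forall y, `|f y| <= C * (1 + sqnorm y) `^ (- (3 / 5) * n%:R).
Proof.
move=> fM fr; have M0 : 0 <= M := le_trans (normr_ge0 _) (fM 0).
(* A lower bound for the weight on the ball of radius [r]: there, in the sup norm, s <= n r^2. *)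
pose c : R := (1 + n%:R * r ^+ 2) `^ (- (3 / 5) * n%:R).
have c0 : 0 < c.
  by rewrite powR_gt0// ltr_pwDl// mulr_ge0// sqr_ge0.
exists (M / c) => y; have [yr|yr] := leP `|y| r; last first.
  by rewrite fr// normr0 mulr_ge0 ?powR_ge0// divr_ge0// ltW.
rewrite (le_trans (fM y))// mulrAC ler_pdivlMr// ler_wpM2l// /c.
rewrite mulNr !powRN lef_pV2 ?posrE; last 2 first.
- by rewrite powR_gt0// ltr_pwDl// mulr_ge0// sqr_ge0.
- by rewrite powR_gt0// ltr_pwDl// sqnorm_ge0.
apply: ge0_ler_powR.
- by rewrite mulr_ge0//; lra.
- by rewrite nnegrE addr_ge0// sqnorm_ge0.
- by rewrite nnegrE addr_ge0// mulr_ge0// sqr_ge0.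
- by rewrite lerD2l sqnorm_le_norm.
Qed.

Lemma norm_le_weight_pt (f : pt R n -> R) (r M : R) :
  (forall x, `|f x| <= M) -> (forall x, r < `|x| -> f x = 0) ->
  exists C : R, forall x, `|f x| <= C * D10 x `^ (- (3 / 5) * n.+1%:R).
Proof.
move=> fM fr; have M0 : 0 <= M := le_trans (normr_ge0 _) (fM 0).
pose c : R := (1 + n%:R * r ^+ 2 + r ^+ 2) `^ (- (3 / 5) * n.+1%:R).
have r0 := sqr_ge0 r.
have c0 : 0 < c.
  by rewrite powR_gt0// -addrA ltr_pwDl// addr_ge0// mulr_ge0.
exists (M / c) => x; have [xr|xr] := leP `|x| r; last first.
  by rewrite fr// normr0 mulr_ge0 ?powR_ge0// divr_ge0// ltW.
rewrite (le_trans (fM x))// mulrAC ler_pdivlMr// ler_wpM2l// /c.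
rewrite mulNr !powRN lef_pV2 ?posrE; last 2 first.
- by rewrite powR_gt0// -addrA ltr_pwDl// addr_ge0// mulr_ge0.
- by rewrite powR_gt0// D10_gt0.
apply: ge0_ler_powR.
- by rewrite mulr_ge0//; lra.
- by rewrite nnegrE ltW// D10_gt0.
- by rewrite nnegrE -addrA addr_ge0// addr_ge0// mulr_ge0.
move: xr; rewrite [`|x|]prod_normE ge_max => /andP[x1 x2].
rewrite /D10; apply: lerD; first by rewrite lerD2l sqnorm_le_norm.
rewrite -real_normK ?num_real//; apply: lerXn2r; rewrite ?nnegrE//.
exact: le_trans x2.
Qed.

End bounded_support.

Lemma continuous_compose (T U V : topologicalType) (f : T -> U) (g : U -> V) :
  continuous f -> continuous g -> continuous (g \o f).
Proof. by move=> cf cg x; apply: continuous_comp; [exact: cf|exact: cg]. Qed.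

(** * Continuous functions of bounded support are bounded and integrable *)

Section continuous_bounded_support.
Context (R : realType) (n : nat).

Lemma continuous_bounded_on_compact (T : topologicalType) (A : set T) (f : T -> R) :
  compact A -> continuous f -> (forall x, ~ A x -> f x = 0) ->
  exists M : R, forall x, `|f x| <= M.
Proof.
move=> cA cf f0.
have /compact_bounded[M [_ HM]] : compact (f @` A).
  by apply: continuous_compact => //; exact: continuous_subspaceT.
exists (`|M| + 1) => x; have [Ax|nAx] := pselect (A x); last first.
  by rewrite f0// normr0 addr_ge0.
by apply: (HM (`|M| + 1)); [rewrite ltr_pwDr// ler_norm|exists x].
Qed.

Lemma compact_ball_rV (r : R) : compact [set y : 'rV[R]_n | `|y| <= r].
Proof.
apply: bounded_closed_compact.
  by exists `|r|; split => [|s rs y /= yr]; rewrite ?num_real// (le_trans yr)//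
    (le_trans (ler_norm _))// ltW.
have -> : [set y : 'rV[R]_n | `|y| <= r] = (@Num.norm _ _) @^-1` [set` `]-oo, r]].
  by apply/seteqP; split => y /=; rewrite in_itv.
by apply: closed_comp => [y _|]; [exact: norm_continuous|exact: interval_closed].
Qed.

Lemma compact_ball_pt (r : R) : compact [set x : pt R n | `|x| <= r].
Proof.
have -> : [set x : pt R n | `|x| <= r] =
    [set y | `|y| <= r] `*` [set` `[- r, r]].
  apply/seteqP; split => -[y t] /=; rewrite in_itv/= -ler_norml
    [`|(_, _)|]prod_normE ge_max; first by move/andP.
  by move=> h; apply/andP.
by apply: compact_setX; [exact: compact_ball_rV|exact: segment_compact].
Qed.

Lemma continuous_bounded_rV (f : 'rV[R]_n -> R) (r : R) :
  continuous f -> (forall y, r < `|y| -> f y = 0) ->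
  exists M : R, forall y, `|f y| <= M.
Proof.
move=> cf f0; apply: (continuous_bounded_on_compact (@compact_ball_rV r) cf).
by move=> y /= /negP; rewrite -ltNge => /f0.
Qed.

Lemma continuous_bounded_pt (f : pt R n -> R) (r : R) :
  continuous f -> (forall y, r < `|y| -> f y = 0) ->
  exists M : R, forall y, `|f y| <= M.
Proof.
move=> cf f0; apply: (continuous_bounded_on_compact (@compact_ball_pt r) cf).
by move=> y /= /negP; rewrite -ltNge => /f0.
Qed.

Lemma le_integrable_fun d (T : measurableType d) (mu : {measure set T -> \bar R})
    (D : set T) (f g : T -> R) : measurable D -> measurable_fun D f ->
  (forall x, D x -> `|f x| <= g x) -> mu.-integrable D (EFin \o g) ->
  mu.-integrable D (EFin \o f).
Proof.
move=> mD mf fg ig; apply: (le_integrable mD _ _ ig); first exact/measurable_EFinP.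
by move=> x Dx; rewrite /= lee_fin (le_trans (fg x Dx))// ler_norm.
Qed.

Lemma integrable_bounded_support_rV (f : 'rV[R]_n -> R) (r M : R) :
  measurable_fun setT f -> (forall y, `|f y| <= M) ->
  (forall y, r < `|y| -> f y = 0) ->
  (lebesgue_rV R n).-integrable setT (EFin \o f).
Proof.
move=> mf fM fr; have [C fC] := norm_le_weight_rV fM fr.
apply: (le_integrable_fun measurableT mf (fun y _ => fC y)).
rewrite (_ : _ \o _ = fun y => (C%:E * ((1 + sqnorm y) `^ (- (3 / 5) * n%:R))%:E)%E).
  by apply: integrableZl => //; exact: integrable_rV_weight.
by apply/funext => y.
Qed.

Lemma integrable_bounded_support_pt (f : pt R n -> R) (r M : R) :
  measurable_fun setT f -> (forall y, `|f y| <= M) ->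
  (forall y, r < `|y| -> f y = 0) ->
  (lebesgue_pt R n).-integrable setT (EFin \o f).
Proof.
move=> mf fM fr; have [C fC] := norm_le_weight_pt fM fr.
apply: (le_integrable_fun measurableT mf (fun y _ => fC y)).
rewrite (_ : _ \o _ = fun y => (C%:E * (D10 y `^ (- (3 / 5) * n.+1%:R))%:E)%E).
  by apply: integrableZl => //; exact: integrable_pt_weight.
by apply/funext => y.
Qed.

Lemma continuous_integrable_rV (f : 'rV[R]_n -> R) (r : R) :
  continuous f -> (forall y, r < `|y| -> f y = 0) ->
  (lebesgue_rV R n).-integrable setT (EFin \o f).
Proof.
move=> cf fr; have [M fM] := continuous_bounded_rV cf fr.
exact: integrable_bounded_support_rV (continuous_measurable_rV cf) fM fr.
Qed.

Lemma continuous_integrable_pt (f : pt R n -> R) (r : R) :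
  continuous f -> (forall y, r < `|y| -> f y = 0) ->
  (lebesgue_pt R n).-integrable setT (EFin \o f).
Proof.
move=> cf fr; have [M fM] := continuous_bounded_pt cf fr.
exact: integrable_bounded_support_pt (continuous_measurable_pt cf) fM fr.
Qed.

End continuous_bounded_support.

Lemma derive_outside_support (R : realType) (V : normedModType R) (f : V -> R)
    (r : R) (v x : V) :
  (forall y, r < `|y| -> f y = 0) -> r < `|x| -> 'D_v f x = 0.
Proof.
move=> f0 rx.
have -> : 'D_v f x = 'D_v (cst 0 : V -> R) x; last by rewrite derive_cst.
apply: near_eq_derive; near=> u; apply: f0.
by near: u; apply: (cvgr_gt `|x|) => //; exact: norm_continuous.
Unshelve. all: by end_near. Qed.

(** * Partial derivatives of compactly supported functions integrate to zero *)

Section integral_derive_rV.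
Context (R : realType).

Lemma continuous_rV_consr n (a : R) :
  continuous (fun y : 'rV[R]_n => rV_cons (a, y)).
Proof.
move=> z A /nbhs_ballP[e /= e0 eA].
apply/nbhs_ballP; exists e => //= w [/= _ zw]; apply: eA.
split => // i j; rewrite !mxE; case: unliftP => [k _|_]; last exact: ballxx.
exact: zw.
Qed.

Lemma continuous_rV_consl n (y : 'rV[R]_n) :
  continuous (fun a : R => rV_cons (a, y)).
Proof.
move=> z A /nbhs_ballP[e /= e0 eA].
apply/nbhs_ballP; exists e => //= w zw; apply: eA.
split => // i j; rewrite !mxE; case: unliftP => [k _|_] //; exact: ballxx.
Qed.

Lemma norm_rV_consr n (a : R) (y : 'rV[R]_n) : `|y| <= `|rV_cons (a, y)|.
Proof.
rewrite [leLHS]mx_normrE; apply/bigmax_leP; split => [|[i j] _]; first exact: normr_ge0.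
rewrite /= ord1.
have := coord_le_norm (rV_cons (a, y)) (lift ord0 j).
by rewrite mxE liftK.
Qed.

Lemma norm_rV_consl n (a : R) (y : 'rV[R]_n) : `|a| <= `|rV_cons (a, y)|.
Proof.
by have := coord_le_norm (rV_cons (a, y)) ord0; rewrite mxE unlift_none.
Qed.

Lemma integral_derive_rV n (G : 'rV[R]_n -> R) (i : 'I_n) (r : R) :
  (forall x, derivable G x (delta_mx ord0 i)) ->
  continuous ('D_(delta_mx ord0 i) G) ->
  (forall x, r < `|x| -> G x = 0) ->
  (\int[lebesgue_rV R n]_x ('D_(delta_mx ord0 i) G x)%:E = 0)%E.
Proof.
elim: n G i r => [G []//|n ih G i r dG cG G0].
have iG : (lebesgue_rV R n.+1).-integrable setT
    (EFin \o 'D_(delta_mx ord0 i) G).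
  apply: (continuous_integrable_rV cG (r := r)) => y.
  exact: derive_outside_support.
have [ig ->] := integral_rV_succ iG.
(* With coordinate 0 split off, a direction other than 0 is tangent to the slices and falls to the
   induction hypothesis; direction 0 is integrated first and falls to the fundamental theorem on the
   line. *)
case: (unliftP ord0 i) => [j|] ei.
  rewrite -integral12_prod_meas1// integral0_eq// => a _.
  rewrite /fubini_F /=.
  have dGa y : is_derive y (delta_mx ord0 j) (fun y => G (rV_cons (a, y)))
      ('D_(delta_mx ord0 i) G (rV_cons (a, y))).
    apply: (derive_comp_affine (L := fun y => rV_cons (a, y))) => // h.
    apply/rowP => k; rewrite !mxE ei; case: unliftP => [l|] -> /=.
      by rewrite !mxE (inj_eq lift_inj).
    by rewrite mulr0 add0r.
  under eq_integral.
    move=> y _; rewrite (_ : 'D_ _ G _ =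
      'D_(delta_mx ord0 j) (fun y => G (rV_cons (a, y))) y).
      over.
    by have [_ ->] := dGa y.
  apply: (ih _ _ r).
  - by move=> y; have [] := dGa y.
  - rewrite (_ : 'D_ _ _ = 'D_(delta_mx ord0 i) G \o (fun y => rV_cons (a, y))).
      exact: (continuous_compose (@continuous_rV_consr n a) cG).
    by apply/funext => y; have [_ ->] := dGa y.
  - by move=> y ry; apply: G0; rewrite (lt_le_trans ry)// norm_rV_consr.
rewrite -integral21_prod_meas1// integral0_eq// => y _.
rewrite /fubini_G /=.
apply: (@integral_derivative_line _ (fun a => G (rV_cons (a, y))) _ r).
- move=> a; apply: (derive_comp_affine (L := fun a : R => rV_cons (a, y))) => // h.
  apply/rowP => k; rewrite !mxE ei; case: unliftP => [l|] -> /=.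
    by rewrite mulr0 add0r.
  by [].
- exact: (continuous_compose (@continuous_rV_consl n y) cG).
- by move=> a ra; apply: G0; rewrite (lt_le_trans ra)// norm_rV_consl.
Qed.

End integral_derive_rV.

(** * The divergence theorem on the half-space *)

Section divergence_half_space.
Context (R : realType) (n : nat).
Implicit Types (F : pt R n -> R) (e : pt R n).

Lemma measurable_half_space : measurable (@half_space R n).
Proof.
have := @measurable_snd _ _ 'rV[R]_n (measurableTypeR R) measurableT _
  (@measurable_itv R `]0, +oo[).
rewrite setTI; congr measurable; apply/seteqP; split => x /=;
  by rewrite in_itv/= andbT.
Qed.

Lemma continuous_tangential_slice (t : R) :
  continuous (fun y : 'rV[R]_n => (y, t) : pt R n).
Proof.
move=> z A /nbhs_ballP[e /= e0 eA].
by apply/nbhs_ballP; exists e => //= w zw; apply: eA; split => //; exact: ballxx.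
Qed.

Lemma continuous_normal_slice (y : 'rV[R]_n) :
  continuous (fun t : R => (y, t) : pt R n).
Proof.
move=> z A /nbhs_ballP[e /= e0 eA].
by apply/nbhs_ballP; exists e => //= w zw; apply: eA; split => //; exact: ballxx.
Qed.

Lemma C1c_bounded_support (Om : set (pt R n)) F : C1c Om F ->
  exists r : R, forall x, r < `|x| -> F x = 0.
Proof.
move=> [_ _ [K [/compact_bounded[M [_ KM]] _ F0]]].
exists (`|M| + 1) => x xM; apply: F0 => Kx.
have : `|x| <= `|M| + 1 by apply: KM => //; rewrite ltr_pwDr// ler_norm.
by rewrite leNgt xM.
Qed.

Lemma dir_max : dir R (@ord_max n) = (0, 1 : R).
Proof. by rewrite /dir unlift_none. Qed.

Lemma dir_lift (i : 'I_n) : dir R (lift ord_max i) = (delta_mx ord0 i, 0 : R).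
Proof. by rewrite /dir liftK. Qed.

Lemma dotp_lift e (i : 'I_n) : dotp e (dir R (lift ord_max i)) = e.1 ord0 i.
Proof.
rewrite dir_lift /dotp/= mulr0 addr0 (bigD1 i)//= mxE !eqxx mulr1 big1 ?addr0//.
by move=> j ji; rewrite mxE (negbTE ji) andbF mulr0.
Qed.

Lemma dotp_max e : dotp e (dir R ord_max) = e.2.
Proof.
rewrite dir_max /dotp/= mulr1 big1 ?add0r// => i _.
by rewrite mxE mulr0.
Qed.

Lemma big_ord_lift (V : nmodType) (f : 'I_n.+1 -> V) :
  \sum_a f a = \sum_(i < n) f (lift ord_max i) + f ord_max.
Proof.
rewrite big_ord_recr; congr (_ + _); apply: eq_bigr => i _; congr f.
by apply: val_inj; rewrite /= /bump leqNgt ltn_ord.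
Qed.

Lemma sum_dir e : e = \sum_a dotp e (dir R a) *: dir R a.
Proof.
rewrite big_ord_lift dotp_max dir_max.
under eq_bigr do rewrite dotp_lift dir_lift.
have -> : \sum_(i < n) e.1 ord0 i *: ((delta_mx ord0 i, 0 : R) : pt R n) =
    (e.1, 0 : R).
  rewrite [in RHS](row_sum_delta e.1).
  elim/big_rec2 : _ => // i y x _ ->.
  by congr pair; rewrite /= scaler0 add0r.
by case: e => y t; congr pair; rewrite /= ?scaler0 ?addr0// add0r /GRing.scale/= mulr1.
Qed.

(** Integration over the tangential variable comes first: each slice t > 0 contributes zero, so the
    boundary is never seen. *)
Lemma int_H_derive_tangential F (i : 'I_n) : C1c setT F ->
  int_H ('D_(dir R (lift ord_max i)) F) = 0.
Proof.
move=> FC; have [dF cF _] := FC; have [r F0] := C1c_bounded_support FC.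
set e := dir R _; set f := 'D_e F.
have iF : (lebesgue_pt R n).-integrable setT (EFin \o (f \_ (@half_space R n))).
  rewrite -restrict_EFin -integrable_restrict ?setTI//; last exact: measurable_half_space.
  apply: (integrableS measurableT measurable_half_space) => //.
  apply: (continuous_integrable_pt (cF e) (r := r)) => y.
  exact: derive_outside_support.
rewrite /int_H /Rintegral integral_mkcond restrict_EFin.
rewrite -integral21_prod_meas1//= integral0_eq// => t _; rewrite /fubini_G/=.
have [t0|t0] := ltP 0 (t : R); last first.
  rewrite integral0_eq// => y _; rewrite patchE memNset//.
  by rewrite /half_space/= ltNge t0.
have dFt y : is_derive y (delta_mx ord0 i) (fun y => F (y, t)) (f (y, t)).
  apply: (derive_comp_affine (L := fun y => ((y, t) : pt R n))) => [h|].
    by rewrite /e dir_lift; congr pair; rewrite /= scaler0 add0r.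
  by apply: diff_derivable; exact: dF.
rewrite -[RHS](@integral_derive_rV _ _ (fun y => F (y, t)) i r).
- apply: eq_integral => y _; rewrite patchE mem_set//.
  by have [_ ->] := dFt y.
- by move=> y; have [] := dFt y.
- rewrite (_ : 'D_ _ _ = f \o (fun y => (y, t))).
    exact: continuous_compose (@continuous_tangential_slice t) (cF e).
  by apply/funext => y; have [_ ->] := dFt y.
- move=> y ry; apply: F0; rewrite (lt_le_trans ry)//.
  by rewrite [leRHS]prod_normE le_max lexx.
Qed.

(** Here t is integrated first, and the half-line form of the fundamental theorem leaves the value
    at t = 0 with a minus sign, the outer normal being -e_t. *)
Lemma int_H_derive_normal F : C1c setT F ->
  int_H ('D_(dir R ord_max) F) = - int_bd (F \o bdry).
Proof.
move=> FC; have [dF cF _] := FC; have [r F0] := C1c_bounded_support FC.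
set e := dir R _; set f := 'D_e F.
have iF : (lebesgue_pt R n).-integrable setT (EFin \o (f \_ (@half_space R n))).
  rewrite -restrict_EFin -integrable_restrict ?setTI//; last exact: measurable_half_space.
  apply: (integrableS measurableT measurable_half_space) => //.
  apply: (continuous_integrable_pt (cF e) (r := r)) => y.
  exact: derive_outside_support.
have iFb : (lebesgue_rV R n).-integrable setT (EFin \o (F \o @Defs.bdry R n)).
  apply: (@continuous_integrable_rV _ _ _ r).
    apply: (continuous_compose (@continuous_tangential_slice 0)).
    by move=> x; apply: differentiable_continuous.
  move=> y ry; apply: F0; rewrite (lt_le_trans ry)//.
  by rewrite [leRHS]prod_normE le_max lexx.
rewrite /int_H /int_bd /Rintegral integral_mkcond restrict_EFin.
rewrite -fineN -integralN; last by apply: integrable_add_def => //; exact: iFb.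
congr fine.
rewrite -integral12_prod_meas1//=; apply: eq_integral => y _; rewrite /fubini_F/=.
have dFy (t : R) : is_derive t 1 (fun t => F (y, t)) (f (y, t)).
  apply: (derive_comp_affine (L := fun t : R => ((y, t) : pt R n))) => [h|].
    by rewrite /e dir_max; congr pair; rewrite /= scaler0 add0r.
  by apply: diff_derivable; exact: dF.
rewrite -[RHS](@integral_derivative_half_line _ _ _ r dFy).
- rewrite [RHS]integral_mkcond; apply: eq_integral => t _; rewrite !patchE.
  have [t0|t0] := ltP 0 (t : R); first by rewrite !mem_set.
  by rewrite !memNset//= /half_space/= ltNge t0.
- exact: continuous_compose (@continuous_normal_slice y) (cF e).
- move=> t rt; apply: F0; rewrite (lt_le_trans rt)//.
  by rewrite [leRHS]prod_normE le_max lexx orbT.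
Qed.

Lemma derive_sum_dir F x e : differentiable F x ->
  'D_e F x = \sum_a dotp e (dir R a) * 'D_(dir R a) F x.
Proof.
move=> dF; rewrite deriveE// {1}(sum_dir e) linear_sum.
by apply: eq_bigr => a _; rewrite linearZ deriveE.
Qed.

Lemma integrable_H_derive F e : C1c setT F -> integrable_H ('D_e F).
Proof.
move=> FC; have [dF cF _] := FC; have [r F0] := C1c_bounded_support FC.
apply: (integrableS measurableT measurable_half_space) => //.
apply: (continuous_integrable_pt (cF e) (r := r)) => y.
exact: derive_outside_support.
Qed.

Lemma int_H_derive F e : C1c setT F ->
  int_H ('D_e F) = - ((e.2 : R) * int_bd (F \o bdry)).
Proof.
move=> FC; have [dF _ _] := FC.
have -> : 'D_e F = fun x => \sum_a dotp e (dir R a) * 'D_(dir R a) F x.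
  by apply/funext => x; exact: derive_sum_dir.
have iF a : integrable_H (fun x => dotp e (dir R a) * 'D_(dir R a) F x).
  rewrite /integrable_H (_ : EFin \o _ =
     fun x => ((dotp e (dir R a))%:E * ('D_(dir R a) F x)%:E)%E); last exact/funext.
  by apply: integrableZl; [exact: measurable_half_space|exact: integrable_H_derive].
rewrite /int_H /Rintegral.
under eq_integral do rewrite -sumEFin.
rewrite integral_sum//; last exact: measurable_half_space.
have E a : (\int[lebesgue_pt R n]_(x in @half_space R n)
    (dotp e (dir R a) * 'D_(dir R a) F x)%:E =
    (dotp e (dir R a) * int_H ('D_(dir R a) F))%:E)%E.
  rewrite -RintegralZl; last 2 first.
  - exact: measurable_half_space.
  - exact: integrable_H_derive.
  rewrite fineK//; apply: integrable_fin_num; first exact: measurable_half_space.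
  exact: iF.
under eq_bigr do rewrite E.
rewrite sumEFin/= big_ord_lift big1 ?add0r.
  by rewrite dotp_max int_H_derive_normal// mulrN.
by move=> i _; rewrite int_H_derive_tangential// mulr0.
Qed.

End divergence_half_space.

(** * Calculus of C^1 functions *)

Section C1_functions.
Context (R : realType) (n : nat).
Implicit Types (f g : pt R n -> R) (x e v : pt R n).

(** [C1c] without its support condition. Differentiability is asked on all of R^N, as in [C1c], so
    functions that matter only for t >= 0 must be extended across the boundary. *)
Definition C1 f : Prop :=
  (forall x, differentiable f x) /\ forall e, continuous ('D_e f).

Lemma C1_derivable f x e : C1 f -> derivable f x e.
Proof. by move=> [df _]; exact: diff_derivable. Qed.

Lemma C1_continuous f : C1 f -> continuous f.
Proof. by move=> [df _] x; exact: differentiable_continuous. Qed.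

Lemma C1_cst (k : R) : C1 (cst k).
Proof.
split => [x|e]; first exact: differentiable_cst.
rewrite (_ : 'D_e _ = cst 0); first exact: cst_continuous.
by apply/funext => x; rewrite derive_cst.
Qed.

Lemma C1D f g : C1 f -> C1 g -> C1 (f \+ g).
Proof.
move=> Cf Cg; split => [x|e].
  by apply: differentiableD; [exact: Cf.1|exact: Cg.1].
rewrite (_ : 'D_e _ = 'D_e f \+ 'D_e g); last first.
  by apply/funext => x; rewrite deriveD//; exact: C1_derivable.
by move=> x; apply: cvgD; [exact: Cf.2|exact: Cg.2].
Qed.

Lemma derive_C1M f g x e : C1 f -> C1 g ->
  'D_e (f \* g) x = f x * 'D_e g x + g x * 'D_e f x.
Proof. by move=> Cf Cg; rewrite deriveM//; exact: C1_derivable. Qed.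

Lemma C1M f g : C1 f -> C1 g -> C1 (f \* g).
Proof.
move=> Cf Cg; split => [x|e].
  by apply: differentiableM; [exact: Cf.1|exact: Cg.1].
rewrite (_ : 'D_e _ = (f \* 'D_e g) \+ (g \* 'D_e f)); last first.
  by apply/funext => x; rewrite derive_C1M.
move=> x; apply: cvgD; apply: cvgM.
- exact: C1_continuous Cf x.
- exact: Cg.2 e x.
- exact: C1_continuous Cg x.
- exact: Cf.2 e x.
Qed.

Lemma C1_sum m (f : 'I_m -> pt R n -> R) : (forall i, C1 (f i)) ->
  C1 (fun x => \sum_i f i x).
Proof.
move=> Cf; elim: (index_enum _) => [|i s ih].
  rewrite (_ : (fun x => _) = cst 0); first exact: C1_cst.
  by apply/funext => x; rewrite big_nil.
rewrite (_ : (fun x => _) = f i \+ (fun x => \sum_(j <- s) f j x)).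
  exact: C1D.
by apply/funext => x; rewrite big_cons.
Qed.

Lemma dotpC x v : dotp x v = dotp v x.
Proof.
by congr (_ + _); [apply: eq_bigr => i _; rewrite mulrC|rewrite mulrC].
Qed.

Lemma dotp_linear v : linear ((fun x => dotp x v) : pt R n -> R).
Proof.
move=> k x y; rewrite /dotp /= scalerDr scaler_sumr addrACA -big_split/=.
congr (_ + _); last by rewrite /GRing.scale/=; lra.
by apply: eq_bigr => i _; rewrite !mxE mulrDl /GRing.scale/= mulrA.
Qed.

Lemma continuous_dotp v : continuous (fun x => dotp x v).
Proof.
move=> x; apply: cvgD; last first.
  by apply: cvgM; [exact: (@continuous_normal R n x)|exact: cvg_cst].
apply: (@continuous_big _ _ +%R) => [|i _]; first exact: add_continuous.
move=> {}x; apply: cvgM; last exact: cvg_cst.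
apply: (@continuous_compose _ _ _ _ (fun y : 'rV[R]_n => y ord0 i)
  (@continuous_tangential R n)).
exact: coord_continuous.
Qed.

Lemma diff_dotp v x : differentiable (fun x => dotp x v) x /\
  forall e, 'D_e (fun x => dotp x v) x = dotp e v.
Proof.
pose lm := GRing.isLinear.Build _ _ _ _ _ (dotp_linear v).
pose l : {linear pt R n -> R} := HB.pack ((fun x => dotp x v) : pt R n -> R) lm.
have cl : continuous l by exact: continuous_dotp.
have dl : differentiable l x by exact: linear_differentiable.
by split => // e; rewrite deriveE// (diff_lin x cl).
Qed.

Lemma C1_dotp v : C1 (fun x => dotp x v).
Proof.
split => [x|e]; first by have [] := diff_dotp v x.
rewrite (_ : 'D_e _ = cst (dotp e v)); first exact: cst_continuous.
by apply/funext => x; have [_ ->] := diff_dotp v x.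
Qed.

Lemma dotp_sum_dir x v : dotp x v = \sum_a dotp x (dir R a) * dotp v (dir R a).
Proof.
by rewrite big_ord_lift !dotp_max; under eq_bigr do rewrite !dotp_lift.
Qed.

Definition C1R (g dg : R -> R) : Prop :=
  (forall u : R, is_derive u 1 g (dg u)) /\ continuous dg.

Lemma derive_C1_comp f (g dg : R -> R) x e : C1 f -> C1R g dg ->
  'D_e (g \o f) x = dg (f x) * 'D_e f x.
Proof.
move=> Cf [Dg _]; have dg' : differentiable g (f x).
  by apply/derivable1_diffP; have [] := Dg (f x).
rewrite deriveE; last by apply: differentiable_comp => //; exact: Cf.1.
rewrite diff_comp//; last exact: Cf.1.
have -> : dg (f x) = 'd g (f x) 1 by rewrite -deriveE//; have [_ ->] := Dg (f x).
rewrite deriveE/=; last exact: Cf.1.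
rewrite -[X in 'd g (f x) X](mulr1 ('d f x e)).
by rewrite -[_ * 1]/(_ *: 1) linearZ/= mulrC.
Qed.

Lemma C1_comp f (g dg : R -> R) : C1 f -> C1R g dg -> C1 (g \o f).
Proof.
move=> Cf Cg; split => [x|e].
  apply: differentiable_comp; first exact: Cf.1.
  by apply/derivable1_diffP; have [] := Cg.1 (f x).
rewrite (_ : 'D_e _ = (dg \o f) \* 'D_e f); last first.
  by apply/funext => x; rewrite (derive_C1_comp _ _ Cf Cg).
move=> x; apply: cvgM; last exact: Cf.2.
exact: (continuous_compose (C1_continuous Cf) Cg.2).
Qed.

Lemma C1c_setT f (r : R) : C1 f -> (forall x, r < `|x| -> f x = 0) -> C1c setT f.
Proof.
move=> [df cf] f0; split => //; exists [set x | `|x| <= r]; split => //.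
  exact: compact_ball_pt.
by move=> x /= /negP; rewrite -ltNge => /f0.
Qed.

Lemma C1c_C1 (Om : set (pt R n)) f : C1c Om f -> C1 f.
Proof. by case. Qed.

Lemma C1cM (Om : set (pt R n)) f g : C1 f -> C1c Om g -> C1c Om (f \* g).
Proof.
move=> Cf Cg; have [h1 h2] := C1M Cf (C1c_C1 Cg); split => //.
have [_ _ [K [cK KO g0]]] := Cg; exists K; split => // x /g0.
by rewrite /= => ->; rewrite mulr0.
Qed.

End C1_functions.

(** * The C^1 extension of powers, and the cut-off functions *)

Section C1_cutoffs.
Context (R : realType).

(** The basic C^1 function that vanishes on a half-line; both the extension [hext] and the cut-off
    [chi] are built from it. *)
Definition posq (u : R) : R := Num.max 0 u ^+ 2.

Lemma C1R_posq : C1R posq (fun u => 2 * Num.max 0 u).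
Proof.
have cmax : continuous (fun u : R => Num.max 0 u).
  by move=> u; apply: continuous_max; [exact: cvg_cst|exact: cvg_id].
split => [u|]; last by move=> u; apply: cvgM; [exact: cvg_cst|exact: cmax].
have [u0|[u0|->]] : u < 0 \/ 0 < u \/ u = 0 
  by case: (ltgtP u 0) => h; [left|right; left|right; right].
- rewrite max_l ?ltW// mulr0.
  apply: near_eq_is_derive (is_derive_cst 0 u 1); near=> w.
  by rewrite /posq max_l ?expr0n//= ltW//; near: w; exact: lt_nbhsl.
- rewrite max_r ?ltW//.
  apply: (@near_eq_is_derive R R R (fun u : R => u ^+ 2)).
    near=> w; rewrite /posq max_r// ltW//; near: w; exact: lt_nbhsr.
  apply: DeriveDef; first exact: exprn_derivable.
  by rewrite exp_derive expr1 /GRing.scale/= mulr1.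
(* At the kink the difference quotient lies between -|h| and |h|. *)
- rewrite maxxx mulr0.
  have hn : (fun h : R => `|h|) @ 0^' --> (0 : R).
    by rewrite -[X in _ --> X](@normr0 _ R); apply: cvg_norm; exact: cvg_within.
  suff h : (fun h : R => h^-1 *: ((posq \o shift 0) (h *: 1) - posq 0)) @ 0^' --> (0 : R).
    by apply: DeriveDef; [apply/cvg_ex; exists 0|exact: cvg_lim h].
  apply: (@squeeze_cvgr _ _ _ _ (fun h : R => - `|h|) (fun h : R => `|h|)).
  + near=> h; rewrite -ler_norml /posq /shift/= addr0 maxxx expr0n/= subr0.
    rewrite /GRing.scale/= mulr1 normrM normrX normfV.
    have [->|h0] := eqVneq h 0; first by rewrite !normr0 invr0 mul0r.
    rewrite mulrC ler_pdivrMr ?normr_gt0// -expr2.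
    by apply: lerXn2r; rewrite ?nnegrE//; case: (leP 0 h) => // _; rewrite normr0.
  + by rewrite -[X in _ --> X]oppr0; exact: cvgN hn.
  + exact: hn.
Unshelve. all: by end_near. Qed.

(* [hext u = u] for [u >= 1], and [hext] is C^1 and positive on the whole line:
   it makes powers of [hext (Dq c x)] smooth beyond the half-space. *)
Definition hext (u : R) : R := u + posq (1 - u).

Lemma hextE u : 1 <= u -> hext u = u.
Proof. by move=> u1; rewrite /hext /posq max_l ?expr0n ?addr0//; lra. Qed.

Lemma hext_gt0 u : 0 < hext u.
Proof.
have [u1|u1] := leP 1 u; first by rewrite hextE//; lra.
(* For u < 1 the value is u + (1 - u)^2 = u^2 - u + 1, which has no real zero. *)
by rewrite /hext /posq max_r; nra.
Qed.

Definition dhext (u : R) : R := 1 - 2 * Num.max 0 (1 - u).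

Lemma C1R_hext : C1R hext dhext.
Proof.
split => [u|].
  have h1 : is_derive u 1 (fun u : R => 1 - u) (-1).
    by have := is_deriveB (is_derive_cst (1 : R) u (1 : R)) (is_derive_id u (1 : R));
      rewrite sub0r.
  have h2 := @is_derive1_comp _ posq (fun u => 1 - u) _ _ _ (C1R_posq.1 (1 - u)) h1.
  have := is_deriveD (is_derive_id u 1) h2.
  by rewrite mulrN1.
move=> u; apply: cvgB; first exact: cvg_cst.
apply: (@continuous_compose _ _ _ (fun u : R => 1 - u) (fun u => 2 * Num.max 0 u)).
  by move=> v; apply: cvgB; [exact: cvg_cst|exact: cvg_id].
exact: C1R_posq.2.
Qed.

Definition pwr (b u : R) : R := hext u `^ (- b).

Definition dpwr (b u : R) : R := - b * hext u `^ (- b - 1) * dhext u.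

Lemma pwrE b u : 1 <= u -> pwr b u = u `^ (- b).
Proof. by move=> u1; rewrite /pwr hextE. Qed.

Lemma dpwrE b u : 1 <= u -> dpwr b u = - b * u `^ (- b - 1).
Proof.
by move=> u1; rewrite /dpwr /dhext hextE// max_l ?mulr0 ?subr0 ?mulr1//; lra.
Qed.

Lemma C1R_pwr b : C1R (pwr b) (dpwr b).
Proof.
have ch : continuous hext.
  move=> u; apply/differentiable_continuous/derivable1_diffP.
  by have [] := C1R_hext.1 u.
split => [u|u].
  exact: (is_derive1_comp (is_derive1_powR (- b) (hext_gt0 u)) (C1R_hext.1 u)).
apply: cvgM; last exact: C1R_hext.2.
apply: cvgM; first exact: cvg_cst.
apply: (@continuous_comp _ _ _ hext (fun u => u `^ (- b - 1))); first exact: ch.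
apply/differentiable_continuous/derivable1_diffP/derivable_powR.
by rewrite in_itv/= andbT hext_gt0.
Qed.

(** Falls from 1 at u = 0 to 0 at u = k. It is not locally constant near 0; pointwise convergence to
    1 as k grows is what the limit argument uses. *)
Definition chi (k u : R) : R := posq (1 - u / k).

Definition dchi (k u : R) : R := - (2 * Num.max 0 (1 - u / k) / k).

Lemma C1R_chi k : C1R (chi k) (dchi k).
Proof.
split => [u|].
  have h1 : is_derive u 1 (fun u : R => 1 - u / k) (- k^-1).
    have := is_deriveB (is_derive_cst (1 : R) u (1 : R))
      (is_deriveZ k^-1 (is_derive_id u (1 : R))).
    rewrite sub0r /GRing.scale/= mulr1.
    rewrite (_ : cst 1 - _ = fun u : R => 1 - u / k)//.
    by apply/funext => v; rewrite mulrC.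
  have := @is_derive1_comp _ posq (fun u => 1 - u / k) _ _ _ (C1R_posq.1 (1 - u / k)) h1.
  by rewrite mulrN.
move=> u; apply: cvgN; apply: cvgM; last exact: cvg_cst.
apply: (@continuous_compose _ _ _ (fun u : R => 1 - u / k) (fun u => 2 * Num.max 0 u)).
  move=> v; apply: cvgB; first exact: cvg_cst.
  by apply: cvgM; [exact: cvg_id|exact: cvg_cst].
exact: C1R_posq.2.
Qed.

Lemma chi_ge0 k u : 0 <= chi k u.
Proof. exact: sqr_ge0. Qed.

Lemma chi_le1 k u : 0 < k -> 0 <= u -> chi k u <= 1.
Proof.
move=> k0 u0; rewrite /chi /posq expr_le1//; last by rewrite le_max lexx.
by rewrite ge_max ler01 gerBl divr_ge0// ltW.
Qed.

Lemma chi_eq0 k u : 0 < k -> k <= u -> chi k u = 0.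
Proof.
move=> k0 ku; rewrite /chi /posq max_l ?expr0n// subr_le0.
by rewrite ler_pdivlMr// mul1r.
Qed.

(** For u >= k the derivative is zero, and for u < k it is at most 2/k <= 2/u. The bound does not
    depend on [k], which makes dominated convergence available for the cut-off error. *)
Lemma dchi_le k u : 0 < k -> 0 < u -> `|dchi k u| <= 2 / u.
Proof.
move=> k0 u0; rewrite /dchi normrN normrM normfV (gtr0_norm k0).
have [ku|uk] := leP k u.
  rewrite max_l ?mulr0 ?normr0 ?mul0r ?divr_ge0// ?(ltW u0)//.
  by rewrite subr_le0 ler_pdivlMr// mul1r.
rewrite ler_pM ?invr_ge0 ?normr_ge0 ?(ltW k0)//; last first.
  by rewrite lef_pV2 ?posrE// ltW.
have m0 : 0 <= Num.max 0 (1 - u / k) by rewrite le_max lexx.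
rewrite ger0_norm ?mulr_ge0// -[leRHS]mulr1 ler_wpM2l//.
by rewrite ge_max ler01 gerBl divr_ge0// ltW.
Qed.

Lemma cvg_chi u : 0 <= u -> chi k.+1%:R u @[k --> \oo] --> (1 : R).
Proof.
move=> u0.
have h : (fun k : nat => 1 - u * k.+1%:R^-1) @ \oo --> (1 : R).
  rewrite -[X in _ --> X]subr0 -[X in _ --> _ - X](mulr0 u).
  apply: cvgB; first exact: cvg_cst.
  apply: cvgM; first exact: cvg_cst.
  exact: cvg_harmonic.
have cp : continuous posq.
  move=> v; apply/differentiable_continuous/derivable1_diffP.
  by have [] := C1R_posq.1 v.
rewrite [X in _ --> X](_ : 1 = posq 1); last by rewrite /posq max_r ?expr1n.
have := @cvg_comp _ _ _ (fun k : nat => 1 - u * k.+1%:R^-1) posq _ _ _ h (cp 1). by [].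
Qed.

Lemma cvg_dchi u : 0 < u -> dchi k.+1%:R u @[k --> \oo] --> (0 : R).
Proof.
move=> u0.
apply: (@squeeze_cvgr _ _ _ _ (fun k : nat => - (2 * harmonic k))
  (fun k : nat => 2 * harmonic k)).
- near=> k; rewrite -ler_norml /dchi normrN normrM normfV.
  rewrite (gtr0_norm (ltr0Sn _ _)) ler_wpM2r ?invr_ge0//.
  have m0 : 0 <= Num.max 0 (1 - u / k.+1%:R) by rewrite le_max lexx.
  rewrite ger0_norm ?mulr_ge0// -[leRHS]mulr1 ler_wpM2l//.
  by rewrite ge_max ler01 gerBl divr_ge0// ltW.
- rewrite -[X in _ --> X]oppr0 -[X in _ --> - X](mulr0 2); apply: cvgN; apply: cvgM.
    exact: cvg_cst.
  exact: cvg_harmonic.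
- rewrite -[X in _ --> X](mulr0 2); apply: cvgM; first exact: cvg_cst.
  exact: cvg_harmonic.
Unshelve. all: by end_near. Qed.

End C1_cutoffs.

(** * The kernel functions Phi_a in closed form *)

Section kernel_functions.
Context (R : realType) (n : nat).
Implicit Types (c : regime) (a b : 'I_n.+1) (x e v : pt R n).
Local Notation N := (n.+1%:R : R).

Lemma dotpDl x y v : dotp (x + y) v = dotp x v + dotp y v.
Proof.
rewrite /dotp /= addrACA -big_split/= mulrDl; congr (_ + _).
by apply: eq_bigr => i _; rewrite !mxE mulrDl.
Qed.

Lemma dotpZl (k : R) x v : dotp (k *: x) v = k * dotp x v.
Proof.
rewrite /dotp /= mulrDr mulr_sumr -mulrA; congr (_ + _).
by apply: eq_bigr => i _; rewrite !mxE mulrA.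
Qed.

Lemma dotpDr x y v : dotp v (x + y) = dotp v x + dotp v y.
Proof. by rewrite dotpC dotpDl !(dotpC v). Qed.

Lemma dotpZr (k : R) x v : dotp v (k *: x) = k * dotp v x.
Proof. by rewrite dotpC dotpZl (dotpC v). Qed.

Lemma dotp_dir a b : dotp (dir R a) (dir R b) = (a == b)%:R.
Proof.
case: (unliftP ord_max b) => [j|] ->; rewrite ?dotp_lift ?dotp_max;
  case: (unliftP ord_max a) => [i|] ->; rewrite ?dir_lift ?dir_max/= ?mxE//.
- by rewrite (inj_eq lift_inj) eq_sym.
- by rewrite [ord_max == _](negbTE (neq_lift _ _)).
- by rewrite eq_sym (negbTE (neq_lift _ _)).
- by rewrite eqxx.
Qed.

Lemma dotp_sqnorm x : dotp x x = sqnorm x.1 + (x.2 : R) ^+ 2.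
Proof. by congr (_ + _); rewrite ?expr2//; apply: eq_bigr => i _; rewrite expr2. Qed.

Lemma D10E x : D10 x = 1 + dotp x x.
Proof. by rewrite dotp_sqnorm /D10 addrA. Qed.

(* [Dq] is the paper's D: s + (t + 1)^2 for [kap c = 1] and 1 + s + t^2 for [kap c = 0]. *)
Definition kap c : R := if c is regime02 then 1 else 0.

Definition Dq c x : R := 1 + dotp x x + 2 * kap c * dotp x (dir R ord_max).

Definition gradD c x : pt R n := 2 *: x + (2 * kap c) *: dir R ord_max.

(* Up to a factor D^(-N/2), the kernel function Phi_a is the polynomial [pol a]. *)
Definition pol a x : R :=
  if a == ord_max then dotp x x - 1 else 2 * dotp x (dir R a).

Definition gradp a x : pt R n :=
  if a == ord_max then 2 *: x else 2 *: dir R a.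

Let coord2 a : pt R n -> R := (fun x => dotp x (dir R a)) \* (fun x => dotp x (dir R a)).

Let dotpxx_sum : (fun x : pt R n => dotp x x) = \sum_a coord2 a.
Proof. by apply/funext => x; rewrite dotp_sum_dir fct_sumE. Qed.

Let C1_coord2 a : C1 (coord2 a).
Proof. by apply: C1M; exact: C1_dotp. Qed.

Lemma derive_dotpxx x e : 'D_e (fun x => dotp x x) x = dotp (2 *: x) e.
Proof.
rewrite dotpxx_sum derive_sum => [|a]; last exact/C1_derivable/C1_coord2.
rewrite dotpZl dotp_sum_dir mulr_sumr; apply: eq_bigr => a _.
rewrite derive_C1M; try exact: C1_dotp.
have [_ ->] := diff_dotp (dir R a) x; lra.
Qed.

Lemma C1_dotpxx : C1 (fun x : pt R n => dotp x x).
Proof.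
rewrite dotpxx_sum (_ : \sum_a _ = fun x => \sum_a coord2 a x).
  exact: C1_sum.
by apply/funext => x; rewrite fct_sumE.
Qed.

Let DqE c : Dq c = (cst 1 \+ (fun x => dotp x x)) \+
  (cst (2 * kap c) \* (fun x => dotp x (dir R ord_max))).
Proof. by []. Qed.

Let C1_1dotp : C1 (cst 1 \+ (fun x : pt R n => dotp x x)).
Proof. by apply: C1D; [exact: C1_cst|exact: C1_dotpxx]. Qed.

Let C1_lin (k : R) v : C1 (cst k \* (fun x : pt R n => dotp x v)).
Proof. by apply: C1M; [exact: C1_cst|exact: C1_dotp]. Qed.

Let derive_lin (k : R) v x e :
  'D_e (cst k \* (fun x : pt R n => dotp x v)) x = k * dotp e v.
Proof.
rewrite derive_C1M; [|exact: C1_cst|exact: C1_dotp].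
by rewrite derive_cst mulr0 addr0; have [_ ->] := diff_dotp v x.
Qed.

Lemma C1_Dq c : C1 (Dq c).
Proof. by rewrite DqE; apply: C1D; [exact: C1_1dotp|exact: C1_lin]. Qed.

Lemma derive_Dq c x e : 'D_e (Dq c) x = dotp (gradD c x) e.
Proof.
rewrite DqE deriveD; [|exact: C1_derivable|exact: C1_derivable].
rewrite deriveD; [|by apply: derivable_cst|by apply: C1_derivable; exact: C1_dotpxx].
rewrite derive_cst add0r derive_dotpxx derive_lin /gradD dotpDl; congr (_ + _).
by rewrite dotpZl dotpC.
Qed.

Let polE a : pol a = if a == ord_max then (fun x => dotp x x) \+ cst (-1)
  else cst 2 \* (fun x => dotp x (dir R a)).
Proof. by apply/funext => x; rewrite /pol; case: ifP. Qed.

Lemma C1_pol a : C1 (pol a).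
Proof.
rewrite polE; case: ifP => _; last exact: C1_lin.
by apply: C1D; [exact: C1_dotpxx|exact: C1_cst].
Qed.

Lemma derive_pol a x e : 'D_e (pol a) x = dotp (gradp a x) e.
Proof.
rewrite polE /gradp; case: ifP => _.
  rewrite deriveD; [|by apply: C1_derivable; exact: C1_dotpxx|by apply: derivable_cst].
  by rewrite derive_cst addr0 derive_dotpxx.
by rewrite derive_lin dotpZl (dotpC e).
Qed.

(** The numerical factor of epsilon in the numerator of the bubble. *)
Definition nu c : R := if c is regime02 then 1 else 2.

Definition kphi c : R := (N - 2) / 2 * nu c `^ ((N - 2) / 2).

Lemma powRD_gt0 (u r s : R) : 0 < u -> u `^ (r + s) = u `^ r * u `^ s.
Proof. by move=> u0; rewrite powRD//; apply/implyP => _; rewrite gt_eqF. Qed.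

Lemma powR_invr (u r : R) : 0 < u -> u^-1 `^ r = u `^ (- r).
Proof. by move=> u0; rewrite -mulN1r powRrM -powR_inv1// ltW. Qed.

(** Along every parameter direction the bubble is a power of an affine function of h over a monic
    quadratic one. Translations (be = 0) and the dilation (be = 1) of both regimes are thus a single
    derivative. *)
Lemma powR_quotient_derive (m v al be D : R) : 0 < v -> 0 < D ->
  is_derive (0 : R) 1
    (fun h : R => (v * (1 + be * h) / (D + al * h + h ^+ 2)) `^ m)
    (m * v `^ m * D `^ (- (m + 1)) * (be * D - al)).
Proof.
move=> v0 D0.
pose num (h : R) := v * (1 + be * h); pose den (h : R) := D + al * h + h ^+ 2.
have did (k : R) : is_derive (0 : R) 1 (fun h => k * h) k.
  have := is_deriveZ k (is_derive_id (0 : R) (1 : R)).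
  by rewrite /GRing.scale/= mulr1.
have dnum : is_derive (0 : R) 1 num (v * be).
  have := is_deriveZ v (is_deriveD (is_derive_cst (1 : R) (0 : R) (1 : R)) (did be)).
  by rewrite add0r.
have dsq : is_derive (0 : R) 1 (fun h : R => h ^+ 2) 0.
  apply: DeriveDef; first exact: exprn_derivable.
  by rewrite exp_derive expr1 /GRing.scale/= !(mulr0, mul0r).
have dden : is_derive (0 : R) 1 den al.
  have := is_deriveD (is_deriveD (is_derive_cst (D : R) (0 : R) (1 : R)) (did al)) dsq.
  by rewrite add0r addr0.
have den0 : den 0 = D by rewrite /den mulr0 expr0n/= !addr0.
have num0 : num 0 = v by rewrite /num mulr0 addr0 mulr1.
have dinv : is_derive (0 : R) 1 (fun h => (den h)^-1) (- D ^- 2 * al).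
  apply: DeriveDef; first by apply: derivableV; rewrite ?den0 ?gt_eqF.
  rewrite deriveV ?den0 ?gt_eqF//.
  by have [_ ->] := dden; rewrite /GRing.scale/=.
have dq := is_deriveM dnum dinv.
have q0 : 0 < (num * (fun h => (den h)^-1)) 0.
  by rewrite -[X in 0 < X]/(num 0 * (den 0)^-1) num0 den0 mulr_gt0 ?invr_gt0.
have h := is_derive1_comp (is_derive1_powR m q0) dq.
apply: (is_derive_eq h).
have -> : (num * (fun h => (den h)^-1)) 0 = v / D.
  by rewrite -[LHS]/(num 0 * (den 0)^-1) num0 den0.
rewrite num0 den0 /GRing.scale/= powRM; [|exact: ltW|by rewrite invr_ge0 ltW].
have E1 : v `^ m = v `^ (m - 1) * v.
  by rewrite -{3}[v](powRr1 (ltW v0)) -powRD_gt0// subrK.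
have E2 : D `^ (- (m + 1)) = D^-1 `^ (m - 1) * D ^- 2.
  rewrite powR_invr// -[D ^+ 2](powR_mulrn 2 (ltW D0)) -powRN -powRD_gt0//.
  by congr (_ `^ _); lra.
rewrite E1 E2; field; exact: lt0r_neq0.
Qed.

Lemma sqnormBZ (y : 'rV[R]_n) (h : R) i :
  sqnorm (y - h *: delta_mx ord0 i) = sqnorm y - 2 * h * y ord0 i + h ^+ 2.
Proof.
rewrite /sqnorm (bigD1 i)//= [in RHS](bigD1 i)//=.
have -> : \sum_(j < n | j != i) (y - h *: delta_mx ord0 i) ord0 j ^+ 2 =
    \sum_(j < n | j != i) y ord0 j ^+ 2.
  by apply: eq_bigr => j ji; rewrite !mxE (negbTE ji) andbF mulr0 subr0.
rewrite !mxE !eqxx mulr1; ring.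
Qed.

Lemma Dq_gt0 c x : 0 <= (x.2 : R) -> 0 < Dq c x.
Proof.
move=> x0; rewrite /Dq dotp_max -D10E.
have := D10_gt0 x; case: c; rewrite /kap; nra.
Qed.

(** The coefficient of h in the denominator of the bubble when the parameter moves from (0, 1) to
    (0, 1) + h e_a. *)
Definition line_al c a x : R :=
  if a == ord_max then 2 * (1 + kap c * (x.2 : R)) else - (2 * dotp x (dir R a)).

Lemma bubble_line c a x (h : R) : bubble c (h *: dir R a + z01 R n) x =
  (nu c * (1 + (a == ord_max)%:R * h) / (Dq c x + line_al c a x * h + h ^+ 2))
    `^ ((N - 2) / 2).
Proof.
rewrite /line_al; case: (unliftP ord_max a) => [i|] ->.
  rewrite (eq_sym (lift _ _)) (negbTE (neq_lift _ _)) dotp_lift dir_lift.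
  rewrite /bubble /z01/= addr0 sqnormBZ scaler0 add0r mul0r addr0 mulr1.
  rewrite /Dq dotp_max dotp_sqnorm.
  by case: c; rewrite /nu /kap; congr ((_ / _) `^ _); ring.
rewrite eqxx dir_max /bubble /z01/= scaler0 addr0 subr0 /Dq dotp_max dotp_sqnorm.
rewrite /GRing.scale/= mulr1.
by case: c; rewrite /nu /kap; congr ((_ / _) `^ _); ring.
Qed.

Lemma PhiE c a x : 0 <= (x.2 : R) ->
  Phi c a x = kphi c * Dq c x `^ (- (N / 2)) * pol a x.
Proof.
move=> x0.
have nu0 : 0 < nu c by case: c.
have := powR_quotient_derive ((N - 2) / 2) (line_al c a x) (a == ord_max)%:R nu0
  (Dq_gt0 c x0).
set f := (fun h : R => _) => df.
have -> : Phi c a x = 'D_1 f 0.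
  have e : (fun h : R => h^-1 *: (((fun z => bubble c z x) \o shift (z01 R n))
        (h *: dir R a) - bubble c (z01 R n) x)) =
      (fun h : R => h^-1 *: ((f \o shift 0) (h *: 1) - f 0)).
    apply/funext => h /=; rewrite addr0 [h%:A]mulr1 /f -!bubble_line.
    by rewrite scale0r add0r.
  by rewrite /Phi /derive e.
have [_ ->] := df; rewrite /kphi.
have -> : - ((N - 2) / 2 + 1) = - (N / 2) :> R by lra.
(* What remains is be D - al: for the dilation D - 2(1 + kap t) = |x|^2 - 1, for a translation 2
   x_a. *)
congr (_ * _); rewrite /pol /line_al /Dq dotp_max; case: ifP => _.
  by rewrite mul1r; ring.
by rewrite mul0r sub0r opprK.
Qed.

End kernel_functions.

(** * Derivatives and decay of the kernel functions *)

Section kernel_estimates.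
Context (R : realType) (n : nat) (c : regime).
Implicit Types (a b : 'I_n.+1) (x e : pt R n).
Local Notation N := (n.+1%:R : R).

(** A C^1 function on all of R^N that agrees with Phi_a for t >= 0. In case (0,2) the closed form
    itself cannot serve, since D vanishes at (0, -1). *)
Definition ker a x : R := kphi R n c * pwr (N / 2) (Dq c x) * pol a x.

Let C1_pwr_Dq (s : R) : C1 (pwr s \o @Dq R n c).
Proof. exact: (C1_comp (@C1_Dq R n c) (C1R_pwr s)). Qed.

Lemma C1_ker a : C1 (ker a).
Proof.
apply: (C1M (f := cst (kphi R n c) \* (pwr (N / 2) \o Dq c)) _ (@C1_pol R n a)).
by apply: C1M; [exact: C1_cst|exact: C1_pwr_Dq].
Qed.

Lemma D10_le_Dq x : 0 <= (x.2 : R) -> D10 x <= Dq c x.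
Proof.
by move=> x0; rewrite D10E /Dq dotp_max; case: c; rewrite /kap; nra.
Qed.

Lemma Dq_ge1 x : 0 <= (x.2 : R) -> 1 <= Dq c x.
Proof. by move=> x0; apply: le_trans (D10_le_Dq x0); exact: D10_ge1. Qed.

(** From 2t <= 1 + t^2. Together with [D10_le_Dq] this allows every estimate to be stated in [D10]
    for both regimes. *)
Lemma Dq_le_2D10 x : 0 <= (x.2 : R) -> Dq c x <= 2 * D10 x.
Proof.
move=> x0; rewrite /Dq dotp_max -D10E /D10.
have := sqnorm_ge0 x.1; have := sqr_ge0 ((x.2 : R) - 1).
by rewrite sqrrB1; case: c; rewrite /kap; lra.
Qed.

Lemma kerE a x : 0 <= (x.2 : R) -> ker a x = Phi c a x.
Proof. by move=> x0; rewrite PhiE// /ker pwrE// Dq_ge1. Qed.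

(** For t >= 0, the gradient of [ker a] without its scalar factor kphi D^(-(N/2+1)): a polynomial
    field. *)
Definition radial_field a x : pt R n :=
  Dq c x *: gradp a x + (- (N / 2 * pol a x)) *: gradD c x.

Lemma dotp_radial_field a x e : dotp (radial_field a x) e =
  Dq c x * dotp (gradp a x) e - N / 2 * pol a x * dotp (gradD c x) e.
Proof. by rewrite /radial_field dotpDl !dotpZl mulNr. Qed.

Lemma derive_ker a x e : 0 <= (x.2 : R) ->
  'D_e (ker a) x =
  kphi R n c * Dq c x `^ (- (N / 2 + 1)) * dotp (radial_field a x) e.
Proof.
move=> x0; have D0 := Dq_gt0 c x0.
rewrite (@derive_C1M _ _ (cst (kphi R n c) \* (pwr (N / 2) \o Dq c)) (pol a));
  [|by apply: C1M => //; exact: C1_cst|exact: C1_pol].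
rewrite derive_C1M//; last exact: C1_cst.
rewrite derive_cst mulr0 addr0 (derive_C1_comp _ _ (@C1_Dq R n c) (C1R_pwr _)).
rewrite derive_Dq derive_pol /= pwrE ?Dq_ge1// dpwrE ?Dq_ge1//.
rewrite dotp_radial_field.
have -> : - (N / 2) - 1 = - (N / 2 + 1) :> R by lra.
have -> : Dq c x `^ (- (N / 2)) = Dq c x `^ (- (N / 2 + 1)) * Dq c x.
  by rewrite -{3}[Dq c x](powRr1 (ltW D0)) -powRD_gt0//; congr (_ `^ _); lra.
ring.
Qed.

Definition rtD x : R := D10 x `^ (1 / 2).

Lemma rtD_ge1 x : 1 <= rtD x.
Proof.
apply: (@le_trans _ _ (1 `^ (1 / 2))); first by rewrite powR1.
by apply: ge0_ler_powR; rewrite ?nnegrE ?ler01 ?D10_ge1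
  ?(ltW (D10_gt0 _)) ?divr_ge0.
Qed.

Lemma rtD_sqr x : rtD x * rtD x = D10 x.
Proof.
rewrite -powRD_gt0 ?D10_gt0//.
have -> : 1 / 2 + 1 / 2 = 1 :> R by lra.
by rewrite powRr1// ltW// D10_gt0.
Qed.

Lemma coord_le_rtD x a : `|dotp x (dir R a)| <= rtD x.
Proof.
have h : dotp x (dir R a) ^+ 2 <= D10 x.
  rewrite D10E (dotp_sum_dir x x) (bigD1 a)//= -expr2.
  have : 0 <= \sum_(i | i != a) dotp x (dir R i) * dotp x (dir R i).
    by apply: sumr_ge0 => i _; rewrite -expr2 sqr_ge0.
  lra.
have r0 : 0 <= rtD x := powR_ge0 _ _.
rewrite -(@ler_pXn2r _ 2)// ?nnegrE// real_normK ?num_real//.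
by rewrite [leRHS]expr2 rtD_sqr.
Qed.

Lemma pol_le a x : `|pol a x| <= 2 * D10 x.
Proof.
have := rtD_ge1 x; have := rtD_sqr x; have := coord_le_rtD x a.
have : 0 <= dotp x x by rewrite dotp_sqnorm addr_ge0 ?sqnorm_ge0 ?sqr_ge0.
rewrite /pol D10E; case: ifP => _ h1 h2 h3 h4.
  by rewrite ler_norml; apply/andP; split; lra.
rewrite normrM ger0_norm//; nra.
Qed.

Lemma dotp_dir_le1 a b : `|dotp (dir R a) (dir R b)| <= 1 :> R.
Proof. by rewrite dotp_dir; case: (a == b); rewrite ?normr1 ?normr0. Qed.

Lemma gradp_le a b x : `|dotp (gradp a x) (dir R b)| <= 2 * rtD x.
Proof.
rewrite /gradp; case: ifP => _; rewrite dotpZl normrM ger0_norm// ler_wpM2l//.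
  exact: coord_le_rtD.
exact: le_trans (dotp_dir_le1 _ _) (rtD_ge1 x).
Qed.

Lemma gradD_le b x : `|dotp (gradD c x) (dir R b)| <= 4 * rtD x.
Proof.
rewrite /gradD dotpDl !dotpZl; apply: le_trans (ler_normD _ _) _.
have := rtD_ge1 x; have := coord_le_rtD x b; have := dotp_dir_le1 ord_max b.
rewrite !normrM (ger0_norm (ler0n _ 2)).
by case: c; rewrite /kap ?normr1 ?normr0; lra.
Qed.

Lemma radial_field_le a b x : 0 <= (x.2 : R) ->
  `|dotp (radial_field a x) (dir R b)| <= (4 + 4 * N) * (D10 x * rtD x).
Proof.
move=> x0; rewrite dotp_radial_field.
apply: le_trans (ler_normB _ _) _; rewrite !normrM.
have E0 := D10_gt0 x; have r1 := rtD_ge1 x.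
have h1 : `|Dq c x| * `|dotp (gradp a x) (dir R b)| <= 2 * D10 x * (2 * rtD x).
  by apply: ler_pM => //; [rewrite gtr0_norm ?Dq_le_2D10 ?Dq_gt0|exact: gradp_le].
have h2 : `|pol a x| * `|dotp (gradD c x) (dir R b)| <= 2 * D10 x * (4 * rtD x).
  by apply: ler_pM => //; [exact: pol_le|exact: gradD_le].
rewrite (ger0_norm (_ : 0 <= N)) ?ler0n// (ger0_norm (_ : 0 <= 2^-1)) ?invr_ge0//.
have := ler_wpM2l (ler0n R n.+1) h2; lra.
Qed.

Lemma Dq_powR_le x (s : R) : 0 <= (x.2 : R) -> 0 <= s ->
  Dq c x `^ (- s) <= D10 x `^ (- s).
Proof.
move=> x0 s0; rewrite !powRN lef_pV2 ?posrE ?powR_gt0 ?D10_gt0 ?Dq_gt0//.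
by apply: ge0_ler_powR; rewrite ?nnegrE ?(ltW (D10_gt0 _)) ?(ltW (Dq_gt0 _ _)) ?D10_le_Dq.
Qed.

(** The polynomial [pol] grows at most like D, so Phi_a decays like |x|^(2-N). In the same way
    [radial_field] grows at most like D^(3/2), which gives the rate |x|^(1-N) for the gradient in
    [derive_ker_le]. *)
Lemma ker_le a : exists C : R, forall x, 0 <= (x.2 : R) ->
  `|ker a x| <= C * D10 x `^ (- (N / 2) + 1).
Proof.
exists (`|kphi R n c| * 2) => x x0.
rewrite /ker; move: (kphi R n c) => K.
rewrite !normrM pwrE ?Dq_ge1// (ger0_norm (powR_ge0 _ _)) -!mulrA ler_wpM2l//.
rewrite powRD_gt0 ?D10_gt0// powRr1 ?(ltW (D10_gt0 _))// [leRHS]mulrCA.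
apply: ler_pM; rewrite ?powR_ge0 ?pol_le//. by apply: Dq_powR_le; rewrite ?divr_ge0.
Qed.

Lemma derive_ker_le a : exists C : R, forall b x, 0 <= (x.2 : R) ->
  `|'D_(dir R b) (ker a) x| <= C * D10 x `^ (- (N / 2) + 1 / 2).
Proof.
exists (`|kphi R n c| * (4 + 4 * N)) => b x x0.
rewrite derive_ker//; move: (kphi R n c) => K.
rewrite !normrM (ger0_norm (powR_ge0 _ _)) -!mulrA ler_wpM2l//.
have -> : - (N / 2) + 1 / 2 = - (N / 2 + 1) + (1 + 1 / 2) :> R by lra.
rewrite !powRD_gt0 ?D10_gt0// powRr1 ?(ltW (D10_gt0 _))// [leRHS]mulrCA.
apply: ler_pM; rewrite ?powR_ge0 ?radial_field_le//.
by apply: Dq_powR_le; rewrite // addr_ge0 ?divr_ge0.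
Qed.

(** The boundary equation of the Jacobi kernel, B_bd Phi_a = 0. At t = 0 the normal component of
    grad [pol] vanishes and that of grad D is 2 kap, so only the power of D contributes. *)
Lemma normal_derivative_ker a (y : 'rV[R]_n) :
  'D_(dir R ord_max) (ker a) (bdry y) =
  - (kap R c * N / (1 + sqnorm y) * ker a (bdry y)).
Proof.
have y0 : 0 <= ((bdry y).2 : R) by [].
have D0 := Dq_gt0 c y0.
have DE : Dq c (bdry y) = 1 + sqnorm y.
  by rewrite /Dq dotp_max dotp_sqnorm /= mulr0 expr0n/= !addr0.
rewrite derive_ker// /ker pwrE ?Dq_ge1// dotp_radial_field.
have -> : dotp (gradp a (bdry y)) (dir R ord_max) = 0.
  rewrite /gradp; case: ifP => am; rewrite dotpZl; first by rewrite dotp_max/= mulr0.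
  by rewrite dotp_dir am mulr0.
rewrite /gradD dotpDl !dotpZl dotp_max/= dotp_dir eqxx !mulr0 !add0r mulr1.
have -> : Dq c (bdry y) `^ (- (N / 2)) =
    Dq c (bdry y) `^ (- (N / 2 + 1)) * Dq c (bdry y).
  by rewrite -{3}[Dq c (bdry y)](powRr1 (ltW D0)) -powRD_gt0//; congr (_ `^ _); lra.
rewrite DE in D0 *; field; exact: lt0r_neq0.
Qed.

End kernel_estimates.

(** * The cut-off gradient of a kernel function and its divergence *)

Section cut_gradient.
Context (R : realType) (n : nat) (c : regime).
Implicit Types (a b : 'I_n.+1) (x : pt R n) (k : R).
Local Notation N := (n.+1%:R : R).

Let amp k : pt R n -> R := cst (kphi R n c) \*
  ((pwr (N / 2 + 1) \o @Dq R n c) \* (chi k \o @Dq R n c)).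

(* On [t >= 0] this is [chi k (Dq c x)] times the [b]-th partial derivative of [ker c a]. *)
Definition cut_gradient a k b : pt R n -> R :=
  amp k \* (fun x => dotp (radial_field c a x) (dir R b)).

Let C1_amp k : C1 (amp k).
Proof.
apply: C1M; first exact: C1_cst.
apply: C1M; [exact: (C1_comp (@C1_Dq R n c) (C1R_pwr _))|].
exact: (C1_comp (@C1_Dq R n c) (C1R_chi _)).
Qed.

Let gradp_dir a b x : dotp (gradp a x) (dir R b) =
  if a == ord_max then 2 * dotp x (dir R b) else 2 * dotp (dir R a) (dir R b).
Proof. by rewrite /gradp; case: ifP => _; rewrite dotpZl. Qed.

Let C1_gradp a b : C1 (fun x => dotp (gradp a x) (dir R b)) /\
  forall x, 'D_(dir R b) (fun x => dotp (gradp a x) (dir R b)) x =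
            (a == ord_max)%:R * 2.
Proof.
rewrite (_ : (fun x => _) = if a == ord_max
  then cst 2 \* (fun x => dotp x (dir R b)) else cst (2 * dotp (dir R a) (dir R b))).
  case: ifP => _; last by split => [|x]; [exact: C1_cst|rewrite derive_cst mul0r].
  split; first by apply: C1M; [exact: C1_cst|exact: C1_dotp].
  move=> x; rewrite derive_C1M; [|exact: C1_cst|exact: C1_dotp].
  rewrite derive_cst mulr0 addr0; have [_ ->] := diff_dotp (dir R b) x.
  by rewrite dotp_dir eqxx mul1r mulr1.
by apply/funext => x; rewrite gradp_dir; case: ifP.
Qed.

Let C1_gradD b : C1 (fun x => dotp (gradD c x) (dir R b)) /\
  forall x, 'D_(dir R b) (fun x => dotp (gradD c x) (dir R b)) x = 2.
Proof.
rewrite (_ : (fun x => _) = (cst 2 \* (fun x => dotp x (dir R b))) \+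
    cst (2 * kap R c * dotp (dir R ord_max) (dir R b))); last first.
  by apply/funext => x; rewrite /gradD dotpDl !dotpZl.
have C : C1 (cst 2 \* (fun x : pt R n => dotp x (dir R b))).
  by apply: C1M; [exact: C1_cst|exact: C1_dotp].
split; first by apply: C1D => //; exact: C1_cst.
move=> x; rewrite deriveD; [|exact: C1_derivable|by apply: derivable_cst].
rewrite derive_cst addr0 derive_C1M; [|exact: C1_cst|exact: C1_dotp].
rewrite derive_cst mulr0 addr0; have [_ ->] := diff_dotp (dir R b) x.
by rewrite dotp_dir eqxx mulr1.
Qed.

(** Summed over [b], the second component gives the divergence of [radial_field]. *)
Let C1_rf a b : C1 (fun x => dotp (radial_field c a x) (dir R b)) /\
  forall x, 'D_(dir R b) (fun x => dotp (radial_field c a x) (dir R b)) x =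
    (1 - N / 2) * (dotp (gradp a x) (dir R b) * dotp (gradD c x) (dir R b)) +
    Dq c x * ((a == ord_max)%:R * 2) - N * pol a x.
Proof.
rewrite (_ : (fun x => _) = (@Dq R n c \* (fun x => dotp (gradp a x) (dir R b))) \+
  (cst (- (N / 2)) \* (@pol R n a \* (fun x => dotp (gradD c x) (dir R b))))); last first.
  by apply/funext => x; rewrite dotp_radial_field /= mulNr mulrA.
have C2 := C1M (@C1_pol R n a) (C1_gradD b).1.
have C1' := C1M (@C1_Dq R n c) (C1_gradp a b).1.
have C3 := C1M (@C1_cst R n (- (N / 2))) C2.
split; first exact: C1D.
move=> x; rewrite deriveD; [|exact: C1_derivable|exact: C1_derivable].
rewrite (derive_C1M _ _ (@C1_Dq R n c) (C1_gradp a b).1).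
rewrite (derive_C1M _ _ (@C1_cst R n _) C2).
rewrite (derive_C1M _ _ (@C1_pol R n a) (C1_gradD b).1).
rewrite derive_cst mulr0 addr0 derive_Dq derive_pol (C1_gradp a b).2 (C1_gradD b).2 /=.
lra.
Qed.

Lemma C1_cut_gradient a k b : C1 (cut_gradient a k b).
Proof. by apply: C1M => //; exact: (C1_rf a b).1. Qed.

(** The set D < k lies in the ball of radius sqrt k <= k around (0, -kap); the extra 1 pays for the
    shifted centre. Negative t is included, as the test functions live on all of R^N. *)
Lemma cut_gradient_support a k b x : 1 <= k -> k + 1 < `|x| ->
  cut_gradient a k b x = 0.
Proof.
move=> k1; rewrite /cut_gradient /amp /= => kx.
rewrite [chi k _]chi_eq0 ?mulr0 ?mul0r//; first lra.
rewrite leNgt; apply/negP => Dk; move: kx; apply/negP; rewrite -leNgt.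
have Dx : 1 + sqnorm x.1 + (x.2 : R) ^+ 2 + 2 * kap R c * (x.2 : R) < k.
  by move: Dk; rewrite /Dq dotp_max dotp_sqnorm; lra.
have s0 := sqnorm_ge0 x.1.
have t2 := sqr_ge0 (x.2 + kap R c : R).
have hk : `|(x.2 : R)| <= k + 1 /\ sqnorm x.1 <= k ^+ 2.
  move: Dx t2; case: c; rewrite /kap ?mulr1 ?mulr0 ?mul0r ?addr0 => Dx t2.
    by split; [rewrite ler_norml; apply/andP; split; nra|nra].
  by split; [rewrite ler_norml; apply/andP; split; nra|nra].
rewrite [`|x|]prod_normE ge_max hk.1 andbT.
rewrite [leLHS]mx_normrE; apply/bigmax_leP; split => [|[i j] _ /=]; first lra.
rewrite ord1; apply: (@le_trans _ _ k); last lra.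
rewrite -(@ler_pXn2r _ 2)// ?nnegrE//; last lra.
by rewrite real_normK ?num_real// (le_trans (sqr_coord_le_sqnorm _ _) hk.2).
Qed.

Lemma C1c_cut_gradient a k b : 1 <= k -> C1c setT (cut_gradient a k b).
Proof.
move=> k1; apply: (C1c_setT (r := k + 1)) => [|x]; first exact: C1_cut_gradient.
exact: cut_gradient_support.
Qed.

Lemma cut_gradientE a k b x : 0 <= (x.2 : R) ->
  cut_gradient a k b x = chi k (Dq c x) * 'D_(dir R b) (ker c a) x.
Proof.
move=> x0; rewrite derive_ker// /cut_gradient /amp /= pwrE ?Dq_ge1//.
ring.
Qed.

(** Since the Laplacian of [pol a] is 2N for the dilation and 0 otherwise, this reads N grad pol .
    grad D = 2N pol + D Lap pol. It is the algebraic reason why D^(-N/2) pol solves the Jacobi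
    equation. *)
Let kernel_identity a x :
  N * dotp (gradp a x) (gradD c x) =
  2 * N * pol a x + Dq c x * (N * ((a == ord_max)%:R * 2)).
Proof.
rewrite /gradp /gradD /pol /Dq; case: eqP => am; rewrite dotpZl dotpDr !dotpZr /=.
  ring.
rewrite dotp_dir (introF eqP am) (dotpC (dir R a)) /=; ring.
Qed.

Let gradD_sqr x : dotp (gradD c x) (gradD c x) = 4 * (Dq c x - 1 + kap R c).
Proof.
rewrite /gradD !(dotpDl, dotpDr, dotpZl, dotpZr) dotp_dir eqxx (dotpC (dir R _) x).
by rewrite /Dq /=; case: c; rewrite /kap; ring.
Qed.

Let derive_amp k b x : 'D_(dir R b) (amp k) x =
  kphi R n c * (pwr (N / 2 + 1) (Dq c x) * dchi k (Dq c x) +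
                chi k (Dq c x) * dpwr (N / 2 + 1) (Dq c x)) *
  dotp (gradD c x) (dir R b).
Proof.
have Cp := C1_comp (@C1_Dq R n c) (C1R_pwr (N / 2 + 1)).
have Cc := C1_comp (@C1_Dq R n c) (C1R_chi k).
rewrite (derive_C1M _ _ (@C1_cst R n _) (C1M Cp Cc)) (derive_C1M _ _ Cp Cc).
rewrite derive_cst mulr0 addr0.
rewrite (derive_C1_comp _ _ (@C1_Dq R n c) (C1R_chi _)).
rewrite (derive_C1_comp _ _ (@C1_Dq R n c) (C1R_pwr _)) derive_Dq /=.
ring.
Qed.

(** For t >= 0 this is dchi(D) grad D . grad [ker], the term in which the derivative falls on the
    cut-off; the factor D - 1 + kap is |grad D|^2 / 4. *)
Definition cut_error a k x : R :=
  kphi R n c * dchi k (Dq c x) * Dq c x `^ (- (N / 2 + 1)) *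
  (Dq c x * dotp (gradp a x) (gradD c x) -
   2 * N * pol a x * (Dq c x - 1 + kap R c)).

(** Apart from the error this is chi times the Laplacian of [ker]. With [kernel_identity] and
    [gradD_sqr] everything but the potential cancels: zero in case (0,2), and -N(N+2) D^(-2) Phi_a
    in case (1,0). *)
Lemma div_cut_gradient a k x : 0 <= (x.2 : R) ->
  \sum_b 'D_(dir R b) (cut_gradient a k b) x =
  - ((1 - kap R c) * N * (N + 2) * Dq c x ^- 2 * (chi k (Dq c x) * ker c a x)) +
  cut_error a k x.
Proof.
move=> x0; have D0 := Dq_gt0 c x0.
have sum_cst (u : R) : \sum_(b < n.+1) u = N * u.
  by rewrite sumr_const card_ord mulr_natl.
under eq_bigr => b _.
  rewrite (derive_C1M _ _ (C1_amp k) (C1_rf a b).1) derive_amp (C1_rf a b).2.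
  rewrite [X in _ + X](_ : _ = kphi R n c *
     (pwr (N / 2 + 1) (Dq c x) * dchi k (Dq c x) +
      chi k (Dq c x) * dpwr (N / 2 + 1) (Dq c x)) *
      (dotp (radial_field c a x) (dir R b) * dotp (gradD c x) (dir R b))); last ring.
  over.
rewrite big_split/= -!mulr_sumr -dotp_sum_dir dotp_radial_field.
rewrite sumrB big_split/= -mulr_sumr -dotp_sum_dir !sum_cst.
rewrite gradD_sqr /cut_error /ker /amp /= !pwrE ?Dq_ge1// dpwrE ?Dq_ge1//.
have K := kernel_identity a x.
set Q := dotp _ _ in K *; set p := pol a x in K *; set D := Dq c x in K D0 *.
have -> : D `^ (- (N / 2 + 1) - 1) = D `^ (- (N / 2 + 1)) / D.
  by rewrite powRD_gt0// powR_inv1// ltW.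
have -> : D `^ (- (N / 2)) = D `^ (- (N / 2 + 1)) * D.
  by rewrite -{3}[D](powRr1 (ltW D0)) -powRD_gt0//; congr (_ `^ _); lra.
move: (kphi R n c) (chi k D) (dchi k D) (D `^ _) => kp ch dch w.
have -> : N * (D * ((a == ord_max)%:R * 2)) = N * Q - 2 * N * p.
  by rewrite mulrCA K; ring.
field; exact: lt0r_neq0.
Qed.

(** The three factors are at most 2/D, D^(-(N/2+1)) and a multiple of D^2, and their product is of
    order D^(-N/2) with a constant independent of [k]. *)
Lemma cut_error_le a : exists C : R, forall k x, 0 < k -> 0 <= (x.2 : R) ->
  `|cut_error a k x| <= C * D10 x `^ (- (N / 2)).
Proof.
exists (`|kphi R n c| * (2 * (6 + 4 * N))) => k x k0 x0.
have D0 := Dq_gt0 c x0; have D1 := Dq_ge1 c x0.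
have p2 : `|pol a x| <= 2 * Dq c x.
  by apply: le_trans (pol_le a x) _; rewrite ler_wpM2l// D10_le_Dq.
have N0 : 0 < N by rewrite ltr0Sn.
have Q6 : `|dotp (gradp a x) (gradD c x)| <= 6 * Dq c x.
  have -> : dotp (gradp a x) (gradD c x) =
      2 * pol a x + Dq c x * ((a == ord_max)%:R * 2).
    by apply: (mulfI (lt0r_neq0 N0)); rewrite kernel_identity; ring.
  apply: le_trans (ler_normD _ _) _; rewrite !normrM (ger0_norm (ler0n _ 2)).
  have : `|(a == ord_max)%:R : R| <= 1 by case: eqP; rewrite ?normr1 ?normr0.
  rewrite (gtr0_norm D0); move: (`|_%:R|) => g g1.
  have := ler_wpM2l (ltW D0) g1; lra.
have kd : `|Dq c x - 1 + kap R c| <= Dq c x.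
  by rewrite ger0_norm; case: c D1; rewrite /kap; lra.
rewrite /cut_error; move: (kphi R n c) => K; rewrite !normrM (ger0_norm (powR_ge0 _ _)).
rewrite -!mulrA ler_wpM2l//.
apply: (@le_trans _ _ (2 / Dq c x * (Dq c x `^ (- (N / 2 + 1)) *
    ((6 + 4 * N) * (Dq c x * Dq c x))))).
  apply: ler_pM; rewrite ?mulr_ge0 ?powR_ge0//; first exact: dchi_le.
  apply: ler_wpM2l; rewrite ?powR_ge0//.
  apply: le_trans (ler_normB _ _) _; rewrite !normrM (gtr0_norm D0).
  rewrite (ger0_norm (ler0n _ 2)) (gtr0_norm N0).
  have h1 := ler_wpM2l (ltW D0) Q6.
  have h2 : `|pol a x| * `|Dq c x - 1 + kap R c| <= 2 * Dq c x * Dq c x.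
    by apply: ler_pM.
  have := ler_wpM2l (ltW N0) h2; lra.
have -> : 2 / Dq c x * (Dq c x `^ (- (N / 2 + 1)) * ((6 + 4 * N) * (Dq c x * Dq c x)))
    = 2 * (6 + 4 * N) * Dq c x `^ (- (N / 2)).
  have -> : Dq c x `^ (- (N / 2)) = Dq c x `^ (- (N / 2 + 1)) * Dq c x.
    by rewrite -{3}[Dq c x](powRr1 (ltW D0)) -powRD_gt0//; congr (_ `^ _); lra.
  field; exact: lt0r_neq0.
by rewrite -mulrA ler_wpM2l// ler_wpM2l ?addr_ge0 ?mulr_ge0// Dq_powR_le// divr_ge0.
Qed.

Lemma cvg_cut_error a x : 0 <= (x.2 : R) ->
  cut_error a k.+1%:R x @[k --> \oo] --> (0 : R).
Proof.
move=> x0; pose z := kphi R n c * (Dq c x `^ (- (N / 2 + 1)) *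
  (Dq c x * dotp (gradp a x) (gradD c x) -
   2 * N * pol a x * (Dq c x - 1 + kap R c))).
have -> : (fun k : nat => cut_error a k.+1%:R x) =
    (fun k : nat => dchi k.+1%:R (Dq c x) * z).
  by apply/funext => k; rewrite /cut_error /z; ring.
rewrite -[X in _ --> X](mul0r z); apply: cvgM; last exact: cvg_cst.
by apply: cvg_dchi; exact: Dq_gt0.
Qed.

End cut_gradient.

(** * Integrability criteria: L^p on a subset, Young's inequality, weights *)

Section Lfun_on.
Context d (T : measurableType d) (R : realType) (mu : {measure set T -> \bar R}).
Implicit Types (D : set T) (f g : T -> R) (p : R).

Lemma restrict_powR D f p : 1 <= p ->
  (fun x => `|(f \_ D) x| `^ p) = (fun x => `|f x| `^ p) \_ D.
Proof.
move=> p1; apply/funext => x; rewrite !patchE; case: ifP => // _.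
by rewrite normr0 powR0// gt_eqF// (lt_le_trans ltr01).
Qed.

Lemma Lfun_onP D f p : measurable D -> 1 <= p ->
  f \_ D \in Lfun mu p%:E <->
  measurable_fun D f /\ mu.-integrable D (fun x => (`|f x| `^ p)%:E).
Proof.
move=> mD p1; split.
  move=> fp; have := Lfun_integrable p1 fp.
  move: fp => /andP[/[!inE] mf _] h; split.
    by apply/(measurable_restrictT _ mD).
  apply/(integrable_mkcond _ mD); rewrite restrict_EFin -restrict_powR//.
move=> [mf ifp]; rewrite inE; apply/andP; split; rewrite inE/=.
  exact/(measurable_restrictT _ mD).
rewrite /finite_norm unlock /Lnorm poweR_lty//.
have := (integrable_mkcond _ mD).1 ifp; rewrite restrict_EFin -restrict_powR//.
by move=> /integrable_lty; apply.
Qed.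

Lemma le_integrable_weight D f g : measurable D -> measurable_fun D f ->
  (exists C : R, forall x, D x -> `|f x| <= C * g x) ->
  mu.-integrable D (EFin \o g) -> mu.-integrable D (EFin \o f).
Proof.
move=> mD mf [C fg] ig; apply: (le_integrable_fun mD mf fg).
rewrite (_ : _ \o _ = (fun x => C%:E * (g x)%:E)%E); last exact/funext.
exact: integrableZl.
Qed.

Lemma integrable_EFinD D f g : measurable D -> mu.-integrable D (EFin \o f) ->
  mu.-integrable D (EFin \o g) -> mu.-integrable D (EFin \o (fun x => f x + g x)).
Proof. by move=> mD hf hg; have := integrableD mD hf hg. Qed.

Lemma integrable_EFinZ D f (k : R) : measurable D -> mu.-integrable D (EFin \o f) ->
  mu.-integrable D (EFin \o (fun x => k * f x)).
Proof. by move=> mD hf; have := integrableZl mD k hf. Qed.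

Lemma integrable_eq_on D f g : measurable D -> (forall x, D x -> f x = g x) ->
  mu.-integrable D (EFin \o f) -> mu.-integrable D (EFin \o g).
Proof. by move=> mD fg; apply: eq_integrable => // x /[!inE] /fg /= ->. Qed.

Lemma integrable_sum_EFin (I : finType) D (f : I -> T -> R) : measurable D ->
  (forall i, mu.-integrable D (EFin \o f i)) ->
  mu.-integrable D (EFin \o (fun x => \sum_i f i x)).
Proof.
move=> mD h; have := integrable_sum mD (index_enum I) (P := predT) (fun i _ => h i).
by rewrite (_ : _ \o _ = fun x => (\sum_i (EFin \o f i) x)%E)//;
  apply/funext => x; rewrite /= sumEFin.
Qed.

End Lfun_on.

(** Young's inequality with both constants 1/p and 1/q enlarged to 1, which is enough for questions
    of integrability. *)
Lemma young (R : realType) (p u v : R) : 1 < p ->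
  `|u * v| <= `|u| `^ p + `|v| `^ (p / (p - 1)).
Proof.
move=> p1; have p0 : 0 < p by lra.
have q0 : 0 < p / (p - 1) by rewrite divr_gt0//; lra.
have q1 : 1 <= p / (p - 1) by rewrite ler_pdivlMr; lra.
rewrite normrM.
have := conjugate_powR (normr_ge0 u) (normr_ge0 v) p0 q0.
have -> : p^-1 + (p / (p - 1))^-1 = 1.
  by field; apply/andP; split; apply: lt0r_neq0; lra.
move=> /(_ erefl) h; apply: le_trans h _; apply: lerD.
  by rewrite ler_pdivrMr// ler_peMr ?powR_ge0// ltW.
by rewrite ler_pdivrMr// ler_peMr ?powR_ge0.
Qed.

Lemma integrable_mul d (T : measurableType d) (R : realType)
    (mu : {measure set T -> \bar R}) (D : set T) (f g : T -> R) (p q : R) :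
  measurable D -> 1 < p -> p / (p - 1) = q ->
  measurable_fun D f -> measurable_fun D g ->
  mu.-integrable D (fun x => (`|f x| `^ p)%:E) ->
  mu.-integrable D (fun x => (`|g x| `^ q)%:E) ->
  mu.-integrable D (EFin \o (fun x => f x * g x)).
Proof.
move=> mD p1 <- mf mg ifp igq; apply: (le_integrable_weight mD
  (g := fun x => `|f x| `^ p + `|g x| `^ (p / (p - 1)))).
- exact: measurable_funM.
- by exists 1 => x _; rewrite mul1r; exact: young.
- exact: integrable_EFinD.
Qed.

Lemma powR_weight_le (R : realType) (u z C s p : R) :
  1 <= u -> `|z| <= C * u `^ (- s) -> 0 <= p ->
  `|z| `^ p <= `|C| `^ p * u `^ (- (s * p)).
Proof.
move=> u1 zC p0.
have zC' : `|z| <= `|C| * u `^ (- s).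
  by apply: le_trans zC _; rewrite ler_wpM2r ?powR_ge0// ler_norm.
rewrite -mulNr powRrM -powRM ?powR_ge0//.
by apply: ge0_ler_powR; rewrite ?nnegrE ?mulr_ge0 ?powR_ge0.
Qed.

Section integrals_half_space.
Context (R : realType) (n : nat).
Implicit Types (f g : pt R n -> R).

Let mH := @measurable_half_space R n.

Lemma int_HD f g : integrable_H f -> integrable_H g ->
  int_H (fun x => f x + g x) = int_H f + int_H g.
Proof. exact: (RintegralD mH). Qed.

Lemma int_HZ f (k : R) : integrable_H f ->
  int_H (fun x => k * f x) = k * int_H f.
Proof. by move=> hf; apply: RintegralZl => //; exact: mH. Qed.

Lemma eq_int_H f g : (forall x, half_space x -> f x = g x) -> int_H f = int_H g.
Proof. by move=> fg; apply: eq_Rintegral => x /[!inE]; exact: fg. Qed.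

Lemma int_bdD (f g : 'rV[R]_n -> R) : integrable_bd f -> integrable_bd g ->
  int_bd (fun x => f x + g x) = int_bd f + int_bd g.
Proof. exact: RintegralD. Qed.

Lemma int_bdZ (f : 'rV[R]_n -> R) (k : R) : integrable_bd f ->
  int_bd (fun x => k * f x) = k * int_bd f.
Proof. by move=> hf; apply: RintegralZl. Qed.

Lemma eq_int_bd (f g : 'rV[R]_n -> R) : f =1 g -> int_bd f = int_bd g.
Proof. by move=> /funext ->. Qed.

Lemma integrable_HD f g : integrable_H f -> integrable_H g ->
  integrable_H (fun x => f x + g x).
Proof. exact: (integrable_EFinD mH). Qed.

Lemma integrable_HZ f (k : R) : integrable_H f -> integrable_H (fun x => k * f x).
Proof. exact: (integrable_EFinZ k mH). Qed.

Lemma eq_integrable_H f g : (forall x, half_space x -> f x = g x) ->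
  integrable_H f -> integrable_H g.
Proof. exact: (integrable_eq_on mH). Qed.

Lemma integrable_bdD (f g : 'rV[R]_n -> R) : integrable_bd f -> integrable_bd g ->
  integrable_bd (fun x => f x + g x).
Proof. exact: integrable_EFinD. Qed.

Lemma integrable_bdZ (f : 'rV[R]_n -> R) (k : R) : integrable_bd f ->
  integrable_bd (fun x => k * f x).
Proof. exact: integrable_EFinZ. Qed.

End integrals_half_space.

(** * Which products are integrable for members of Sigma *)

Section energy_space.
Context (R : realType) (n : nat) (hn : (2 <= n)%N).
Implicit Types (v w : wfun R n) (a : 'I_n.+1) (h : pt R n -> R).
Local Notation N := (n.+1%:R : R).
Local Notation H := (@half_space R n).

Let mH := @measurable_half_space R n.

Let pH : R := 2 * N / (N - 2).
Let pB : R := 2 * (N - 1) / (N - 2).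

Lemma N_ge3 : 3 <= N. Proof. by rewrite ler_nat. Qed.

Let pH_gt1 : 1 < pH.
Proof. by rewrite /pH ltr_pdivlMr; have := N_ge3; lra. Qed.

Let pB_gt1 : 1 < pB.
Proof. by rewrite /pB ltr_pdivlMr; have := N_ge3; lra. Qed.

Let conj_pH : pH / (pH - 1) = 2 * N / (N + 2).
Proof.
have N3 := N_ge3; rewrite /pH; field.
by repeat (apply/andP; split); apply: lt0r_neq0; lra.
Qed.

Let conj_pB : pB / (pB - 1) = 2 * (N - 1) / N.
Proof.
have N3 := N_ge3; rewrite /pB; field.
by repeat (apply/andP; split); apply: lt0r_neq0; lra.
Qed.

Lemma Sigma_fn w : in_Sigma w -> measurable_fun H (fn w) /\
  (lebesgue_pt R n).-integrable H (fun x => (`|fn w x| `^ pH)%:E).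
Proof. by move=> [_ _ h _]; exact: (@Lfun_onP _ _ R _ H _ pH mH (ltW pH_gt1)).1 h. Qed.

Lemma Sigma_grad w a : in_Sigma w ->
  measurable_fun H (fun x => dotp (grad w x) (dir R a)) /\
  (lebesgue_pt R n).-integrable H (fun x => (`|dotp (grad w x) (dir R a)| `^ 2)%:E).
Proof. by move=> [_ h _ _]; exact: (@Lfun_onP _ _ R _ H _ 2 mH (ler1n R 2)).1 (h a). Qed.

Lemma Sigma_tr w : in_Sigma w -> measurable_fun setT (tr w) /\
  (lebesgue_rV R n).-integrable setT (fun x => (`|tr w x| `^ pB)%:E).
Proof.
move=> [_ _ _ h]; apply: (@Lfun_onP _ _ R _ setT _ pB measurableT (ltW pB_gt1)).1.
by rewrite patch_setT.
Qed.

Lemma integrable_grad v w : in_Sigma v -> in_Sigma w ->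
  integrable_H (fun x => dotp (grad v x) (grad w x)).
Proof.
move=> Sv Sw; rewrite /integrable_H.
rewrite (_ : (fun x => _) = fun x =>
  \sum_a dotp (grad v x) (dir R a) * dotp (grad w x) (dir R a)); last first.
  by apply/funext => x; exact: dotp_sum_dir.
apply: integrable_sum_EFin => // a.
have [mv iv] := Sigma_grad a Sv; have [mw iw] := Sigma_grad a Sw.
apply: (integrable_mul (p := 2) (q := 2)) => //; first lra.
by rewrite [2 - 1](_ : _ = 1) ?divr1//; lra.
Qed.

Lemma integrable_H_weight (s : R) : 3 / 5 * N <= s ->
  integrable_H (fun x : pt R n => D10 x `^ (- s)).
Proof.
move=> hs; apply: (integrableS measurableT mH) => //.
have mD : measurable_fun setT (fun x : pt R n => D10 x `^ (- s)).
  by apply: (measurableT_comp (measurable_powR _)); exact: measurable_D10.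
apply: (le_integrable_fun measurableT mD (g := fun x : pt R n => D10 x `^ (- (3 / 5) * N))).
  move=> x _; rewrite ger0_norm ?powR_ge0//; apply: ler_powR; first exact: D10_ge1.
  by rewrite mulNr lerN2.
exact: integrable_pt_weight.
Qed.

Lemma integrable_bd_weight (s : R) : 3 / 5 * (N - 1) <= s ->
  integrable_bd (fun y : 'rV[R]_n => (1 + sqnorm y) `^ (- s)).
Proof.
move=> hs.
have mD : measurable_fun setT (fun y : 'rV[R]_n => (1 + sqnorm y) `^ (- s)).
  apply: (measurableT_comp (measurable_powR _)).
  by apply: measurable_funD => //; exact: measurable_sqnorm.
apply: (le_integrable_fun measurableT mD
  (g := fun y : 'rV[R]_n => (1 + sqnorm y) `^ (- (3 / 5) * n%:R))).
  move=> y _; rewrite ger0_norm ?powR_ge0//; apply: ler_powR.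
    by rewrite lerDl sqnorm_ge0.
  by rewrite mulNr lerN2; move: hs; rewrite -(natr1 n) addrK.
exact: integrable_rV_weight.
Qed.

(** The exponent conjugate to 2N/(N-2) is 2N/(N+2), and D10^(-N/2) to this power is
    D10^(-N^2/(N+2)). Comparison with the weight of exponent 3N/5 asks for N^2/(N+2) >= 3N/5, that
    is N >= 3. *)
Lemma integrable_H_fn w h : in_Sigma w -> measurable_fun H h ->
  (exists C : R, forall x, H x -> `|h x| <= C * D10 x `^ (- (N / 2))) ->
  integrable_H (fun x => h x * fn w x).
Proof.
move=> Sw mh [C hC]; have [mw iw] := Sigma_fn Sw; have N3 := N_ge3.
apply: (@eq_integrable_H _ _ (fun x => fn w x * h x)) => [x _|]; first by rewrite mulrC.
have q0 : 0 <= 2 * N / (N + 2) by rewrite divr_ge0; lra.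
apply: (integrable_mul mH pH_gt1 conj_pH mw mh iw).
apply: (le_integrable_weight mH (g := fun x : pt R n => D10 x `^ (- (N / 2 * (2 * N / (N + 2)))))).
- apply: (@measurable_comp _ _ _ _ _ _ setT (fun z : R => z `^ (2 * N / (N + 2)))) => //.
  by apply: measurableT_comp.
- exists (`|C| `^ (2 * N / (N + 2))) => x Hx.
  rewrite ger0_norm ?powR_ge0//; apply: powR_weight_le (D10_ge1 x) (hC x Hx) q0.
- apply: integrable_H_weight; rewrite mulrA ler_pdivlMr; last lra.
  nra.
Qed.

Lemma integrable_bd_tr w (g : 'rV[R]_n -> R) : in_Sigma w -> measurable_fun setT g ->
  (exists C : R, forall y, `|g y| <= C * (1 + sqnorm y) `^ (- (N / 2))) ->
  integrable_bd (fun y => g y * tr w y).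
Proof.
move=> Sw mg [C gC]; have [mw iw] := Sigma_tr Sw; have N3 := N_ge3.
rewrite /integrable_bd (_ : (fun x => _) = fun x => tr w x * g x); last first.
  by apply/funext => y; rewrite mulrC.
have q0 : 0 <= 2 * (N - 1) / N by rewrite divr_ge0//; lra.
apply: (integrable_mul measurableT pB_gt1 conj_pB mw mg iw).
apply: (le_integrable_weight measurableT
  (g := fun y : 'rV[R]_n => (1 + sqnorm y) `^ (- (N / 2 * (2 * (N - 1) / N))))).
- apply: (@measurable_comp _ _ _ _ _ _ setT (fun z : R => z `^ (2 * (N - 1) / N))) => //.
  by apply: measurableT_comp.
- exists (`|C| `^ (2 * (N - 1) / N)) => y _.
  rewrite ger0_norm ?powR_ge0//; apply: powR_weight_le (gC y) q0.
  by rewrite lerDl sqnorm_ge0.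
- apply: integrable_bd_weight.
  have -> : N / 2 * (2 * (N - 1) / N) = N - 1 by field; apply: lt0r_neq0; lra.
  lra.
Qed.

(** From |v w| <= v^2 + w^2, followed by Young's inequality for u z^2 with exponent p/2, whose
    conjugate is p/(p-2). *)
Let weight_product (u v w p : R) : 2 < p -> 0 <= u ->
  `|u * v * w| <= `|v| `^ p + `|w| `^ p + 2 * u `^ (p / (p - 2)).
Proof.
move=> p2 u0.
have h (z : R) : u * (z * z) <= `|z| `^ p + u `^ (p / (p - 2)).
  have p1 : 1 < p / 2 by lra.
  have := young (`|z| `^ 2) u p1.
  have -> : p / 2 / (p / 2 - 1) = p / (p - 2).
    by field; repeat (apply/andP; split); apply: lt0r_neq0; lra.
  rewrite (ger0_norm (powR_ge0 _ _)) -powRrM (ger0_norm u0).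
  have -> : 2 * (p / 2) = p by field.
  apply: le_trans; rewrite normrM (ger0_norm u0) (ger0_norm (powR_ge0 _ _)).
  by rewrite powR_mulrn// real_normK ?num_real// expr2 mulrC.
have := h v; have := h w.
have : `|u * v * w| <= u * (v * v) + u * (w * w).
  rewrite -mulrDr -mulrA normrM (ger0_norm u0) ler_wpM2l// ler_norml.
  by apply/andP; split; nra.
lra.
Qed.

Lemma integrable_bd_potential v w : in_Sigma v -> in_Sigma w ->
  integrable_bd (fun y => tr v y * tr w y / (1 + sqnorm y)).
Proof.
move=> Sv Sw; have [mv iv] := Sigma_tr Sv; have [mw iw] := Sigma_tr Sw.
have N3 := N_ge3.
have s0 (y : 'rV[R]_n) : 0 < 1 + sqnorm y by rewrite ltr_pwDl// sqnorm_ge0.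
have ms : measurable_fun setT (fun y : 'rV[R]_n => (1 + sqnorm y) `^ (- 1)).
  apply: (measurableT_comp (measurable_powR _)).
  by apply: measurable_funD => //; exact: measurable_sqnorm.
have eV (y : 'rV[R]_n) : (1 + sqnorm y)^-1 = (1 + sqnorm y) `^ (- 1).
  by rewrite powR_inv1// ltW.
apply: (le_integrable_weight measurableT (g := fun y =>
  `|tr v y| `^ pB + `|tr w y| `^ pB + 2 * (1 + sqnorm y) `^ (- (N - 1)))).
- under eq_fun do rewrite eV.
  by do 2![apply: measurable_funM => //].
- exists 1 => y _; rewrite mul1r mulrC mulrA.
  (* For the critical trace exponent pB / (pB - 2) = N - 1, so the potential 1/(1+s) contributes an
     integrable power. *)
  have -> : - (N - 1) = - 1 * (pB / (pB - 2)).
    by rewrite /pB; field; repeat (apply/andP; split); apply: lt0r_neq0; lra.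
  rewrite (powRrM (1 + sqnorm y)) -eV; apply: weight_product; last by rewrite invr_ge0 ltW.
  by rewrite /pB ltr_pdivlMr; lra.
- apply: integrable_EFinD => //; first exact: integrable_EFinD.
  by apply: integrable_EFinZ => //; apply: integrable_bd_weight; lra.
Qed.

Lemma integrable_H_potential v w : in_Sigma v -> in_Sigma w ->
  integrable_H (fun x => D10 x ^- 2 * fn v x * fn w x).
Proof.
move=> Sv Sw; have [mv iv] := Sigma_fn Sv; have [mw iw] := Sigma_fn Sw.
have N3 := N_ge3.
have ms : measurable_fun H (fun x : pt R n => D10 x `^ (- 2)).
  apply: measurable_funTS; apply: (measurableT_comp (measurable_powR _)).
  exact: measurable_D10.
have eV (x : pt R n) : D10 x ^- 2 = D10 x `^ (- 2).
  by rewrite powRN powR_mulrn// ltW// D10_gt0.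
apply: (le_integrable_weight mH (g := fun x =>
  `|fn v x| `^ pH + `|fn w x| `^ pH + 2 * D10 x `^ (- N))).
- under eq_fun do rewrite eV.
  by do 2![apply: measurable_funM => //].
- exists 1 => x _; rewrite mul1r.
  (* In the interior pH / (pH - 2) = N/2, and the potential D10^(-2) becomes D10^(-N). *)
  have -> : - N = - 2 * (pH / (pH - 2)).
    by rewrite /pH; field; repeat (apply/andP; split); apply: lt0r_neq0; lra.
  rewrite (powRrM (D10 x)) -eV; apply: weight_product; last first.
    by rewrite invr_ge0 exprn_ge0// ltW// D10_gt0.
  by rewrite /pH ltr_pdivlMr; lra.
- apply: (integrable_EFinD mH); first exact: (integrable_EFinD mH).
  by apply: (integrable_EFinZ _ mH); apply: integrable_H_weight; lra.
Qed.

End energy_space.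

(** * Sigma is a vector space and contains the kernel functions *)

Section Sigma_subspace.
Context (R : realType) (n : nat) (hn : (2 <= n)%N).
Implicit Types (v w : wfun R n) (a b : 'I_n.+1) (f g : pt R n -> R) (e : pt R n).
Local Notation N := (n.+1%:R : R).
Local Notation H := (@half_space R n).

Let mH := @measurable_half_space R n.

Lemma fnE (k : R) v w x : fn (k *: v + w) x = k * fn v x + fn w x.
Proof. by []. Qed.

Lemma trE (k : R) v w y : tr (k *: v + w) y = k * tr v y + tr w y.
Proof. by []. Qed.

Lemma gradE (k : R) v w x e :
  dotp (grad (k *: v + w) x) e = k * dotp (grad v x) e + dotp (grad w x) e.
Proof.
by rewrite -[grad (k *: v + w) x]/(k *: grad v x + grad w x) dotpDl dotpZl.
Qed.

(** Brings bounded functions of bounded support under the decay hypotheses of [integrable_H_fn] and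
    [integrable_bd_tr]. *)
Lemma norm_le_half_weight f (r M : R) : (forall x, `|f x| <= M) ->
  (forall x, r < `|x| -> f x = 0) ->
  exists C : R, forall x, `|f x| <= C * D10 x `^ (- (N / 2)).
Proof.
move=> fM fr; have [C fC] := norm_le_weight_pt fM fr.
exists `|C| => x; apply: le_trans (fC x) _.
apply: (@le_trans _ _ (`|C| * D10 x `^ (- (3 / 5) * N))).
  by rewrite ler_wpM2r ?powR_ge0// ler_norm.
rewrite ler_wpM2l//; apply: ler_powR; first exact: D10_ge1.
by have := N_ge3 R hn; lra.
Qed.

Lemma D10_bdry (y : 'rV[R]_n) : D10 (bdry y) = 1 + sqnorm y.
Proof. by rewrite /D10 /= expr0n addr0. Qed.

Lemma continuous_bdry : continuous (@Defs.bdry R n).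
Proof. exact: (@continuous_tangential_slice R n 0). Qed.

Lemma integrable_fn_test w g (r : R) : in_Sigma w -> continuous g ->
  (forall x, r < `|x| -> g x = 0) -> integrable_H (fun x => fn w x * g x).
Proof.
move=> Sw cg gr; have [M gM] := continuous_bounded_pt cg gr.
have [C gC] := norm_le_half_weight gM gr.
apply: (eq_integrable_H (f := fun x => g x * fn w x)) => [x _|]; first by rewrite mulrC.
apply: integrable_H_fn => //.
  by apply: measurable_funTS; exact: continuous_measurable_pt.
by exists C => x _.
Qed.

Lemma integrable_tr_test w g (r : R) : in_Sigma w -> continuous g ->
  (forall x, r < `|x| -> g x = 0) -> integrable_bd (fun y => tr w y * g (bdry y)).
Proof.
move=> Sw cg gr; have [M gM] := continuous_bounded_pt cg gr.
have [C gC] := norm_le_half_weight gM gr.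
rewrite /integrable_bd (_ : (fun y => _) = fun y => g (bdry y) * tr w y); last first.
  by apply/funext => y; rewrite mulrC.
apply: integrable_bd_tr => //.
  by apply: continuous_measurable_rV; exact: continuous_compose continuous_bdry cg.
by exists C => y; rewrite -D10_bdry.
Qed.

Lemma integrable_sqr_test g (r : R) : continuous g ->
  (forall x, r < `|x| -> g x = 0) ->
  (lebesgue_pt R n).-integrable H (fun x => (`|g x| `^ 2)%:E).
Proof.
move=> cg gr; apply: (integrableS measurableT mH) => //.
rewrite (_ : (fun x => _) = EFin \o (fun x => g x * g x)); last first.
  by apply/funext => x; rewrite /= powR_mulrn// real_normK ?num_real// expr2.
apply: (continuous_integrable_pt (r := r)) => [x|x /gr ->]; last by rewrite mulr0.
by apply: cvgM; exact: cg.
Qed.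

Lemma integrable_grad_test w g e (r : R) : in_Sigma w -> continuous g ->
  (forall x, r < `|x| -> g x = 0) ->
  integrable_H (fun x => dotp (grad w x) e * g x).
Proof.
move=> Sw cg gr.
rewrite /integrable_H (_ : (fun x => _) = fun x =>
  \sum_a dotp e (dir R a) * (dotp (grad w x) (dir R a) * g x)); last first.
  apply/funext => x; rewrite dotp_sum_dir mulr_suml; apply: eq_bigr => a _.
  by rewrite mulrCA mulrA.
apply: integrable_sum_EFin => // a; apply: (integrable_EFinZ _ mH).
have [mw iw] := Sigma_grad a Sw.
apply: (integrable_mul mH (p := 2) (q := 2)) => //.
- lra.
- by rewrite [2 - 1](_ : _ = 1) ?divr1//; lra.
- by apply: measurable_funTS; exact: continuous_measurable_pt.
- exact: integrable_sqr_test gr.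
Qed.

Lemma restrict_lin (D : set (pt R n)) (k : R) f g :
  (fun x => k * f x + g x) \_ D = k *: (f \_ D) + g \_ D.
Proof.
apply/funext => x; rewrite -[RHS]/(k * _ + _) !patchE.
by case: ifP => _ //; rewrite mulr0 addr0.
Qed.

Lemma L2loc_lin (k : R) f g : L2loc f -> L2loc g -> L2loc (fun x => k * f x + g x).
Proof.
move=> lf lg r.
have p12 : (1 <= (2 : R)%:E)%E by rewrite lee_fin ler1n.
have [_ h] := Lfun_submod_closed (lebesgue_pt R n) p12.
rewrite restrict_lin; exact: h.
Qed.

Lemma Lfun_H_lin (k p : R) f g : 1 <= p ->
  f \_ H \in Lfun (lebesgue_pt R n) p%:E -> g \_ H \in Lfun (lebesgue_pt R n) p%:E ->
  (fun x => k * f x + g x) \_ H \in Lfun (lebesgue_pt R n) p%:E.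
Proof.
move=> p1 lf lg; have p1' : (1 <= p%:E)%E by rewrite lee_fin.
have [_ h] := Lfun_submod_closed (lebesgue_pt R n) p1'.
rewrite restrict_lin; exact: h.
Qed.

(** The identity [has_grad_tr] equates total integrals, so it is additive only once every test
    integral is known to converge; the global L^p conditions on both members supply this. *)
Lemma in_Sigma_lin (k : R) v w : in_Sigma v -> in_Sigma w -> in_Sigma (k *: v + w).
Proof.
move=> Sv Sw; have N3 := N_ge3 R hn.
have [[gv lv lgv] gv2 fv tv] := Sv; have [[gw lw lgw] gw2 fw tw] := Sw.
split.
- split.
  + move=> phi e Cphi; have [df cphi _] := Cphi.
    have [r phi0] := C1c_bounded_support Cphi.
    have cp : continuous phi by move=> x; exact: differentiable_continuous.
    have dphi0 x : r < `|x| -> 'D_e phi x = 0 by exact: derive_outside_support.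
    have iv := integrable_fn_test Sv (cphi e) dphi0.
    have iw := integrable_fn_test Sw (cphi e) dphi0.
    have jv := integrable_grad_test e Sv cp phi0.
    have jw := integrable_grad_test e Sw cp phi0.
    have tv' := integrable_tr_test Sv cp phi0.
    have tw' := integrable_tr_test Sw cp phi0.
    rewrite (eq_int_H (g := fun x => k * (fn v x * 'D_e phi x) + fn w x * 'D_e phi x));
      last by move=> x _; rewrite fnE mulrDl mulrA.
    rewrite (eq_int_H (f := fun x => dotp (grad (k *: v + w) x) e * phi x)
      (g := fun x => k * (dotp (grad v x) e * phi x) + dotp (grad w x) e * phi x)); last first.
    by move=> x _; rewrite gradE mulrDl mulrA.
    rewrite (eq_int_bd (g := fun y => k * (tr v y * phi (bdry y)) +
      tr w y * phi (bdry y))); last by move=> y; rewrite trE mulrDl mulrA.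
    rewrite int_HD ?int_HZ//; last exact: integrable_HZ.
    rewrite int_HD ?int_HZ//; last exact: integrable_HZ.
    rewrite int_bdD ?int_bdZ//; last exact: integrable_bdZ.
    by rewrite gv// gw//; ring.
  + exact: (L2loc_lin k lv lw).
  + move=> a; rewrite (_ : (fun x => _) = fun x =>
      k * dotp (grad v x) (dir R a) + dotp (grad w x) (dir R a)).
      exact: (L2loc_lin k (lgv a) (lgw a)).
    by apply/funext => x; exact: gradE.
- move=> a; rewrite (_ : (fun x => dotp (grad _ x) _) = fun x =>
    k * dotp (grad v x) (dir R a) + dotp (grad w x) (dir R a)).
    exact: (Lfun_H_lin k (ler1n R 2) (gv2 a) (gw2 a)).
  by apply/funext => x; exact: gradE.
- have p1 : 1 <= 2 * N / (N - 2) by rewrite ler_pdivlMr; lra.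
  exact: (Lfun_H_lin k p1 fv fw).
- have p1 : (1 <= (2 * (N - 1) / (N - 2))%:E)%E.
    by rewrite lee_fin ler_pdivlMr; lra.
  have [_ h] := Lfun_submod_closed (lebesgue_rV R n) p1.
  exact: (h k _ _ tv tw).
Qed.

Definition wf f : wfun R n := (f, gradient f, f \o bdry).

Lemma dotp_gradient f x e : differentiable f x -> dotp (gradient f x) e = 'D_e f x.
Proof.
move=> df; rewrite derive_sum_dir// dotp_sum_dir; apply: eq_bigr => a _.
rewrite mulrC; congr (_ * _).
case: (unliftP ord_max a) => [i|] ->; first by rewrite dotp_lift dir_lift mxE.
by rewrite dotp_max dir_max.
Qed.

Lemma has_grad_tr_C1 f : C1 f -> has_grad_tr (wf f).
Proof.
move=> Cf phi e Cphi; have Cp := C1c_C1 Cphi.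
have [r phi0] := C1c_bounded_support Cphi.
have dphi0 x : r < `|x| -> 'D_e phi x = 0 by exact: derive_outside_support.
(* The product f phi is again C^1 with compact support; its divergence theorem is integration by
   parts. *)
have := int_H_derive e (C1cM Cf Cphi).
rewrite /fn /grad /tr /wf /= /comp.
have i1 : integrable_H (fun x => f x * 'D_e phi x).
  apply: (integrableS measurableT mH) => //.
  apply: (continuous_integrable_pt (r := r)) => [x|x /dphi0 ->]; last by rewrite mulr0.
  by apply: cvgM; [exact: C1_continuous|exact: Cp.2].
have i2 : integrable_H (fun x => 'D_e f x * phi x).
  apply: (integrableS measurableT mH) => //.
  apply: (continuous_integrable_pt (r := r)) => [x|x /phi0 ->]; last by rewrite mulr0.
  by apply: cvgM; [exact: Cf.2|exact: C1_continuous].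
rewrite (eq_int_H (g := fun x => f x * 'D_e phi x + 'D_e f x * phi x)); last first.
  by move=> x _; rewrite derive_C1M// [phi x * _]mulrC.
rewrite int_HD// => h.
rewrite (eq_int_H (f := fun x => dotp _ _ * _) (g := fun x => 'D_e f x * phi x)); last first.
  by move=> x _; rewrite dotp_gradient//; exact: Cf.1.
rewrite -(addrK (int_H (fun x => 'D_e f x * phi x))
  (int_H (fun x => f x * 'D_e phi x))) h.
by rewrite addrC.
Qed.

Lemma measurable_cball (r : R) : measurable [set x : pt R n | `|x| <= r].
Proof.
rewrite (_ : [set x | _] = ~` [set x : pt R n | r < `|x|]).
  apply: measurableC; apply: open_measurable_pt.
  by apply: (open_comp (f := @Num.norm _ (pt R n)) (D := [set s | r < s])) =>
    [x _|]; [exact: norm_continuous|exact: open_gt].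
apply/seteqP; split => x /=; first by rewrite leNgt => /negP.
by move=> /negP; rewrite -leNgt.
Qed.

Lemma L2loc_continuous f : continuous f -> L2loc f.
Proof.
move=> cf r; have mB := measurable_cball r.
have mHB := measurableI _ _ mH mB.
apply/(@Lfun_onP _ _ R _ _ _ 2 mHB (ler1n R 2)).
have mf : measurable_fun setT f by exact: continuous_measurable_pt.
split; first exact: measurable_funTS.
have [M fM] : exists M : R, forall x : pt R n, `|x| <= r -> `|f x| <= M.
  have /compact_bounded[M [_ HM]] : compact (f @` [set x : pt R n | `|x| <= r]).
    by apply: continuous_compact;
      [exact: continuous_subspaceT|exact: compact_ball_pt].
  exists (`|M| + 1) => x xr.
  by apply: (HM (`|M| + 1)); [rewrite ltr_pwDr// ler_norm|exists x].
pose B := [set x : pt R n | `|x| <= r].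
pose g := (fun x => `|f x| `^ 2) \_ B.
apply: (integrable_eq_on (f := g) mHB) => [x [_ Bx]|].
  by rewrite /g patchE mem_set.
apply: (integrableS measurableT mHB) => //.
apply: (integrable_bounded_support_pt (r := r) (M := M `^ 2)) => [|x|x rx].
- apply/(measurable_restrictT _ mB)/measurable_funTS.
  apply: (measurableT_comp (measurable_powR _)).
  exact: measurableT_comp.
- rewrite /g patchE; case: ifPn => [|_]; last by rewrite normr0 powR_ge0.
  rewrite inE => Bx; rewrite ger0_norm ?powR_ge0//.
  apply: ge0_ler_powR; rewrite ?nnegrE//; last exact: fM.
  exact: le_trans (fM x Bx).
- by rewrite /g patchE memNset// /B /=; apply/negP; rewrite -ltNge.
Qed.

(** A pointwise criterion: the right-hand sides are the integrable weights, and the left-hand powers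
    are those in the definition of Sigma. *)
Lemma in_Sigma_C1 f : C1 f ->
  (exists C : R, forall x, H x ->
    `|f x| `^ (2 * N / (N - 2)) <= C * D10 x `^ (- (3 / 5 * N))) ->
  (forall a, exists C : R, forall x, H x ->
    `|'D_(dir R a) f x| `^ 2 <= C * D10 x `^ (- (3 / 5 * N))) ->
  (exists C : R, forall y : 'rV[R]_n,
    `|f (bdry y)| `^ (2 * (N - 1) / (N - 2)) <= C * (1 + sqnorm y) `^ (- (3 / 5 * (N - 1)))) ->
  in_Sigma (wf f).
Proof.
move=> Cf hf hg ht; have N3 := N_ge3 R hn.
have cf := C1_continuous Cf.
have gE a : (fun x => dotp (grad (wf f) x) (dir R a)) = 'D_(dir R a) f.
  by apply/funext => x; rewrite dotp_gradient//; exact: Cf.1.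
have iw := @integrable_H_weight R n _ (lexx (3 / 5 * N)).
have mpow (p : R) : measurable_fun setT (fun z : R => `|z| `^ p).
  apply: (measurableT_comp (measurable_powR _)).
  by apply: continuous_measurable_fun; exact: norm_continuous.
split.
- split; first exact: has_grad_tr_C1.
    exact: L2loc_continuous.
  by move=> a; rewrite gE; apply: L2loc_continuous; exact: Cf.2.
- move=> a; rewrite gE; apply/(@Lfun_onP _ _ R _ _ _ 2 mH (ler1n R 2)).
  have mf : measurable_fun setT ('D_(dir R a) f).
    by apply: continuous_measurable_pt; exact: Cf.2.
  split; first exact: measurable_funTS.
  have [C hC] := hg a; apply: (le_integrable_weight mH _ _ iw).
    by apply: measurable_funTS; exact: measurableT_comp (mpow 2) mf.
  by exists C => x Hx; rewrite ger0_norm ?powR_ge0// hC.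
- have p1 : 1 <= 2 * N / (N - 2) by rewrite ler_pdivlMr; lra.
  apply/(@Lfun_onP _ _ R _ _ _ _ mH p1).
  have mf : measurable_fun setT f by exact: continuous_measurable_pt.
  split; first exact: measurable_funTS.
  have [C hC] := hf; apply: (le_integrable_weight mH _ _ iw).
    by apply: measurable_funTS; exact: measurableT_comp (mpow _) mf.
  by exists C => x Hx; rewrite ger0_norm ?powR_ge0// hC.
- have p1 : 1 <= 2 * (N - 1) / (N - 2) by rewrite ler_pdivlMr; lra.
  rewrite -[tr _](patch_setT (fun=> 0)).
  apply/(@Lfun_onP _ _ R _ _ _ _ measurableT p1).
  have mf : measurable_fun setT (tr (wf f)).
    by apply: continuous_measurable_rV; exact: continuous_compose continuous_bdry cf.
  split => //; have [C hC] := ht.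
  apply: (le_integrable_weight measurableT _ _ (@integrable_bd_weight R n _ (lexx _))).
    exact: measurableT_comp (mpow _) mf.
  by exists C => y _; rewrite ger0_norm ?powR_ge0// hC.
Qed.

Lemma in_Sigma_C1c (Om : set (pt R n)) f : C1c Om f -> in_Sigma (wf f).
Proof.
move=> Cf; have Cf' := C1c_C1 Cf; have [r f0] := C1c_bounded_support Cf.
have N3 := N_ge3 R hn.
have pow_test (g : pt R n -> R) (p : R) : 1 <= p -> continuous g ->
    (forall x, r < `|x| -> g x = 0) ->
    exists C : R, forall x, `|g x| `^ p <= C * D10 x `^ (- (3 / 5 * N)).
  move=> p1 cg g0; have [M gM] := continuous_bounded_pt cg g0.
  have [x|x /g0 ->|C hC] := @norm_le_weight_pt _ _ (fun x => `|g x| `^ p) r (M `^ p).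
  - rewrite ger0_norm ?powR_ge0//; apply: ge0_ler_powR; rewrite ?nnegrE//.
    + lra.
    + exact: le_trans (gM x).
  - by rewrite normr0 powR0//; lra.
  exists C => x; rewrite -[X in X <= _]ger0_norm ?powR_ge0//.
  by apply: le_trans (hC x) _; rewrite mulNr.
apply: in_Sigma_C1 => //.
- have [|//|//|C hC] := pow_test f (2 * N / (N - 2)).
  + by rewrite ler_pdivlMr; lra.
  + exact: C1_continuous.
  by exists C => x _.
- move=> a; have [|||C hC] := pow_test ('D_(dir R a) f) 2.
  + lra.
  + exact: Cf'.2.
  + by move=> x; exact: derive_outside_support.
  by exists C => x _.
- have [|||C hC] := pow_test f (2 * (N - 1) / (N - 2)) => //.
  + by rewrite ler_pdivlMr; lra.
  + exact: C1_continuous.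
  exists `|C| => y; apply: le_trans (hC (bdry y)) _; rewrite D10_bdry.
  apply: (@le_trans _ _ (`|C| * (1 + sqnorm y) `^ (- (3 / 5 * N)))).
    by rewrite ler_wpM2r ?powR_ge0// ler_norm.
  rewrite ler_wpM2l//; apply: ler_powR; first by rewrite lerDl sqnorm_ge0.
  lra.
Qed.

(** The decay D^(1-N/2) raised to the critical exponents gives D10^(-N) in the interior and
    (1+s)^(-(N-1)) on the boundary; the squared gradient gives D10^(-(N-1)), and N - 1 >= 3N/5
    because N >= 3. *)
Lemma in_Sigma_ker c a : in_Sigma (wf (ker c a)).
Proof.
have N3 := N_ge3 R hn; have [C1' hC1] := @ker_le R n c a; have [C2 hC2] := @derive_ker_le R n c a.
have le_w (p s s' C u z : R) : 1 <= u -> 0 <= p -> s' <= s * p ->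
    `|z| <= C * u `^ (- s) -> `|z| `^ p <= `|C| `^ p * u `^ (- s').
  move=> u1 p0 ss zC; apply: le_trans (powR_weight_le u1 zC p0) _.
  by rewrite ler_wpM2l ?powR_ge0//; apply: ler_powR => //; rewrite lerN2.
have e1 : - (N / 2) + 1 = - (N / 2 - 1) :> R by lra.
have e2 : - (N / 2) + 1 / 2 = - (N / 2 - 1 / 2) :> R by lra.
apply: (in_Sigma_C1 (@C1_ker R n c a)).
- exists (`|C1'| `^ (2 * N / (N - 2))) => x Hx.
  apply: (le_w _ (N / 2 - 1)).
  + exact: D10_ge1.
  + by rewrite divr_ge0; lra.
  + have -> : (N / 2 - 1) * (2 * N / (N - 2)) = N by field; apply: lt0r_neq0; lra.
    lra.
  + by rewrite -e1; apply: hC1; exact: ltW.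
- move=> b; exists (`|C2| `^ 2) => x Hx; apply: (le_w _ (N / 2 - 1 / 2)).
  + exact: D10_ge1.
  + lra.
  + lra.
  + by rewrite -e2; apply: hC2; exact: ltW.
- exists (`|C1'| `^ (2 * (N - 1) / (N - 2))) => y; apply: (le_w _ (N / 2 - 1)).
  + by rewrite lerDl sqnorm_ge0.
  + by rewrite divr_ge0; lra.
  + have -> : (N / 2 - 1) * (2 * (N - 1) / (N - 2)) = N - 1.
      by field; apply: lt0r_neq0; lra.
    lra.
  + by rewrite -e1 -D10_bdry; apply: hC1.
Qed.

End Sigma_subspace.

Lemma cvg_Rintegral d (T : measurableType d) (R : realType)
    (mu : {measure set T -> \bar R}) (D : set T) (f_ : nat -> T -> R) (f g : T -> R) :
  measurable D -> (forall k, measurable_fun D (f_ k)) -> measurable_fun D f ->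
  (forall x, D x -> f_ k x @[k --> \oo] --> f x) ->
  mu.-integrable D (EFin \o g) ->
  (forall k x, D x -> `|f_ k x| <= g x) ->
  \int[mu]_(x in D) f_ k x @[k --> \oo] --> \int[mu]_(x in D) f x.
Proof.
move=> mD mf_ mf ff ig fg.
have mEf : measurable_fun D (EFin \o f) by exact/measurable_EFinP.
have mEf_ k : measurable_fun D (EFin \o f_ k) by exact/measurable_EFinP.
have ff' : {ae mu, forall x, D x -> (EFin \o f_ k) x @[k --> \oo] --> (EFin \o f) x}.
  by apply: aeW => x Dx; apply: cvg_EFin; [exact: nearW|exact: ff].
have fg' : {ae mu, forall x k, D x -> (`|(EFin \o f_ k) x| <= (EFin \o g) x)%E}.
  by apply: aeW => x k Dx; rewrite /= lee_fin fg.
have [intf _ h] := dominated_convergence mD mEf_ mEf ff' ig fg'.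
apply: fine_cvg; rewrite fineK//.
exact: integrable_fin_num.
Qed.

Lemma Rintegral_sum d (T : measurableType d) (R : realType)
    (mu : {measure set T -> \bar R}) (D : set T) (m : nat) (f : 'I_m -> T -> R) :
  measurable D -> (forall i, mu.-integrable D (EFin \o f i)) ->
  \int[mu]_(x in D) (\sum_i f i x) = \sum_i \int[mu]_(x in D) f i x.
Proof.
move=> mD fi; suff h (s : seq 'I_m) :
    mu.-integrable D (EFin \o (fun x => \sum_(i <- s) f i x)) /\
    \int[mu]_(x in D) (\sum_(i <- s) f i x) = \sum_(i <- s) \int[mu]_(x in D) f i x.
  exact: (h _).2.
elim: s => [|i s [ih1 ih2]].
  rewrite (_ : (fun x => _) = fun=> 0); last by apply/funext => x; rewrite big_nil.
  by split; [exact: integrable0|rewrite big_nil /Rintegral integral0].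
rewrite (_ : (fun x => _) = fun x => f i x + \sum_(j <- s) f j x); last first.
  by apply/funext => x; rewrite big_cons.
by split; [exact: integrable_EFinD|rewrite RintegralD// ih2 big_cons].
Qed.

Lemma int_H_sum (R : realType) (n m : nat) (f : 'I_m -> pt R n -> R) :
  (forall i, integrable_H (f i)) ->
  int_H (fun x => \sum_i f i x) = \sum_i int_H (f i).
Proof. by move=> fi; apply: Rintegral_sum => //; exact: measurable_half_space. Qed.

Lemma int_bd_sum (R : realType) (n m : nat) (f : 'I_m -> 'rV[R]_n -> R) :
  (forall i, integrable_bd (f i)) ->
  int_bd (fun x => \sum_i f i x) = \sum_i int_bd (f i).
Proof. by move=> fi; apply: Rintegral_sum. Qed.

(** * The Jacobi form, and its vanishing on the kernel *)

Section jacobi_form.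
Context (R : realType) (n : nat) (hn : (2 <= n)%N) (c : regime).
Implicit Types (v w psi : wfun R n) (a b : 'I_n.+1).
Local Notation N := (n.+1%:R : R).
Local Notation H := (@half_space R n).

Let mH := @measurable_half_space R n.

(** With [kap] as an indicator both potentials appear in one formula, and later computations need no
    case distinction. *)
Lemma BE v psi : B c v psi = int_H (fun x => dotp (grad v x) (grad psi x))
  - kap R c * (N * int_bd (fun y => tr v y * tr psi y / (1 + sqnorm y)))
  - (1 - kap R c) * (N * (N + 2) * int_H (fun x => D10 x ^- 2 * fn v x * fn psi x)).
Proof. by rewrite /B; case: c; rewrite /kap; ring. Qed.

Lemma B_sym v psi : B c v psi = B c psi v.
Proof.
rewrite !BE (eq_int_H (g := fun x => dotp (grad psi x) (grad v x))); last first.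
  by move=> x _; exact: dotpC.
rewrite (eq_int_bd (g := fun y => tr psi y * tr v y / (1 + sqnorm y))); last first.
  by move=> y; rewrite (mulrC (tr v y)).
rewrite (eq_int_H (f := fun x => D10 x ^- 2 * fn v x * fn psi x)
  (g := fun x => D10 x ^- 2 * fn psi x * fn v x))//.
by move=> x _; rewrite mulrAC.
Qed.

Lemma B_linl (k : R) v w psi : in_Sigma v -> in_Sigma w -> in_Sigma psi ->
  B c (k *: v + w) psi = k * B c v psi + B c w psi.
Proof.
move=> Sv Sw Sp; rewrite !BE.
rewrite (eq_int_H (f := fun x => dotp (grad (k *: v + w) x) (grad psi x))
  (g := fun x => k * dotp (grad v x) (grad psi x) + dotp (grad w x) (grad psi x)));
  last by move=> x _; exact: gradE.
rewrite (eq_int_bd (f := fun y => tr (k *: v + w) y * tr psi y / (1 + sqnorm y))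
  (g := fun y => k * (tr v y * tr psi y / (1 + sqnorm y)) +
                 tr w y * tr psi y / (1 + sqnorm y)));
  last by move=> y; rewrite trE; ring.
rewrite (eq_int_H (f := fun x => D10 x ^- 2 * fn (k *: v + w) x * fn psi x)
  (g := fun x => k * (D10 x ^- 2 * fn v x * fn psi x) + D10 x ^- 2 * fn w x * fn psi x));
  last by move=> x _; rewrite fnE; ring.
have g1 := integrable_grad Sv Sp; have g2 := integrable_grad Sw Sp.
have b1 := integrable_bd_potential hn Sv Sp; have b2 := integrable_bd_potential hn Sw Sp.
have h1 := integrable_H_potential hn Sv Sp; have h2 := integrable_H_potential hn Sw Sp.
rewrite (int_HD (integrable_HZ k g1) g2) (int_bdD (integrable_bdZ k b1) b2).
rewrite (int_HD (integrable_HZ k h1) h2) (int_HZ k g1) (int_bdZ k b1) (int_HZ k h1).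
ring.
Qed.

Lemma B_linr (k : R) v w psi : in_Sigma v -> in_Sigma w -> in_Sigma psi ->
  B c psi (k *: v + w) = k * B c psi v + B c psi w.
Proof. by move=> Sv Sw Sp; rewrite B_sym B_linl// !(B_sym psi). Qed.

Lemma continuous_chi_Dq (k : R) : continuous (chi k \o @Dq R n c).
Proof. by apply: C1_continuous; exact: (C1_comp (@C1_Dq R n c) (C1R_chi k)). Qed.

Lemma chi_Dq_le1 (k : nat) x : 0 <= (x.2 : R) -> `|chi k.+1%:R (@Dq R n c x)| <= 1.
Proof.
by move=> x0; rewrite ger0_norm ?chi_ge0// chi_le1// ltW// Dq_gt0.
Qed.

Lemma integrable_H_chi (f : pt R n -> R) (k : nat) : integrable_H f ->
  integrable_H (fun x => chi k.+1%:R (Dq c x) * f x).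
Proof.
move=> fi; have mf : measurable_fun H f by case/integrableP: fi => /measurable_EFinP.
apply: (le_integrable_fun mH (g := fun x => `|f x|)).
- apply: measurable_funM => //; apply: measurable_funTS.
  by apply: continuous_measurable_pt; exact: continuous_chi_Dq.
- by move=> x Hx; rewrite normrM ler_piMl//; apply: chi_Dq_le1; exact: ltW.
- exact: (integrable_norm fi).
Qed.

Lemma integrable_bd_chi (f : 'rV[R]_n -> R) (k : nat) : integrable_bd f ->
  integrable_bd (fun y => chi k.+1%:R (Dq c (bdry y)) * f y).
Proof.
move=> fi; have mf : measurable_fun setT f by case/integrableP: fi => /measurable_EFinP.
apply: (le_integrable_fun measurableT (g := fun x => `|f x|)).
- apply: measurable_funM => //; apply: continuous_measurable_rV.
  exact: (continuous_compose (@continuous_bdry R n) (@continuous_chi_Dq _)).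
- by move=> y _; rewrite normrM ler_piMl//; apply: chi_Dq_le1.
- exact: (integrable_norm fi).
Qed.

Lemma cvg_int_H_chi (f : pt R n -> R) : integrable_H f ->
  int_H (fun x => chi k.+1%:R (Dq c x) * f x) @[k --> \oo] --> int_H f.
Proof.
move=> fi; have mf : measurable_fun H f by case/integrableP: fi => /measurable_EFinP.
apply: (cvg_Rintegral mH (g := fun x => `|f x|)) => //.
- move=> k; apply: measurable_funM => //; apply: measurable_funTS.
  by apply: continuous_measurable_pt; exact: continuous_chi_Dq.
- move=> x Hx; rewrite -[X in _ --> X](mul1r (f x)); apply: cvgM; last exact: cvg_cst.
  by apply: cvg_chi; rewrite ltW// Dq_gt0// ltW.
- exact: (integrable_norm fi).
- move=> k x Hx; rewrite normrM ler_piMl//; apply: chi_Dq_le1; exact: ltW.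
Qed.

Lemma cvg_int_bd_chi (f : 'rV[R]_n -> R) : integrable_bd f ->
  int_bd (fun y => chi k.+1%:R (Dq c (bdry y)) * f y) @[k --> \oo] --> int_bd f.
Proof.
move=> fi; have mf : measurable_fun setT f by case/integrableP: fi => /measurable_EFinP.
apply: (cvg_Rintegral measurableT (g := fun x => `|f x|)) => //.
- move=> k; apply: measurable_funM => //.
  apply: continuous_measurable_rV.
  exact: (continuous_compose (@continuous_bdry R n) (@continuous_chi_Dq _)).
- move=> y _; rewrite -[X in _ --> X](mul1r (f y)); apply: cvgM; last exact: cvg_cst.
  by apply: cvg_chi; rewrite ltW// Dq_gt0.
- exact: (integrable_norm fi).
- by move=> k y _; rewrite normrM ler_piMl//; apply: chi_Dq_le1.
Qed.

Lemma measurable_Dq_inv : measurable_fun H (fun x => @Dq R n c x ^- 2).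
Proof.
apply: (eq_measurable_fun (fun x => Dq c x `^ (- 2))).
  move=> x /[!inE] Hx; rewrite powRN powR_mulrn// ltW// Dq_gt0//; exact: ltW.
apply: measurable_funTS; apply: (measurableT_comp (measurable_powR _)).
by apply: continuous_measurable_pt; apply: C1_continuous; exact: C1_Dq.
Qed.

Lemma measurable_cut_error a (k : R) : measurable_fun H (cut_error c a k).
Proof.
(* Measurability is read off [div_cut_gradient]: the error is a divergence of C^1 components plus a
   potential term. *)
apply: (eq_measurable_fun (fun x => \sum_b 'D_(dir R b) (cut_gradient c a k b) x +
  (1 - kap R c) * N * (N + 2) * (Dq c x ^- 2 * (chi k (Dq c x) * ker c a x)))).
  move=> x /[!inE] Hx; rewrite div_cut_gradient; last exact: ltW.
  ring.
have mT (f : pt R n -> R) : continuous f -> measurable_fun H f.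
  by move=> cf; apply: measurable_funTS; exact: continuous_measurable_pt.
apply: measurable_funD.
  apply: measurable_sum => b; apply: mT; exact: (C1_cut_gradient c a k b).2.
apply: measurable_funM => //; apply: measurable_funM; first exact: measurable_Dq_inv.
apply: mT => x; apply: cvgM; first exact: continuous_chi_Dq.
by apply: C1_continuous; exact: C1_ker.
Qed.

Lemma integrable_cut_error v a (k : nat) : in_Sigma v ->
  integrable_H (fun x => fn v x * cut_error c a k.+1%:R x).
Proof.
move=> Sv; have [C hC] := @cut_error_le R n c a.
apply: (eq_integrable_H (f := fun x => cut_error c a k.+1%:R x * fn v x)).
  by move=> x _; rewrite mulrC.
apply: (integrable_H_fn hn Sv (@measurable_cut_error a _)).
by exists C => x Hx; apply: hC; rewrite ?ltr0Sn//; exact: ltW.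
Qed.

(** The errors tend to 0 pointwise and are dominated by C D10^(-N/2) |v|, which is integrable by
    [integrable_H_fn]. *)
Lemma cvg_int_H_cut_error v a : in_Sigma v ->
  int_H (fun x => fn v x * cut_error c a k.+1%:R x) @[k --> \oo] --> (0 : R).
Proof.
move=> Sv; have [C hC] := @cut_error_le R n c a; have [mv _] := Sigma_fn hn Sv.
have -> : 0 = int_H (fun _ : pt R n => 0 : R).
  by rewrite /int_H /Rintegral integral0.
have mw : measurable_fun H (fun x : pt R n => `|C| * D10 x `^ (- (N / 2))).
  apply: measurable_funM => //; apply: measurable_funTS.
  by apply: (measurableT_comp (measurable_powR _)); exact: measurable_D10.
have iw : integrable_H (fun x => `|C| * D10 x `^ (- (N / 2)) * fn v x).
  apply: (integrable_H_fn hn Sv mw); exists `|C| => x _.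
  by rewrite ger0_norm// mulr_ge0 ?powR_ge0.
apply: (cvg_Rintegral mH (g := fun x => `| `|C| * D10 x `^ (- (N / 2)) * fn v x|)) => //.
- by move=> k; apply: measurable_funM => //; exact: measurable_cut_error.
- move=> x Hx; rewrite -[X in _ --> X](mulr0 (fn v x)); apply: cvgM; first exact: cvg_cst.
  by apply: cvg_cut_error; exact: ltW.
- exact: (integrable_norm iw).
- move=> k x Hx; rewrite (normrM (fn v x)) [leRHS]normrM [leLHS]mulrC ler_wpM2r//.
  rewrite [leRHS]ger0_norm ?mulr_ge0 ?powR_ge0//.
  apply: le_trans (hC _ x _ (ltW Hx)) _; first exact: ltr0Sn.
  by rewrite ler_wpM2r ?powR_ge0// ler_norm.
Qed.

(* Testing the weak gradient of [v] against the cut-off gradient of the kernel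
   function and letting the cut-off tend to 1. *)
Lemma B_ker v a : in_Sigma v -> B c v (wf (ker c a)) = 0.
Proof.
move=> Sv; have Sk := @in_Sigma_ker R n hn c a.
pose K k := @cut_gradient R n c a k.+1%:R.
have k1 (k : nat) : 1 <= k.+1%:R :> R by rewrite ler1n.
have CK k b : C1c setT (K k b) by exact: C1c_cut_gradient.
have Csupp k b := C1c_bounded_support (CK k b).
have cK k b : continuous (K k b) by apply: C1_continuous; exact: C1_cut_gradient.
pose G x := dotp (grad v x) (grad (wf (ker c a)) x).
pose P x := D10 x ^- 2 * fn v x * fn (wf (ker c a)) x.
pose T y := tr v y * tr (wf (ker c a)) y / (1 + sqnorm y).
have iG : integrable_H G by exact: integrable_grad.
have iP : integrable_H P by exact: integrable_H_potential.
have iT : integrable_bd T by exact: integrable_bd_potential.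
(* This is the definition of the weak gradient with e = e_b and test function [K k b], summed over
   [b]: the left side becomes the integral of v div K, and grad v . K carries the cut-off Dirichlet
   term. *)
have key k : int_H (fun x => chi k.+1%:R (Dq c x) * G x) =
    (1 - kap R c) * (N * (N + 2)) * int_H (fun x => chi k.+1%:R (Dq c x) * P x)
    - int_H (fun x => fn v x * cut_error c a k.+1%:R x)
    + kap R c * N * int_bd (fun y => chi k.+1%:R (Dq c (bdry y)) * T y).
  have [[hg _ _] _ _ _] := Sv.
  have i1 b : integrable_H (fun x => fn v x * 'D_(dir R b) (K k b) x).
    have [r Kr] := Csupp k b.
    apply: (integrable_fn_test hn Sv ((C1_cut_gradient c a k.+1%:R b).2 (dir R b)) (r := r)).
    by move=> x; exact: derive_outside_support Kr.
  have i2 b : integrable_H (fun x => dotp (grad v x) (dir R b) * K k b x).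
    by have [r Kr] := Csupp k b; exact: (integrable_grad_test _ Sv (cK k b) Kr).
  have : \sum_b int_H (fun x => fn v x * 'D_(dir R b) (K k b) x) =
      - \sum_b int_H (fun x => dotp (grad v x) (dir R b) * K k b x)
      - \sum_b ((dir R b).2 : R) * int_bd (fun y => tr v y * K k b (bdry y)).
    by rewrite -!sumrN -big_split/=; apply: eq_bigr => b _; exact: hg (CK k b).
  (* Only e_t has a normal component, so a single boundary term survives. *)
  rewrite -!int_H_sum// big_ord_lift big1 ?add0r; last first.
    by move=> i _; rewrite dir_lift mul0r.
  rewrite dir_max mul1r.
  rewrite (eq_int_H (g := fun x => - ((1 - kap R c) * (N * (N + 2))) *
      (chi k.+1%:R (Dq c x) * P x) + fn v x * cut_error c a k.+1%:R x)); last first.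
    move=> x Hx; rewrite -mulr_sumr div_cut_gradient; last exact: ltW.
    rewrite /P /fn /wf /= mulrDr; congr (_ + _).
    (* The factor 1 - kap is zero in case (0,2), and in case (1,0) [Dq] is [D10]. *)
    have -> : (1 - kap R c) * N * (N + 2) * Dq c x ^- 2 =
        (1 - kap R c) * N * (N + 2) * D10 x ^- 2.
      case: c; rewrite /kap ?subrr ?mul0r//.
      by rewrite /Dq /kap mulr0 mul0r addr0 D10E.
    ring.
  rewrite (eq_int_H (f := fun x => \sum_b dotp (grad v x) (dir R b) * K k b x)
    (g := fun x => chi k.+1%:R (Dq c x) * G x)); last first.
    move=> x Hx; rewrite /G dotp_sum_dir mulr_sumr; apply: eq_bigr => b _.
    have -> : dotp (grad (wf (ker c a)) x) (dir R b) = 'D_(dir R b) (ker c a) x.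
      by apply: dotp_gradient; exact: (@C1_ker R n c a).1.
    by rewrite /K cut_gradientE; [ring|exact: ltW].
  rewrite (eq_int_bd (f := fun y => tr v y * K k ord_max (bdry y))
    (g := fun y => - (kap R c * N) * (chi k.+1%:R (Dq c (bdry y)) * T y))); last first.
    move=> y; rewrite /K cut_gradientE// normal_derivative_ker /T /tr /wf /=.
    ring.
  have iPk := integrable_H_chi k iP; have iTk := integrable_bd_chi k iT.
  rewrite (int_HD (integrable_HZ _ iPk) (integrable_cut_error a k Sv)).
  rewrite (int_HZ _ iPk) (int_bdZ _ iTk); lra.
have l1 := cvg_int_H_chi iG.
have l2 : int_H (fun x => chi k.+1%:R (Dq c x) * G x) @[k --> \oo] -->
    (1 - kap R c) * (N * (N + 2)) * int_H P - 0 + kap R c * N * int_bd T.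
  under eq_fun do rewrite key.
  apply: cvgD; last by apply: cvgM; [exact: cvg_cst|exact: cvg_int_bd_chi].
  apply: cvgB; last exact: cvg_int_H_cut_error.
  by apply: cvgM; [exact: cvg_cst|exact: cvg_int_H_chi].
(* The Dirichlet integral equals the sum of the two potential terms of the form, so that the form
   vanishes. *)
have := cvg_unique _ l1 l2; rewrite BE -/P -/G -/T => ->//.
ring.
Qed.

End jacobi_form.

Lemma integral_gt0 d (T : measurableType d) (R : realType)
    (mu : {measure set T -> \bar R}) (D A : set T) (f : T -> R) (eps : R) :
  measurable D -> measurable A -> A `<=` D -> (forall x, D x -> 0 <= f x) ->
  mu.-integrable D (EFin \o f) -> 0 < eps -> (forall x, A x -> eps <= f x) ->
  (0 < mu A)%E -> 0 < \int[mu]_(x in D) f x.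
Proof.
move=> mD mA AD f0 fi e0 fe muA.
have mf : measurable_fun D f by case/integrableP: fi => /measurable_EFinP.
apply: fine_gt0; apply/andP; split; last first.
  by have := integrable_lty mD fi.
apply: (@lt_le_trans _ _ (\int[mu]_(x in A) (f x)%:E)%E); last first.
  by apply: ge0_subset_integral => //; exact/measurable_EFinP.
apply: (@lt_le_trans _ _ (\int[mu]_(x in A) eps%:E)%E).
  by rewrite integral_cst// mule_gt0// lte_fin.
apply: ge0_le_integral => //.
- by move=> x _; rewrite lee_fin ltW.
- apply/measurable_EFinP; exact: measurable_funS mf.
Qed.

(** * A continuous nonnegative function with zero integral vanishes *)

Section positive_measure.
Context (R : realType).

Definition cube n (y : 'rV[R]_n) (r : R) : set 'rV[R]_n :=
  [set z | forall i, `|z ord0 i - y ord0 i| < r].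

Let itv_ball (t r : R) : [set s : R | `|s - t| < r] = [set` `](t - r), (t + r)[].
Proof. by apply/seteqP; split => s /=; rewrite in_itv/= distrC ltr_distlC. Qed.

Lemma measurable_cube n (y : 'rV[R]_n) r : measurable (cube y r).
Proof.
have -> : cube y r = \bigcap_(i in [set: 'I_n])
    (fun z : 'rV[R]_n => z ord0 i) @^-1` [set s | `|s - y ord0 i| < r].
  by apply/seteqP; split => z h i; [move=> _; exact: h|exact: h].
apply: fin_bigcap_measurable => // i _; rewrite -[X in measurable X]setTI.
apply: measurable_rV_coord => //; rewrite itv_ball; exact: measurable_itv.
Qed.

Let lebesgue_ball_gt0 (t r : R) : 0 < r ->
  (0 < @lebesgue_measure R [set s : R | (`|s - t| < r)%R])%E.
Proof.
move=> r0; rewrite itv_ball lebesgue_measure_itv/= lte_fin ifT; last lra.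
by rewrite -EFinB lte_fin; lra.
Qed.

Lemma lebesgue_cube_gt0 n (y : 'rV[R]_n) r : 0 < r -> (0 < lebesgue_rV R n (cube y r))%E.
Proof.
move=> r0; elim: n y => [|n ih] y.
  rewrite /= diracE mem_set ?lte01//= => -[] //.
have -> : lebesgue_rV R n.+1 (cube y r) =
    (lebesgue_measure \x lebesgue_rV R n)%E
      ([set s : R | (`|s - y ord0 ord0| < r)%R] `*` cube (rV_uncons y).2 r).
  rewrite -[LHS]/((lebesgue_measure \x lebesgue_rV R n)%E (@rV_cons R n @^-1` cube y r)).
  congr (_ _); apply/seteqP; split => -[s z] /=.
    move=> h; split => [|i]; first by have := h ord0; rewrite mxE unlift_none.
    by have := h (lift ord0 i); rewrite !mxE liftK.
  move=> [h1 h2] i; rewrite mxE; case: unliftP => [j|] ->//.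
  by have := h2 j; rewrite mxE.
rewrite product_measure1E; first by apply: mule_gt0; [exact: lebesgue_ball_gt0|exact: ih].
- by rewrite itv_ball; exact: measurable_itv.
- exact: measurable_cube.
Qed.

Lemma lebesgue_box_gt0 n (x : pt R n) r : 0 < r ->
  (0 < lebesgue_pt R n (box x.1 (x.2 : R) r))%E.
Proof.
move=> r0.
rewrite -[X in (0 < X)%E]/((lebesgue_rV R n \x lebesgue_measure)%E
  (cube x.1 r `*` [set s : R | (`|s - x.2| < r)%R])).
rewrite product_measure1E; first by apply: mule_gt0;
  [exact: lebesgue_cube_gt0|exact: lebesgue_ball_gt0].
- exact: measurable_cube.
- by rewrite itv_ball; exact: measurable_itv.
Qed.

(** Where f y > 0, continuity keeps [f] above f y / 2 on a cube, and cubes have positive measure. *)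
Lemma int_bd_eq0 n (f : 'rV[R]_n -> R) : continuous f -> (forall y, 0 <= f y) ->
  integrable_bd f -> int_bd f = 0 -> forall y, f y = 0.
Proof.
move=> cf f0 fi I0 y; apply/eqP; rewrite eq_le f0 andbT leNgt; apply/negP => fy.
have : \forall z \near y, f y / 2 < f z by apply: (cvgr_gt (f y) (cf y)); lra.
move=> /nbhs_ballP[e /= e0 he].
have := @integral_gt0 _ _ _ (lebesgue_rV R n) setT (cube y e) f (f y / 2)
  measurableT (measurable_cube _ _) (@subsetT _ _) (fun y _ => f0 y) fi.
rewrite -/(int_bd f) I0 ltxx => h; suff: false by [].
apply: h; [lra| |exact: lebesgue_cube_gt0].
move=> z yz; apply/ltW/he; split => // i j; rewrite ord1 /ball/= distrC; exact: yz.
Qed.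

Lemma int_H_eq0 n (f : pt R n -> R) : continuous f ->
  (forall x, half_space x -> 0 <= f x) ->
  integrable_H f -> int_H f = 0 -> forall x, half_space x -> f x = 0.
Proof.
move=> cf f0 fi I0 x Hx; apply/eqP; rewrite eq_le f0// andbT leNgt; apply/negP => fx.
have : \forall z \near x, f x / 2 < f z by apply: (cvgr_gt (f x) (cf x)); lra.
move=> /nbhs_ballP[e /= e0 he].
(* The second bound keeps the box inside the open half-space. *)
pose r := Num.min e (x.2 : R).
have r0 : 0 < r by rewrite lt_min e0.
have := @integral_gt0 _ _ _ (lebesgue_pt R n) (@half_space R n)
  (box x.1 (x.2 : R) r) f (f x / 2)
  (@measurable_half_space R n) (measurable_box _ _ _) _ f0 fi.
rewrite -/(int_H f) I0 ltxx => h; suff: false by [].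
apply: h; [|lra| |exact: lebesgue_box_gt0].
- move=> z [_]; rewrite /half_space /= lt_min => /andP[_].
  by rewrite ltr_norml => /andP[+ _]; lra.
- move=> z [z1 z2]; apply/ltW/he; apply: ball_pt => // [i|].
    by rewrite distrC (lt_le_trans (z1 i))// ge_min lexx.
  by rewrite distrC (lt_le_trans z2)// ge_min lexx.
Qed.

End positive_measure.

(** * The constraints defining Sigma_(0,1), and the splitting of Sigma *)

Section constraints.
Context (R : realType) (n : nat) (hn : (2 <= n)%N) (c : regime).
Implicit Types (v w psi : wfun R n) (a b : 'I_n.+1) (u : 'I_n.+1 -> R).
Local Notation N := (n.+1%:R : R).
Local Notation H := (@half_space R n).
Local Notation z01 := (Defs.z01 R n).

Let mH := @measurable_half_space R n.

Lemma bubble_z01 x : 0 <= (x.2 : R) ->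
  bubble c z01 x = (nu R c / @Dq R n c x) `^ ((N - 2) / 2).
Proof.
move=> x0; have := bubble_line c ord_max x 0.
by rewrite scale0r add0r !mulr0 !addr0 expr0n/= addr0 mulr1.
Qed.

Definition ell a w : R :=
  match c with
  | regime02 => int_bd (fun y => bubble c z01 (bdry y) `^ (2 / (N - 2)) *
                                 Phi c a (bdry y) * tr w y)
  | regime10 => int_H (fun x => bubble c z01 x `^ (4 / (N - 2)) * Phi c a x * fn w x)
  end.

Lemma in_Sigma01P w : in_Sigma01 c w <-> in_Sigma w /\ forall a, ell a w = 0.
Proof. by rewrite /in_Sigma01 /ell; case: c. Qed.

Definition ker_bd a (y : 'rV[R]_n) : R := (1 + sqnorm y) `^ (- 1) * ker c a (bdry y).

Definition ker_H a (x : pt R n) : R := 4 * D10 x `^ (- 2) * ker c a x.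

(** The bubble has exponent (N-2)/2, so its powers 2/(N-2) and 4/(N-2) are plain weights: 1/(1+s) on
    the boundary and (2/D10)^2 in the interior. *)
Lemma ellE a w : ell a w = if c is regime02
  then int_bd (fun y => ker_bd a y * tr w y) else int_H (fun x => ker_H a x * fn w x).
Proof.
have N3 := N_ge3 R hn.
rewrite /ell; case ec : c; rewrite -?ec.
  apply: eq_int_bd => y; rewrite bubble_z01// -powRrM.
  have -> : (N - 2) / 2 * (2 / (N - 2)) = 1 by field; apply: lt0r_neq0; lra.
  have D0 := Dq_gt0 c (lexx 0 : 0 <= ((bdry y).2 : R)).
  rewrite /ker_bd kerE// powRr1 ?divr_ge0 ?(ltW D0)//; last by rewrite ec /nu.
  rewrite -D10_bdry powR_inv1 ?(ltW (D10_gt0 _))//.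
  by rewrite ec /nu /Dq dotp_max /= mulr0 addr0 -D10E div1r.
apply: eq_int_H => x Hx; have x0 := ltW Hx; rewrite bubble_z01// -powRrM.
have -> : (N - 2) / 2 * (4 / (N - 2)) = 2 by field; apply: lt0r_neq0; lra.
have D0 := Dq_gt0 c x0.
rewrite /ker_H kerE// powR_mulrn ?divr_ge0 ?(ltW D0)//; last by rewrite ec /nu.
rewrite ec /nu /Dq /kap mulr0 mul0r addr0 -D10E powRN powR_mulrn ?(ltW (D10_gt0 _))//.
by rewrite expr_div_n; congr (_ / _ * _ * _); ring.
Qed.

Lemma measurable_ker_bd a : measurable_fun setT (ker_bd a).
Proof.
apply: measurable_funM; last first.
  apply: continuous_measurable_rV.
  exact: continuous_compose (@continuous_bdry R n) (C1_continuous (@C1_ker R n c a)).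
apply: (measurableT_comp (measurable_powR _)).
by apply: measurable_funD => //; exact: measurable_sqnorm.
Qed.

Lemma measurable_ker_H a : measurable_fun setT (ker_H a).
Proof.
apply: measurable_funM; last first.
  by apply: continuous_measurable_pt; apply: C1_continuous; exact: C1_ker.
apply: measurable_funM => //.
by apply: (measurableT_comp (measurable_powR _)); exact: measurable_D10.
Qed.

Lemma integrable_ker_bd a w : in_Sigma w -> integrable_bd (fun y => ker_bd a y * tr w y).
Proof.
move=> Sw; apply: (integrable_bd_tr hn Sw (@measurable_ker_bd a)).
have [C hC] := @ker_le R n c a; exists C => y.
have s0 : 0 < 1 + sqnorm y by rewrite ltr_pwDl// sqnorm_ge0.
rewrite /ker_bd normrM (ger0_norm (powR_ge0 _ _)).
have := hC (bdry y) (lexx 0); rewrite D10_bdry => h.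
apply: le_trans (ler_wpM2l (powR_ge0 _ _) h) _.
rewrite mulrCA -powRD_gt0//.
by have -> : - 1 + (- (N / 2) + 1) = - (N / 2) :> R by lra.
Qed.

Lemma integrable_ker_H a w : in_Sigma w -> integrable_H (fun x => ker_H a x * fn w x).
Proof.
move=> Sw; apply: (integrable_H_fn hn Sw).
  by apply: measurable_funTS; exact: measurable_ker_H.
have [C hC] := @ker_le R n c a; exists (4 * `|C|) => x Hx.
have w0 : 0 <= 4 * D10 x `^ (- 2) by rewrite mulr_ge0 ?powR_ge0.
rewrite /ker_H normrM (ger0_norm w0).
apply: le_trans (ler_wpM2l w0 (hC x (ltW Hx))) _.
have -> : 4 * D10 x `^ (- 2) * (C * D10 x `^ (- (N / 2) + 1)) =
    4 * (C * D10 x `^ (- 2 + (- (N / 2) + 1))).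
  by rewrite (powRD_gt0 (- 2) (- (N / 2) + 1)) ?D10_gt0//; ring.
rewrite -[leRHS]mulrA ler_wpM2l//.
apply: (@le_trans _ _ (`|C| * D10 x `^ (- 2 + (- (N / 2) + 1)))).
  by rewrite ler_wpM2r ?powR_ge0// ler_norm.
by rewrite ler_wpM2l//; apply: ler_powR; [exact: D10_ge1|lra].
Qed.

(** Linearity is asked on Sigma alone: outside it the integrals behind [ell], [B] and [pairing] may
    diverge and take default values. *)
Definition Sigma_linear (F : wfun R n -> R) : Prop := forall (k : R) v w,
  in_Sigma v -> in_Sigma w -> F (k *: v + w) = k * F v + F w.

Lemma ell_linear a : Sigma_linear (ell a).
Proof.
move=> k v w Sv Sw; rewrite !ellE; case ec : c; rewrite -?ec.
  have i1 := integrable_ker_bd a Sv; have i2 := integrable_ker_bd a Sw.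
  rewrite -(int_bdZ _ i1) -(int_bdD (integrable_bdZ _ i1) i2).
  by apply: eq_int_bd => y; rewrite trE; ring.
have i1 := integrable_ker_H a Sv; have i2 := integrable_ker_H a Sw.
rewrite -(int_HZ _ i1) -(int_HD (integrable_HZ _ i1) i2).
by apply: eq_int_H => x _; rewrite fnE; ring.
Qed.

Lemma in_Sigma0 : in_Sigma (0 : wfun R n).
Proof.
have Sk := @in_Sigma_ker R n hn c ord_max.
by have := in_Sigma_lin hn (-1) Sk Sk; rewrite scaleN1r addNr.
Qed.

Lemma Sigma_linear0 (F : wfun R n -> R) : Sigma_linear F -> F 0 = 0.
Proof.
move=> lF; have := lF (-1) _ _ in_Sigma0 in_Sigma0.
by rewrite scaler0 addr0 mulN1r addNr.
Qed.

Definition ker_comb u : wfun R n := \sum_b u b *: wf (ker c b).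

Lemma Sigma_linear_comb u : in_Sigma (ker_comb u) /\
  forall F, Sigma_linear F -> F (ker_comb u) = \sum_b u b * F (wf (ker c b)).
Proof.
rewrite /ker_comb; elim: (index_enum _) => [|b s [ih1 ih2]].
  rewrite big_nil; split; first exact: in_Sigma0.
  by move=> F lF; rewrite big_nil Sigma_linear0.
have Sb := @in_Sigma_ker R n hn c b.
rewrite big_cons; split; first exact: in_Sigma_lin.
by move=> F lF; rewrite big_cons lF// ih2.
Qed.

(** At (0, t0) the translation polynomials vanish, and the dilation one is t0^2 - 1, nonzero; with
    its coefficient gone, the point (e_i, t1) isolates the coefficient of the i-th translation. *)
Lemma pol_independent u (t0 t1 : R) : t0 ^+ 2 != 1 ->
  \sum_b u b * pol b ((0, t0) : pt R n) = 0 ->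
  (forall i : 'I_n, \sum_b u b * pol b ((delta_mx ord0 i, t1) : pt R n) = 0) ->
  forall b, u b = 0.
Proof.
move=> t01 h0 h1.
have polE x : \sum_b u b * pol b x =
    \sum_(i < n) u (lift ord_max i) * (2 * x.1 ord0 i) + u ord_max * (dotp x x - 1).
  rewrite big_ord_lift; congr (_ + _); last by rewrite /pol eqxx.
  apply: eq_bigr => i _; rewrite /pol [lift _ _ == _]eq_sym (negbTE (neq_lift _ _)).
  by rewrite dotp_lift.
have umax : u ord_max = 0.
  move: h0; rewrite polE big1 => [|i _]; last by rewrite mxE !mulr0.
  rewrite add0r dotp_sqnorm /= /sqnorm big1 => [|i _]; last by rewrite mxE expr0n.
  rewrite add0r => /eqP; rewrite mulf_eq0 subr_eq0 (negbTE t01) orbF.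
  by move/eqP.
move=> b; case: (unliftP ord_max b) => [i|] -> //.
have := h1 i; rewrite polE umax mul0r addr0 (bigD1 i)//= mxE !eqxx big1.
  by rewrite addr0 mulr1 => /eqP; rewrite mulf_eq0 pnatr_eq0 orbF => /eqP.
by move=> j ji; rewrite mxE (negbTE ji) andbF !mulr0.
Qed.

Lemma kphi_neq0 : kphi R n c != 0.
Proof.
have N3 := N_ge3 R hn; apply: lt0r_neq0; rewrite /kphi mulr_gt0//; first lra.
by apply: powR_gt0; case: c.
Qed.

Lemma ker_comb0 u x : \sum_b u b * ker c b x = 0 -> \sum_b u b * pol b x = 0.
Proof.
have -> : \sum_b u b * ker c b x =
    kphi R n c * pwr (N / 2) (Dq c x) * \sum_b u b * pol b x.
  by rewrite mulr_sumr; apply: eq_bigr => b _; rewrite /ker; ring.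
have p0 : pwr (N / 2) (Dq c x) != 0 by rewrite lt0r_neq0// powR_gt0// hext_gt0.
by move=> h; apply: (mulfI (mulf_neq0 kphi_neq0 p0)); rewrite mulr0.
Qed.

Lemma tr_comb u y : tr (ker_comb u) y = \sum_b u b * ker c b (bdry y).
Proof. exact: (big_morph (fun w : wfun R n => tr w y) (id1 := 0) (op1 := +%R)). Qed.

Lemma fn_comb u x : fn (ker_comb u) x = \sum_b u b * ker c b x.
Proof. exact: (big_morph (fun w : wfun R n => fn w x) (id1 := 0) (op1 := +%R)). Qed.

Lemma continuous_comb u : continuous (fun x => \sum_b u b * ker c b x).
Proof.
apply: (@continuous_big _ _ +%R) => [|b _]; first exact: add_continuous.
move=> x; apply: cvgM; first exact: cvg_cst.
by apply: C1_continuous; exact: C1_ker.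
Qed.

Lemma continuous_D10_powR (s : R) : continuous (fun x : pt R n => D10 x `^ s).
Proof.
move=> x; apply: (@continuous_comp (pt R n) R R (@D10 R n) (fun u : R => u `^ s) x).
  exact: continuous_D10.
apply/differentiable_continuous/derivable1_diffP/derivable_powR.
by rewrite in_itv/= andbT D10_gt0.
Qed.

(* The Gram matrix of the kernel functions is positive definite: its quadratic form
   at [u] is the weighted integral of the square of the combination [ker_comb u]. *)
Lemma gram_injective u : (forall a, ell a (ker_comb u) = 0) -> forall b, u b = 0.
Proof.
move=> h; have [Su _] := Sigma_linear_comb u.
have sum0 : \sum_a u a * ell a (ker_comb u) = 0.
  by rewrite big1// => a _; rewrite h mulr0.
move: sum0; under eq_bigr do rewrite ellE.
case ec : c; rewrite -?ec.
  have i1 a := integrable_ker_bd a Su.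
  under eq_bigr do rewrite -int_bdZ//.
  rewrite -int_bd_sum; last by move=> a; exact: integrable_bdZ.
  set f := (fun y => _) => I0.
  have fE y : f y = (1 + sqnorm y) `^ (- 1) * (\sum_b u b * ker c b (bdry y)) ^+ 2.
    rewrite /f tr_comb; under eq_bigr do rewrite mulrA.
    rewrite -mulr_suml expr2 mulrA; congr (_ * _); rewrite mulr_sumr.
    by apply: eq_bigr => a _; rewrite /ker_bd; ring.
  have I1 : integrable_bd f.
    apply: integrable_sum_EFin => // a; exact: (integrable_bdZ (u a) (i1 a)).
  have w0 (y : 'rV[R]_n) : 0 < (1 + sqnorm y) `^ (- 1).
    by rewrite powR_gt0// ltr_pwDl// sqnorm_ge0.
  have cF : continuous (fun x => \sum_b u b * ker c b x) by exact: continuous_comb.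
  have cf : continuous f.
    rewrite (_ : f = (fun x => D10 x `^ (- 1) * (\sum_b u b * ker c b x) ^+ 2) \o
        @Defs.bdry R n); last by apply/funext => y; rewrite /= D10_bdry fE.
    apply: (continuous_compose (@continuous_bdry R n)) => x; apply: cvgM.
      exact: continuous_D10_powR.
    exact: continuous_sqr.
  have f0 y : 0 <= f y by rewrite fE mulr_ge0 ?sqr_ge0// ltW.
  have F0 y : \sum_b u b * pol b (bdry y) = 0.
    apply: ker_comb0; apply/eqP; rewrite -(sqrf_eq0 (\sum_b _)).
    have /eqP := int_bd_eq0 cf f0 I1 I0 y.
    by rewrite fE mulf_eq0 (negbTE (lt0r_neq0 (w0 y))).
  (* In case (0,2) the combination is known to vanish on the boundary only, which dictates t = 0. *)
  apply: (@pol_independent _ 0 0) => [||i]; last exact: F0.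
    by rewrite expr0n eq_sym oner_eq0.
  exact: (F0 0).
have i1 a := integrable_ker_H a Su.
under eq_bigr do rewrite -int_HZ//.
rewrite -int_H_sum; last by move=> a; exact: integrable_HZ.
set f := (fun y => _) => I0.
have fE x : f x = 4 * D10 x `^ (- 2) * (\sum_b u b * ker c b x) ^+ 2.
  rewrite /f fn_comb; under eq_bigr do rewrite mulrA.
  rewrite -mulr_suml expr2 mulrA; congr (_ * _); rewrite mulr_sumr.
  by apply: eq_bigr => a _; rewrite /ker_H; ring.
have I1 : integrable_H f.
  apply: (integrable_sum_EFin mH) => a; exact: (integrable_HZ (u a) (i1 a)).
have w0 (x : pt R n) : 0 < 4 * D10 x `^ (- 2).
  by rewrite mulr_gt0// powR_gt0// D10_gt0.
have cF : continuous (fun x => \sum_b u b * ker c b x) by exact: continuous_comb.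
have cf : continuous f.
  rewrite (funext fE) => x; apply: cvgM; last exact: continuous_sqr.
  by apply: cvgM; [exact: cvg_cst|exact: continuous_D10_powR].
have f0 x : H x -> 0 <= f x by move=> _; rewrite fE mulr_ge0 ?sqr_ge0// ltW.
have F0 x : H x -> \sum_b u b * pol b x = 0.
  move=> Hx; apply: ker_comb0; apply/eqP; rewrite -(sqrf_eq0 (\sum_b _)).
  have /eqP := int_H_eq0 cf f0 I1 I0 Hx.
  by rewrite fE mulf_eq0 (negbTE (lt0r_neq0 (w0 x))).
(* In case (1,0) the points must be interior, and t0 = 1 is excluded; 2 and 1 satisfy both
   conditions. *)
apply: (@pol_independent _ 2 1) => [||i]; last by apply: F0; rewrite /half_space/=.
  by rewrite -natrX (eqr_nat R 4 1).
by apply: F0; rewrite /half_space/=.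
Qed.

Lemma kernel_decomposition psi : in_Sigma psi ->
  exists u, in_Sigma01 c (psi - ker_comb u).
Proof.
move=> Sp; pose M := \matrix_(a, b) ell b (wf (ker c a)).
have M_unit : M \in unitmx.
  (* A row vector in the left kernel of the Gram matrix is a combination of kernel functions on
     which all constraints vanish. *)
  rewrite unitmxE unitfE; apply/negP => /det0P[u u0 uM].
  case/negP: u0; apply/eqP/rowP => b; rewrite mxE.
  apply: (gram_injective (u := fun b => u ord0 b)) => a.
  rewrite (Sigma_linear_comb _).2; last exact: ell_linear.
  transitivity ((u *m M) ord0 a); last by rewrite uM mxE.
  by rewrite [RHS]mxE; apply: eq_bigr => i _; rewrite [M _ _]mxE.
(* The coefficients solve d M = L, so the combination has the same constraint values as [psi]. *)
pose L := \row_a ell a psi; pose d := L *m invmx M.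
exists (fun b => d ord0 b); have [Sd hd] := Sigma_linear_comb (fun b => d ord0 b).
rewrite -scaleN1r addrC; apply/in_Sigma01P; split; first exact: in_Sigma_lin.
move=> a; rewrite ell_linear// hd; last exact: ell_linear.
rewrite mulN1r; apply/eqP; rewrite addrC subr_eq0; apply/eqP.
have /rowP/(_ a) : d *m M = L by rewrite mulmxKV.
rewrite [LHS]mxE [L _ _]mxE => <-; apply: eq_bigr => i _.
by rewrite [M _ _]mxE.
Qed.

End constraints.

(** * Extension to all of Sigma, the energy identity, and Green's formula with a converse *)

Section green.
Context (R : realType) (n : nat) (hn : (2 <= n)%N) (c : regime).
Implicit Types (v w psi X Z : wfun R n) (S g : pt R n -> R) (f p : 'rV[R]_n -> R).
Local Notation N := (n.+1%:R : R).
Local Notation H := (@half_space R n).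

Let mH := @measurable_half_space R n.

Lemma in_Sigma_sub v w : in_Sigma v -> in_Sigma w -> in_Sigma (v - w).
Proof. by move=> Sv Sw; rewrite -scaleN1r addrC; exact: in_Sigma_lin. Qed.

Lemma in_Sigma01_sub v w : in_Sigma01 c v -> in_Sigma01 c w -> in_Sigma01 c (v - w).
Proof.
move=> /(in_Sigma01P)[Sv lv] /(in_Sigma01P)[Sw lw].
apply/(in_Sigma01P); split; first exact: in_Sigma_sub.
by move=> a; rewrite -scaleN1r addrC ell_linear// lv lw mulr0 addr0.
Qed.

Lemma B_subl v w psi : in_Sigma v -> in_Sigma w -> in_Sigma psi ->
  B c (v - w) psi = B c v psi - B c w psi.
Proof.
by move=> Sv Sw Sp; rewrite -scaleN1r addrC B_linl// mulN1r addrC.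
Qed.

Lemma B_subr v w psi : in_Sigma v -> in_Sigma w -> in_Sigma psi ->
  B c psi (v - w) = B c psi v - B c psi w.
Proof. by move=> Sv Sw Sp; rewrite B_sym B_subl// !(B_sym c _ psi). Qed.

Lemma source_integrable S psi : source S -> in_Sigma psi ->
  integrable_H (fun x => S x * fn psi x).
Proof. by move=> [C hC] /hC[]. Qed.

Lemma pairing_linear S : source S -> Sigma_linear (pairing S).
Proof.
move=> hS k v w Sv Sw; have i1 := source_integrable hS Sv.
have i2 := source_integrable hS Sw.
rewrite /pairing -(int_HZ _ i1) -(int_HD (integrable_HZ _ i1) i2).
by apply: eq_int_H => x _; rewrite fnE; ring.
Qed.

Lemma pairing_ker S a : compatible c S -> pairing S (wf (ker c a)) = 0.
Proof.
move=> cS; rewrite -[RHS](cS a); apply: eq_int_H => x Hx.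
by rewrite /fn /wf /= kerE//; exact: ltW.
Qed.

(* Both sides vanish on the kernel functions, so the equation defining [L^-1 S] on
   Sigma_(0,1) extends to the whole of Sigma. *)
Lemma Linv_Sigma S Z psi : source S -> compatible c S -> is_Linv c S Z ->
  in_Sigma psi -> B c Z psi = pairing S psi.
Proof.
move=> hS cS [/(in_Sigma01P)[SZ _] hZ] Sp.
have [u /[dup] su /hZ] := kernel_decomposition hn c Sp.
have [Su lin_u] := Sigma_linear_comb hn c u.
have lB : Sigma_linear (B c Z) by move=> k v w Sv Sw; exact: B_linr.
have lS := pairing_linear hS.
rewrite -scaleN1r addrC lB// lS// (lin_u _ lB) (lin_u _ lS).
rewrite !big1 ?mulr0 ?add0r// => b _; first by rewrite pairing_ker ?mulr0.
by rewrite B_ker ?mulr0.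
Qed.

Lemma energy_identity S S' Z Z' X X' : source S -> source S' ->
  compatible c S -> compatible c S' -> is_Linv c S Z -> is_Linv c S' Z' ->
  in_Sigma X -> in_Sigma X' ->
  pairing S Z' = pairing S X' + pairing S' X - B c X X' + B c (Z - X) (Z' - X').
Proof.
move=> hS hS' cS cS' LZ LZ' SX SX'.
have [[SZ _] _] := LZ; have [[SZ' _] _] := LZ'.
rewrite B_subl ?B_subr//; try exact: in_Sigma_sub.
rewrite !(Linv_Sigma hS cS LZ)// (B_sym c X Z') (Linv_Sigma hS' cS' LZ')//.
ring.
Qed.

(** The Laplacian that the equation J w = g forces, in a form common to both regimes; [normal_of]
    does the same for the normal derivative and B_bd w = f. *)
Definition laplacian_of w g x : R :=
  - g x - (1 - kap R c) * (N * (N + 2)) * (D10 x ^- 2 * fn w x).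

Lemma J_of_laplacian w g k x : J_of c w k x = g x <-> k x = laplacian_of w g x.
Proof.
rewrite /J_of /laplacian_of; case: c; rewrite /kap.
  rewrite subrr !mul0r subr0; split => [<-|->]; by rewrite opprK.
by rewrite subr0 mul1r mulrA; split => [<-|->]; ring.
Qed.

Definition normal_of w f y : R := - f y - kap R c * N * (tr w y / (1 + sqnorm y)).

Lemma Bbd_of_normal w p f y : Bbd_of c w p y = f y <-> p y = normal_of w f y.
Proof.
rewrite /Bbd_of /normal_of; case: c; rewrite /kap.
  by split => [<-|->]; ring.
by rewrite !mul0r subr0; split => [<-|->]; rewrite opprK.
Qed.

Lemma integrable_laplacian w g psi : in_Sigma w -> in_Sigma psi ->
  integrable_H (fun x => g x * fn psi x) ->
  integrable_H (fun x => laplacian_of w g x * fn psi x) /\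
  int_H (fun x => laplacian_of w g x * fn psi x) =
  - int_H (fun x => g x * fn psi x) -
  (1 - kap R c) * (N * (N + 2)) * int_H (fun x => D10 x ^- 2 * fn w x * fn psi x).
Proof.
move=> Sw Sp ig; have iw := integrable_H_potential hn Sw Sp.
pose k : R := - ((1 - kap R c) * (N * (N + 2))).
have e x : laplacian_of w g x * fn psi x =
    -1 * (g x * fn psi x) + k * (D10 x ^- 2 * fn w x * fn psi x).
  by rewrite /laplacian_of /k; ring.
rewrite (funext e); split.
  by apply: integrable_HD; exact: integrable_HZ.
rewrite (int_HD (integrable_HZ _ ig) (integrable_HZ _ iw)) (int_HZ _ ig) (int_HZ _ iw).
by rewrite /k; ring.
Qed.

Lemma integrable_normal w f psi : in_Sigma w -> in_Sigma psi ->
  integrable_bd (fun y => f y * tr psi y) ->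
  integrable_bd (fun y => normal_of w f y * tr psi y) /\
  int_bd (fun y => normal_of w f y * tr psi y) =
  - int_bd (fun y => f y * tr psi y) -
  kap R c * N * int_bd (fun y => tr w y * tr psi y / (1 + sqnorm y)).
Proof.
move=> Sw Sp ig; have iw := integrable_bd_potential hn Sw Sp.
have e y : normal_of w f y * tr psi y =
    -1 * (f y * tr psi y) + - (kap R c * N) * (tr w y * tr psi y / (1 + sqnorm y)).
  by rewrite /normal_of; ring.
rewrite (funext e); split.
  by apply: integrable_bdD; exact: integrable_bdZ.
rewrite (int_bdD (integrable_bdZ _ ig) (integrable_bdZ _ iw)).
by rewrite (int_bdZ _ ig) (int_bdZ _ iw); ring.
Qed.

(** The weak normal derivative is Green's first identity. Solving J v = g and B_bd v = f for the
    Laplacian and the normal derivative produces potential terms that cancel those of [B]. *)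
Lemma green v g f psi : in_Sigma v -> Bbd_eq c v g f -> in_Sigma psi ->
  integrable_H (fun x => g x * fn psi x) -> integrable_bd (fun y => f y * tr psi y) ->
  B c v psi = int_H (fun x => g x * fn psi x) + int_bd (fun y => f y * tr psi y).
Proof.
move=> Sv [k [p [_ [_ _ hp] Jk Bp]]] Sp ig jf.
have [ik ek] := integrable_laplacian Sv Sp ig; have [jp ep] := integrable_normal Sv Sp jf.
have kE x : H x -> k x = laplacian_of v g x.
  by move=> Hx; apply/J_of_laplacian; exact: Jk.
have pE y : p y = normal_of v f y by apply/Bbd_of_normal; exact: Bp.
rewrite BE hp//.
- rewrite (eq_int_H (f := fun x => k x * fn psi x)
    (g := fun x => laplacian_of v g x * fn psi x)) => [|x Hx]; last by rewrite kE.
  rewrite (eq_int_bd (f := fun y => p y * tr psi y)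
    (g := fun y => normal_of v f y * tr psi y)) => [|y]; last by rewrite pE.
  by rewrite ek ep; ring.
- by apply: (eq_integrable_H _ ik) => x Hx; rewrite kE.
- by rewrite (_ : (fun y => _) = fun y => normal_of v f y * tr psi y)//;
    apply/funext => y; rewrite pE.
Qed.

Lemma C1c_half_space_bdry (phi : pt R n -> R) y : C1c H phi -> phi (bdry y) = 0.
Proof.
move=> [_ _ [K [_ KH phi0]]]; apply: phi0 => /KH.
by rewrite /half_space/= ltxx.
Qed.

Lemma B_C1c v phi : C1c H phi ->
  B c v (wf phi) = int_H (fun x => dotp (grad v x) (gradient phi x)) -
    (1 - kap R c) * (N * (N + 2) * int_H (fun x => D10 x ^- 2 * fn v x * phi x)).
Proof.
move=> Cphi; rewrite BE (eq_int_bd (g := fun=> 0)) => [|y].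
  by rewrite /int_bd /Rintegral integral0 !mulr0 subr0.
by rewrite /tr /wf /= C1c_half_space_bdry// mulr0 mul0r.
Qed.

Lemma weak_laplacian_of v g : in_Sigma v ->
  (forall phi, C1c H phi -> integrable_H (fun x => g x * phi x) /\
    B c v (wf phi) = int_H (fun x => g x * phi x)) ->
  weak_laplacian v (laplacian_of v g).
Proof.
move=> Sv h phi Cphi; have [ig Bv] := h phi Cphi.
have Sp := in_Sigma_C1c hn Cphi.
have [ik ek] := integrable_laplacian Sv Sp ig; split; first exact: ik.
move: ek; rewrite /fn /wf /= => ->; rewrite -/(fn v).
by move: Bv; rewrite B_C1c//; lra.
Qed.

Lemma B_J_eq v S phi : in_Sigma v -> source S -> J_eq c v S -> C1c H phi ->
  B c v (wf phi) = pairing S (wf phi).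
Proof.
move=> Sv hS [k kl kJ] Cphi; have [_ hk] := kl phi Cphi.
have Sp := in_Sigma_C1c hn Cphi.
have [_ ek] := integrable_laplacian Sv Sp (source_integrable hS Sp).
rewrite B_C1c// hk (eq_int_H (g := fun x => laplacian_of v S x * fn (wf phi) x)).
  by rewrite ek /pairing /fn /wf /=; ring.
by move=> x Hx; congr (_ * _); apply/J_of_laplacian; exact: kJ.
Qed.

Lemma J_eq0 v : in_Sigma v -> (forall phi, C1c H phi -> B c v (wf phi) = 0) ->
  weak_laplacian v (laplacian_of v (fun=> 0)).
Proof.
move=> Sv h; apply: weak_laplacian_of => // phi Cphi.
rewrite (_ : (fun x => 0 * phi x) = fun=> 0); last by apply/funext => x; rewrite mul0r.
split; first exact: integrable0.
by rewrite h// /int_H /Rintegral integral0.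
Qed.

Lemma integrable_laplacian_ball v (r : R) : in_Sigma v ->
  (lebesgue_pt R n).-integrable (H `&` [set x | `|x| <= r])
    (EFin \o laplacian_of v (fun=> 0)).
Proof.
move=> Sv; have mB := @measurable_cball R n r; have mHB := measurableI _ _ mH mB.
(* Truncating the potential to the ball leaves it unchanged where it matters and makes it decay, so
   [integrable_H_fn] applies. *)
pose h := (fun x : pt R n => D10 x `^ (- 2)) \_ [set x : pt R n | `|x| <= r].
have mh : measurable_fun setT h.
  apply/(measurable_restrictT _ mB)/measurable_funTS.
  by apply: (measurableT_comp (measurable_powR _)); exact: measurable_D10.
have [C hC] : exists C : R, forall x, `|h x| <= C * D10 x `^ (- (N / 2)).
  apply: (norm_le_half_weight hn (r := r) (M := 1)) => x.
    rewrite /h patchE; case: ifP => _; last by rewrite normr0.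
    rewrite ger0_norm ?powR_ge0// -[leRHS](powRr0 (D10 x)); apply: ler_powR.
      exact: D10_ge1.
    by rewrite oppr_le0.
  by move=> rx; rewrite /h patchE memNset//=; apply/negP; rewrite -ltNge.
have ih : integrable_H (fun x => h x * fn v x).
  apply: (integrable_H_fn hn Sv); first exact: measurable_funTS.
  by exists C => x _.
apply: (integrable_eq_on mHB (f := fun x =>
    - ((1 - kap R c) * (N * (N + 2))) * (h x * fn v x))).
  move=> x [Hx Bx]; rewrite /laplacian_of /h patchE mem_set//.
  by rewrite powRN powR_mulrn ?ltW ?D10_gt0//; ring.
apply: (integrableS mH mHB); first exact: subIsetl.
exact: integrable_HZ.
Qed.

Lemma measurable_rV_cball (r : R) : measurable [set y : 'rV[R]_n | `|y| <= r].
Proof.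
rewrite (_ : mkset _ = Num.Def.normr @^-1` `]-oo, r]%classic).
  have /(_ measurableT _ (measurable_itv `]-oo, r])) :=
    continuous_measurable_rV (@norm_continuous _ 'rV[R]_n).
  by rewrite setTI.
by apply/seteqP; split => y /=; rewrite in_itv.
Qed.

Lemma integrable_trace_ball v (r : R) : in_Sigma v ->
  (lebesgue_rV R n).-integrable [set y | `|y| <= r]
    (EFin \o (fun y => tr v y / (1 + sqnorm y))).
Proof.
move=> Sv; pose B := [set x : pt R n | `|x| <= r].
have mB := @measurable_cball R n r.
have bB y : (bdry y \in B) = (y \in [set y : 'rV[R]_n | `|y| <= r]).
  apply/idP/idP; rewrite !inE /B /= [`|bdry y|]prod_normE /= ge_max normr0.
    by move=> /andP[].
  by move=> yr; rewrite yr (le_trans _ yr).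
have mb := measurable_rV_cball r.
pose h := (fun x : pt R n => D10 x `^ (- 1)) \_ B.
have [C hC] : exists C : R, forall x, `|h x| <= C * D10 x `^ (- (N / 2)).
  apply: (norm_le_half_weight hn (r := r) (M := 1)) => x.
    rewrite /h patchE; case: ifP => _; last by rewrite normr0.
    rewrite ger0_norm ?powR_ge0// -[leRHS](powRr0 (D10 x)); apply: ler_powR.
      exact: D10_ge1.
    by rewrite oppr_le0.
  by move=> rx; rewrite /h patchE memNset//= /B/=; apply/negP; rewrite -ltNge.
have hE y : h (bdry y) = ((fun y => (1 + sqnorm y) `^ (- 1)) \_ [set y : 'rV[R]_n | `|y| <= r]) y.
  by rewrite /h !patchE bB D10_bdry.
have ih : integrable_bd (fun y => h (bdry y) * tr v y).
  apply: (integrable_bd_tr hn Sv); last by exists C => y; rewrite -D10_bdry.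
  rewrite (funext hE); apply/(measurable_restrictT _ mb)/measurable_funTS.
  apply: (measurableT_comp (measurable_powR _)).
  by apply: measurable_funD => //; exact: measurable_sqnorm.
apply: (integrable_eq_on mb (f := fun y => h (bdry y) * tr v y)).
  move=> y yr; rewrite hE patchE mem_set// powR_inv1 1?mulrC//.
  by rewrite addr_ge0// sqnorm_ge0.
exact: (integrableS measurableT mb _ ih).
Qed.

(** A converse of [green] without interior source: representing B(v, .) by a boundary integral on
    Sigma yields J v = 0 and B_bd v = f together. *)
Lemma Bbd_eq0 v f : in_Sigma v ->
  (forall r : R, (lebesgue_rV R n).-integrable [set y | `|y| <= r] (EFin \o f)) ->
  (forall psi, in_Sigma psi -> integrable_bd (fun y => f y * tr psi y) ->
    B c v psi = int_bd (fun y => f y * tr psi y)) ->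
  Bbd_eq c v (fun=> 0) f.
Proof.
move=> Sv loc_f hv; pose k := laplacian_of v (fun=> 0); pose p := normal_of v f.
have z0 psi : (fun x => 0 * fn psi x) = (fun=> 0 : R).
  by apply/funext => x; rewrite mul0r.
have i0 psi : integrable_H (fun x => 0 * fn psi x) by rewrite z0; exact: integrable0.
have I0 psi : int_H (fun x => 0 * fn psi x) = 0.
  by rewrite z0 /int_H /Rintegral integral0.
exists k, p; split; last 2 first.
- by move=> x _; apply/J_of_laplacian.
- by move=> y; apply/Bbd_of_normal.
(* Interior test functions vanish on the boundary, so they see only the equation J v = 0. *)
- apply: J_eq0 => // phi Cphi; have tr0 y : f y * tr (wf phi) y = 0.
    by rewrite /tr /wf /= C1c_half_space_bdry// mulr0.
  rewrite hv; last by rewrite (funext tr0); exact: integrable0.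
    by rewrite (funext tr0) /int_bd /Rintegral integral0.
  exact: (in_Sigma_C1c hn Cphi).
- split=> [r|r|psi Sp ik ip].
  + exact: integrable_laplacian_ball.
  + have mb := measurable_rV_cball r.
    apply: (integrable_eq_on mb (f := fun y => -1 * f y +
        - (kap R c * N) * (tr v y / (1 + sqnorm y)))).
      by move=> y _; rewrite /p /normal_of; ring.
    apply: (integrable_EFinD mb (integrable_EFinZ (-1) mb (loc_f r))).
    exact: (integrable_EFinZ _ mb (integrable_trace_ball r Sv)).
  (* Integrability is given for the normal derivative, whereas [hv] asks for it for [f]; they differ
     by the boundary potential, integrable on Sigma. *)
  + have jf : integrable_bd (fun y => f y * tr psi y).
      have iw := integrable_bd_potential hn Sv Sp.
      rewrite (_ : (fun y => _) = fun y => -1 * (p y * tr psi y) +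
          - (kap R c * N) * (tr v y * tr psi y / (1 + sqnorm y))).
        by apply: integrable_bdD; exact: integrable_bdZ.
      by apply/funext => y; rewrite /p /normal_of; ring.
    have [_ ek] := integrable_laplacian Sv Sp (i0 psi).
    have [_ ep] := integrable_normal Sv Sp jf.
    by have := hv psi Sp jf; rewrite BE /k /p ek ep I0; lra.
Qed.

End green.

(** * The residual Z - X, the operator R_perp, and the boundary formula *)

Section residual.
Context (R : realType) (n : nat) (hn : (2 <= n)%N) (c : regime).
Implicit Types (v psi X Z : wfun R n) (S : pt R n -> R) (b f : 'rV[R]_n -> R).
Local Notation N := (n.+1%:R : R).
Local Notation H := (@half_space R n).

Lemma bd_forcing_integrable b psi : bd_forcing b -> in_Sigma psi ->
  integrable_bd (fun y => b y * tr psi y).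
Proof. by move=> [C hC] /hC[]. Qed.

Lemma Bbd_eq_loc_integrable v S b (r : R) : in_Sigma v -> Bbd_eq c v S b ->
  (lebesgue_rV R n).-integrable [set y | `|y| <= r] (EFin \o b).
Proof.
move=> Sv [k [p [_ [_ loc_p _] _ Bp]]]; have mb := @measurable_rV_cball R n r.
apply: (integrable_eq_on mb (f := fun y => -1 * p y +
    - (kap R c * N) * (tr v y / (1 + sqnorm y)))).
  by move=> y _; have /Bbd_of_normal := Bp y; rewrite /normal_of => ->; ring.
apply: (integrable_EFinD mb (integrable_EFinZ (-1) mb (loc_p r))).
exact: (integrable_EFinZ _ mb (integrable_trace_ball hn r Sv)).
Qed.

Section single_source.
Variables (S : pt R n -> R) (Z X : wfun R n).
Hypotheses (hS : source S) (cS : compatible c S) (LZ : is_Linv c S Z).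
Hypothesis (SX : in_Sigma01 c X) (JX : J_eq c X S).

Let SigX : in_Sigma X. Proof. by case: SX. Qed.
Let SigZ : in_Sigma Z. Proof. by case: LZ => -[]. Qed.

(** Against interior test functions both B(Z, .) and B(X, .) equal the pairing with [S]. Both signs
    are recorded: the theorem speaks of Z - X, while X - Z represents R_perp. *)
Lemma J_eq_residual : J_eq c (Z - X) (fun=> 0) /\ J_eq c (X - Z) (fun=> 0).
Proof.
have BZX phi : C1c H phi -> B c Z (wf phi) = B c X (wf phi).
  move=> Cphi; rewrite (B_J_eq hn SigX hS JX Cphi).
  exact: (Linv_Sigma hn hS cS LZ (in_Sigma_C1c hn Cphi)).
split; eexists; try (by move=> x _; apply/J_of_laplacian).
  apply: (J_eq0 hn) => [|phi Cphi]; first exact: in_Sigma_sub.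
  by rewrite B_subl ?BZX ?subrr//; exact: (in_Sigma_C1c hn Cphi).
apply: (J_eq0 hn) => [|phi Cphi]; first exact: in_Sigma_sub.
by rewrite B_subl ?BZX ?subrr//; exact: (in_Sigma_C1c hn Cphi).
Qed.

Variable b : 'rV[R]_n -> R.
Hypothesis (BX : Bbd_eq c X S b).

(** Green's formula for [X] and the extended equation for [Z] have the same volume term; their
    difference is the boundary integral alone. *)
Lemma B_residual psi : in_Sigma psi -> integrable_bd (fun y => b y * tr psi y) ->
  B c (X - Z) psi = int_bd (fun y => b y * tr psi y).
Proof.
move=> Sp ib; rewrite B_subl// (Linv_Sigma hn hS cS LZ Sp).
rewrite (green hn SigX BX Sp _ ib); last exact: source_integrable.
by rewrite /pairing addrAC subrr add0r.
Qed.

Lemma Bbd_eq_residual : Bbd_eq c (X - Z) (fun=> 0) b.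
Proof.
apply: (Bbd_eq0 hn) => [|r|]; first exact: in_Sigma_sub.
  exact: (Bbd_eq_loc_integrable r SigX BX).
exact: B_residual.
Qed.

Lemma Bbd_eq_residualN : Bbd_eq c (Z - X) (fun=> 0) (fun y => - b y).
Proof.
have nE psi : (fun y => - b y * tr psi y) = fun y => -1 * (b y * tr psi y).
  by apply/funext => y; ring.
apply: (Bbd_eq0 hn) => [|r|psi Sp]; first exact: in_Sigma_sub.
  have mb := @measurable_rV_cball R n r.
  apply: (integrable_eq_on mb (f := fun y => -1 * b y)); first by move=> y _; ring.
  exact: (integrable_EFinZ (-1) mb (Bbd_eq_loc_integrable r SigX BX)).
rewrite nE => /(integrable_bdZ (-1)) ib.
have {}ib : integrable_bd (fun y => b y * tr psi y).
  by move: ib; congr integrable_bd; apply/funext => y; ring.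
rewrite (int_bdZ _ ib) -B_residual// !B_subl//; ring.
Qed.

Hypothesis (fb : bd_forcing b).

(** By [B_residual] the pairing with Phi_a is B(X - Z, Phi_a), which is zero by [B_ker]. *)
Lemma bd_compatible_forcing : bd_compatible c b.
Proof.
move=> a; have Sk := @in_Sigma_ker R n hn c a.
transitivity (int_bd (fun y => b y * tr (wf (ker c a)) y)).
  by apply: eq_int_bd => y; rewrite /tr /wf /= kerE.
rewrite -B_residual//; last exact: bd_forcing_integrable.
by rewrite B_ker//; exact: in_Sigma_sub.
Qed.

Lemma Rperp_residual : exists r, is_Rperp c b r.
Proof.
exists (tr (X - Z)); split=> //; first exact: bd_compatible_forcing.
exists (X - Z); split=> //; last exact: Bbd_eq_residual.
  by apply: (in_Sigma01_sub hn) => //; case: LZ.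
by case: J_eq_residual.
Qed.

End single_source.

Lemma bd_pairing_Rperp S S' Z Z' X X' b b' r :
  source S -> source S' -> compatible c S -> compatible c S' ->
  is_Linv c S Z -> is_Linv c S' Z' -> in_Sigma01 c X -> in_Sigma01 c X' ->
  Bbd_eq c X S b -> Bbd_eq c X' S' b' -> bd_forcing b -> bd_forcing b' ->
  is_Rperp c b' r -> bd_pairing b r = B c (Z - X) (Z' - X').
Proof.
move=> hS hS' cS cS' LZ LZ' SX SX' BX BX' fb fb' [_ _ [v [[Sv _] _ Bv ->]]].
have [[SigZ _] _] := LZ; have [[SigZ' _] _] := LZ'.
have [SigX _] := SX; have [SigX' _] := SX'.
have SW := in_Sigma_sub hn SigX SigZ; have SW' := in_Sigma_sub hn SigX' SigZ'.
rewrite /bd_pairing -(B_residual hS cS LZ SX BX)//; last exact: bd_forcing_integrable.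
have z0 psi : (fun x => 0 * fn psi x) = (fun=> 0 : R).
  by apply/funext => x; rewrite mul0r.
rewrite B_sym (green hn Sv Bv SW); last 2 first.
- by rewrite z0; exact: integrable0.
- exact: bd_forcing_integrable.
rewrite z0 {1}/int_H /Rintegral integral0 add0r.
rewrite -(B_residual hS' cS' LZ' SX' BX')//; last exact: bd_forcing_integrable.
by rewrite B_sym !B_subl ?B_subr//; try (exact: (in_Sigma_sub hn)); ring.
Qed.

(** Green's formula evaluates B(X, X') in two ways, with the source and boundary data of [X] or with
    those of [X']; inserting the mean of the two in the energy identity gives the halves and the
    minus sign. *)
Lemma pairing_Green S S' Z Z' X X' b b' :
  source S -> source S' -> compatible c S -> compatible c S' ->
  is_Linv c S Z -> is_Linv c S' Z' -> in_Sigma01 c X -> in_Sigma01 c X' ->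
  Bbd_eq c X S b -> Bbd_eq c X' S' b' -> bd_forcing b -> bd_forcing b' ->
  pairing S Z' = 2^-1 * int_H (fun x => S x * fn X' x + S' x * fn X x)
    - 2^-1 * int_bd (fun y => tr X y * b' y + tr X' y * b y)
    + B c (Z - X) (Z' - X').
Proof.
move=> hS hS' cS cS' LZ LZ' [SX _] [SX' _] BX BX' fb fb'.
rewrite (energy_identity hn hS hS' cS cS' LZ LZ' SX SX').
have iS := source_integrable hS SX'; have iS' := source_integrable hS' SX.
have ib := bd_forcing_integrable fb SX'; have ib' := bd_forcing_integrable fb' SX.
rewrite (int_HD iS iS') -!/(pairing _ _).
rewrite (eq_int_bd (g := fun y => b' y * tr X y + b y * tr X' y)); last first.
  by move=> y; ring.
rewrite (int_bdD ib' ib); have e1 := green hn SX BX SX' iS ib.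
have := green hn SX' BX' SX iS' ib'; rewrite B_sym => e2.
by rewrite -/(pairing _ _) in e1; rewrite -/(pairing _ _) in e2; lra.
Qed.

End residual.

(** Here [V] stands for the projected space: each [Z] solves its equation against every vector of
    [V], so symmetry and linearity suffice. *)
Lemma scalar_energy_identity (R : realType) (V : lmodType R) (L : V -> {scalar V})
    (S S' : {scalar V}) (Z Z' X X' : V) :
  (forall v w, L v w = L w v) -> (forall w, L Z w = S w) -> (forall w, L Z' w = S' w) ->
  S Z' = S X' + S' X - L X X' + L (Z - X) (Z' - X').
Proof.
move=> symL LZ LZ'; rewrite [L (Z - X) _]symL linearB/= (symL _ Z) (symL _ X) LZ.
by rewrite !linearB/= (symL X Z') LZ'; ring.
Qed.

Unset Implicit Arguments.
Set Strict Implicit.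

(* The space dimension is N = n.+1 >= 3. *)
Theorem lemma5p1 (R : realType) (n : nat) (hn : (2 <= n)%N) (c : regime)
    (I : Type) :
  (forall (S : I -> pt R n -> R) (Z X : I -> wfun R n),
    (forall i, source (S i)) ->
    (forall i, compatible c (S i)) ->
    (forall i, is_Linv c (S i) (Z i)) ->
    (forall i, in_Sigma01 c (X i)) ->
    [/\ forall i j,
          pairing (S i) (Z j) =
          pairing (S i) (X j) + pairing (S j) (X i) - B c (X i) (X j)
          + B c (Z i - X i) (Z j - X j),
        forall i,
          pairing (S i) (Z i) =
          2 * pairing (S i) (X i) - B c (X i) (X i)
          + B c (Z i - X i) (Z i - X i)
      & (forall i, J_eq c (X i) (S i)) ->
        (forall i, J_eq c (Z i - X i) (fun=> 0)) /\
        forall b : I -> 'rV[R]_n -> R,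
          (forall i, Bbd_eq c (X i) (S i) (b i)) ->
          (forall i, Bbd_eq c (Z i - X i) (fun=> 0) (fun y => - b i y)) /\
          ((forall i, bd_forcing (b i)) ->
            (forall i, exists r, is_Rperp c (b i) r) /\
            forall i j r, is_Rperp c (b j) r ->
              pairing (S i) (Z j) =
                2^-1 * int_H (fun x => S i x * fn (X j) x + S j x * fn (X i) x)
                - 2^-1 * int_bd (fun y => tr (X i) y * b j y
                                          + tr (X j) y * b i y)
                + bd_pairing (b i) r /\
              bd_pairing (b i) r = B c (Z i - X i) (Z j - X j))])
  /\
  (forall (V : lmodType R) (L : V -> {scalar V}) (S : I -> {scalar V})
      (Z X : I -> V),
    (forall v w, L v w = L w v) ->
    (forall i w, L (Z i) w = S i w) ->
    forall i j,
      S i (Z j) =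
      S i (X j) + S j (X i) - L (X i) (X j) + L (Z i - X i) (Z j - X j)).
Proof.
split; last first.
  by move=> V L S Z X symL LZ i j; exact: scalar_energy_identity.
move=> S Z X hS cS LZ SX; have SigX i : in_Sigma (X i) by case: (SX i).
split=> [i j|i|JX].
- exact: (energy_identity hn).
- rewrite (energy_identity hn (hS i) (hS i) _ _ (LZ i) (LZ i) (SigX i) (SigX i))//.
  by rewrite mulr2n mulrDl mul1r.
- split=> [i|b BX].
    by have [] := J_eq_residual hn (hS i) (cS i) (LZ i) (SX i) (JX i).
  split=> [i|fb].
    exact: (Bbd_eq_residualN hn (hS i) (cS i) (LZ i) (SX i) (BX i)).
  split=> [i|i j r hr].
    exact: (Rperp_residual hn (hS i) (cS i) (LZ i) (SX i) (JX i) (BX i) (fb i)).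
  have e := bd_pairing_Rperp hn (hS i) (hS j) (cS i) (cS j) (LZ i) (LZ j)
    (SX i) (SX j) (BX i) (BX j) (fb i) (fb j) hr.
  split=> //; rewrite e; exact: (pairing_Green hn).
Qed.
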